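(* Let $(\mathcal X,d,m)$ be a metric measure space satisfying volume doubling (VD), and let $\Psi=\Psi_{\beta_L,\beta}$ with $\beta_L,\beta\ge2$. Then the condition $\mathrm{CSA}(\Psi)$ is stable: if $(\mathcal E_1,\mathcal F)$ and $(\mathcal E_2,\mathcal F)$ are two strongly local regular Dirichlet forms on $L^2(\mathcal X,m)$ with the same domain $\mathcal F$ and, for some constant $C\ge 1$, $$C^{-1}\mathcal E_1(f,f)\le\mathcal E_2(f,f)\le C\,\mathcal E_1(f,f)\quad\text{for all }f\in\mathcal F,$$ then $\mathrm{CSA}(\Psi)$ holds for $(\mathcal X,\mathcal E_1)$ if and only if it holds for $(\mathcal X,\mathcal E_2)$.
   Context: Setting. $(\mathcal X,d)$ is a locally compact metric space and $m$ is a positive Radon measure on $\mathcal X$ with $\operatorname{supp}[m]=\mathcal X$. $B(x,r)$ is the ball in $(\mathcal X,d)$ and $V(x,r)=m(B(x,r))$. Functions in $\mathcal F$ are represented by quasi-continuous versions. VD: there is a constant $C_D$ with $V(x,2r)\le C_DV(x,r)$ for all $x\in\mathcal X$, $r>0$. $\Psi(r)=\Psi_{\beta_L,\beta}(r)=r^{\beta_L}$ for $0\le r\le1$ and $r^{\beta}$ for $r>1$. Energy measure of a strongly local regular Dirichlet form $(\mathcal E,\mathcal F)$. For essentially bounded $f\in\mathcal F$, $\Gamma(f,f)$ is the unique Borel measure with $\int g\,d\Gamma(f,f)=\mathcal E(f,fg)-\tfrac12\mathcal E(f^2,g)$ for all essentially bounded $g\in\mathcal F$; it is extended to all of $\mathcal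 F$ by truncation, and $\Gamma(f,g)$ is defined by polarization, so that $\mathcal E(f,g)=\int_{\mathcal X}d\Gamma(f,g)$. By strong locality $\Gamma(\varphi,\varphi)$ is also defined for functions locally in $\mathcal F$ (i.e. agreeing $m$-a.e. on each relatively compact open set with an element of $\mathcal F$). $\mathrm{CSA}(\Psi)$ for $(\mathcal X,\mathcal E)$: for open $U\subset\overline U\subset V$, a cutoff function for $U\subset V$ is a continuous function $\varphi$ (locally in $\mathcal F$, $0\le\varphi\le1$) with $\varphi=1$ on $U$ and $\varphi=0$ on $V^c$. For open $D_0\subset\overline{D_0}\subset D_1$ and $\theta>0$, with $U=D_1-\overline{D_0}$, condition $\mathrm{CSD}(D_0,D_1,\theta)$ holds if there is a cutoff function $\varphi$ for $D_0\subset D_1$ such that for all $f\in\mathcal F$ $$\int_Uf^2\,d\Gamma(\varphi,\varphi)\le\tfrac18\int_U\varphi^2\,d\Gamma(f,f)+\theta\int_Uf^2\,dm.$$ $\mathrm{CSA}(\Psi)$ holds if there is a constant $C_S$ such that $\mathrm{CSD}(B(x,R),B(x,R+r),C_S\Psi(r)^{-1})$ holds for every $x\in\mathcal X$, $R>0$, $r>0$. *)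

(* Defs.v *)
From HB Require Import structures.
From mathcomp Require Import all_boot all_order all_algebra.
From mathcomp Require Import all_classical all_reals all_analysis.

Set Implicit Arguments.
Unset Strict Implicit.
Unset Printing Implicit Defensive.

Import Order.TTheory GRing.Theory Num.Theory.
Import numFieldNormedType.Exports.

Local Open Scope classical_set_scope.
Local Open Scope ring_scope.

HB.mixin Record MeasurableMetric_isBorel (d : measure_display) (R : realType) X
    & Metric R X & Measurable d X := {
  measurable_borel : @measurable d X = <<s @open X >>
}.

(* A measurableType is pointed: these spaces are nonempty. *)
#[short(type="borelMetricType")]
HB.structure Definition BorelMetric (d : measure_display) (R : realType) :=
  {X of Metric R X & Measurable d X & MeasurableMetric_isBorel d R X}.

Section measures.
Context (d : measure_display) (R : realType) (X : borelMetricType d R).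
Implicit Types (m : {measure set X -> \bar R}).
Local Open Scope ereal_scope.

Definition radon_measure m : Prop :=
  [/\ forall K : set X, compact K -> m K < +oo,
      forall A : set X, measurable A ->
        m A = ereal_inf [set m U | U in [set U | open U /\ A `<=` U]] &
      forall U : set X, open U ->
        m U = ereal_sup [set m K | K in [set K | compact K /\ K `<=` U]]].

Definition measure_support m : set X :=
  [set x | forall U : set X, open U -> U x -> 0 < m U].

Definition volume_doubling m : Prop :=
  exists C : R, forall (x : X) (r : R), (0 < r)%R ->
    m (ball x (2 * r)%R) <= C%:E * m (ball x r).

End measures.

Definition Psi (R : realType) (betaL beta r : R) : R :=
  if r <= 1 then r `^ betaL else r `^ beta.

(* Elements of L^2(X, m) and of the domain F are represented by everywhere
   defined Borel functions, and F is saturated for equality m-a.e. *)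
Section dirichlet_forms.
Context (d : measure_display) (R : realType) (X : borelMetricType d R).
Variable m : {measure set X -> \bar R}.
Variables (F : set (X -> R)) (E : (X -> R) -> (X -> R) -> R).
Implicit Types (f g h u v phi : X -> R).

(* E_1(f, f) = E(f, f) + ||f||_{L^2}^2 *)
Definition form1 f : R := E f f + \int[m]_x (f x ^+ 2).

Record dirichlet_form : Prop := {
  dirichlet_L2 : forall f, F f -> f \in Lfun m 2%:E;
  dirichlet0 : F (cst 0);
  dirichletD : forall (a : R) f g, F f -> F g -> F (fun x => a * f x + g x);
  dirichlet_ae : forall f g, F f -> measurable_fun setT g ->
    {ae m, forall x, f x = g x} -> F g /\ forall h, F h -> E f h = E g h;
  dirichlet_dense : forall f, f \in Lfun m 2%:E -> forall e : R, 0 < e ->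
    exists2 g, F g & \int[m]_x ((f x - g x) ^+ 2) < e;
  dirichlet_sym : forall f g, F f -> F g -> E f g = E g f;
  dirichlet_linear : forall (a : R) f g h, F f -> F g -> F h ->
    E (fun x => a * f x + g x) h = a * E f h + E g h;
  dirichlet_ge0 : forall f, F f -> 0 <= E f f;
  dirichlet_closed : forall u : nat -> X -> R, (forall n, F (u n)) ->
    (forall e : R, 0 < e -> exists N : nat, forall i j : nat,
      (N <= i)%N -> (N <= j)%N -> form1 (u i \- u j) < e) ->
    exists2 f, F f & form1 (u n \- f) @[n --> \oo] --> 0;
  dirichlet_markov : forall f, F f ->
    let g := fun x => Num.min (Num.max (f x) 0) 1 in F g /\ E g g <= E f f
}.

Definition cont_compact_support : set (X -> R) :=
  [set f | continuous f /\ compact (closure [set x | f x != 0])].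

Definition regular_form : Prop :=
  (forall f, F f -> forall e : R, 0 < e ->
    exists2 g, (F `&` cont_compact_support) g & form1 (f \- g) < e) /\
  (forall f, cont_compact_support f -> forall e : R, 0 < e ->
    exists2 g, (F `&` cont_compact_support) g & forall x, `|f x - g x| < e).

(* The support of the measure |u| m. *)
Definition ae_support u : set X :=
  [set x | forall U : set X, open U -> U x ->
    ~ {ae m, forall y, U y -> u y = 0}].

Definition strongly_local : Prop :=
  forall u v, F u -> F v -> compact (ae_support u) -> compact (ae_support v) ->
  (exists (W : set X) (c : R), [/\ open W, ae_support u `<=` W &
     {ae m, forall x, W x -> v x = c}]) ->
  E u v = 0.

Definition capacity (A : set X) : \bar R :=
  ereal_inf [set (form1 u)%:E | u in [set u | F u /\
    exists W : set X, [/\ open W, A `<=` W &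
      {ae m, forall x, W x -> 1 <= u x}]]].

Definition quasi_continuous u : Prop :=
  forall e : R, 0 < e -> exists G : set X,
    [/\ open G, (capacity G < e%:E)%E & {within ~` G, continuous u}].

Definition ess_bounded f : Prop :=
  exists M : R, {ae m, forall x, `|f x| <= M}.

(* "The" Borel measure with property P; null if there is none. *)
Definition the_measure (P : {measure set X -> \bar R} -> Prop) :
    {measure set X -> \bar R} :=
  if pselect (exists mu, P mu) is left exP then sval (cid exP) else mzero.

(* Gamma(f, f) for essentially bounded f in F.  The test functions are
   quasi-continuous because Gamma(f, f) may charge m-null sets. *)
Definition energy_measure_bounded f : {measure set X -> \bar R} :=
  the_measure (fun mu => forall g, F g -> quasi_continuous g -> ess_bounded g ->
    (\int[mu]_x (g x)%:E =
      (E f (f \* g) - 2^-1 * E (fun x => f x ^+ 2) g)%:E)%E).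

Definition truncation (n : nat) f : X -> R :=
  fun x => Num.max (- n%:R) (Num.min (f x) n%:R).

(* Gamma(f, f) for all f in F, by truncation. *)
Definition energy_measure f : {measure set X -> \bar R} :=
  the_measure (fun mu => forall A : set X, measurable A ->
    energy_measure_bounded (truncation n f) A @[n --> \oo] --> mu A).

Definition locally_in_domain phi : Prop :=
  forall G : set X, open G -> precompact G ->
    exists2 h, F h & {ae m, forall x, G x -> phi x = h x}.

(* Gamma(phi, phi) for phi locally in F, glued from the restrictions to
   relatively compact open sets; well defined by strong locality. *)
Definition local_energy_measure phi : {measure set X -> \bar R} :=
  the_measure (fun mu => forall (G : set X) h, open G -> precompact G -> F h ->
    {ae m, forall x, G x -> phi x = h x} ->
    forall A : set X, measurable A -> A `<=` G -> mu A = energy_measure h A).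

Definition cutoff (U V : set X) phi : Prop :=
  [/\ continuous phi, locally_in_domain phi, forall x, 0 <= phi x <= 1,
      forall x, U x -> phi x = 1 & forall x, ~ V x -> phi x = 0].

(* The quantifier on f runs over the quasi-continuous versions of elements
   of F. *)
Definition CSD (D0 D1 : set X) (theta : R) : Prop :=
  exists2 phi, cutoff D0 D1 phi &
    let U := D1 `\` closure D0 in
    forall f, F f -> quasi_continuous f ->
      (\int[local_energy_measure phi]_(x in U) (f x ^+ 2)%:E <=
       (8^-1)%:E * \int[energy_measure f]_(x in U) (phi x ^+ 2)%:E +
       theta%:E * \int[m]_(x in U) (f x ^+ 2)%:E)%E.

Definition CSA (Psi : R -> R) : Prop :=
  exists2 CS : R, 0 < CS & forall (x : X) (rho r : R), 0 < rho -> 0 < r ->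
    CSD (ball x rho) (ball x (rho + r)) (CS * (Psi r)^-1).

End dirichlet_forms.

(* Main.v *)
(* Comparability of the forms passes to the energy measures: if f_n is f folded
   into an interval of length 2^-n, then E(f_n k, f_n k) tends to the integral of
   k^2 against Gamma(f, f), since folding preserves Gamma and f_n tends to 0; hence
   E2 <= C E1 implies Gamma2 <= C Gamma1.  Replacing E1 by E2 in CSD therefore
   multiplies the constant 1/8 by C^2, and it suffices to show that under CSA the
   constant 1/8 can be replaced by an arbitrarily small one.

   Take cutoff functions phi_n for B(x, rho_n) in B(x, rho_(n+1)), where
   rho_n = rho + r (1 - t^n), and set phi = sum_n (1 - q) q^n psi_n, where psi_n is
   a steepening of phi_n.  On the n-th annulus phi = (1 - q) q^n psi_n + q^(n+1), so
   Gamma(phi, phi) = (1 - q)^2 q^(2n) Gamma(psi_n, psi_n) there, whereas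
   phi^2 >= q^(2n+2): the constant 1/8 is multiplied by 4 ((1 - q) / q)^2, which is
   small for q close to 1.  As Psi (l r) >= l^gamma Psi r for l <= 1, where
   gamma = max(beta_L, beta), the choice t^gamma = q keeps the factors of the
   integrals of f^2 bounded by a multiple of 1 / Psi r.

   The energy measure of a bounded f is the Daniell extension of the functional
   g |-> E(f, f g) - E(f^2, g) / 2 on the continuous elements of F with compact
   support.  It is dominated by capacity, whence the formula for
   quasi-continuous g. *)
From HB Require Import structures.
Require Import Defs.
From mathcomp Require Import all_boot all_order all_algebra.
From mathcomp Require Import all_classical all_reals all_analysis.
From mathcomp Require Import measurable_realfun ring lra.
Import Order.TTheory GRing.Theory Num.Theory.
Import numFieldNormedType.Exports.
Local Open Scope classical_set_scope.
Local Open Scope ring_scope.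
Set Implicit Arguments.
Unset Strict Implicit.
Unset Printing Implicit Defensive.

(** * Dirichlet forms and truncations *)

(** Neither a chain rule nor a Leibniz rule for the energy measures is given, and the two forms are
    compared through E(f, f) alone. The calculus is therefore built from two facts: the Markov
    property, which gives E(p, f - p) >= 0 for a clip p of f, and strong locality, which makes E(p,
    q) vanish when p is constant on {q != 0}. Cutting the range of f into thin slices makes the
    higher-order errors disappear; this yields the fourth-order identity behind the product formula,
    the invariance of Gamma under folding, and the equality of the Daniell integral with the
    functional it extends. Positivity is known first on squares k^2 only, and square roots of
    functions of F need not lie in F: a series of tent maps bridges this gap. The measures in the
    statement are chosen with the zero measure as default, so existence has to be proved before any
    defining property can be used. CSD controls energy on an open annulus but not on its bounding
    spheres, which is why the cutoff functions are made constant near these before being summed. *)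

Section square_integrable.
Context {d : measure_display} {R : realType} {X : measurableType d}.
Variable m : {measure set X -> \bar R}.
Implicit Types f g : X -> R.

Definition sqint f : Prop :=
  measurable_fun setT f /\ m.-integrable setT (EFin \o (fun x => f x ^+ 2)).

Definition sqn f : R := \int[m]_x (f x ^+ 2).

Lemma Lfun2_sqint f : f \in Lfun m 2%:E -> sqint f.
Proof.
move=> fL; split.
  by have := sub_Lfun_mfun fL; rewrite inE.
have /Lfun_integrable : (1 <= 2 :> R) by lra.
move=> /(_ _ _ m f fL); congr (integrable _ _ _); apply/funext => x /=.
by rewrite powR_mulrn// real_normK// num_real.
Qed.

Lemma sqint_le f g : measurable_fun setT f -> (forall x, `|f x| <= `|g x|) ->
  sqint g -> sqint f.
Proof.
move=> mf fg [mg ig]; split=> //.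
apply: le_integrable ig => //.
  by apply/measurable_EFinP; apply: measurable_funX.
move=> x _ /=; rewrite lee_fin !normrX.
by apply: lerXn2r; rewrite ?nnegrE.
Qed.

Lemma sqintZ (a : R) f : sqint f -> sqint (fun x => a * f x).
Proof.
move=> [mf intf]; split; first exact: measurable_funM.
rewrite [X in _.-integrable _ X](_ : _ =
  (fun x => (a ^+ 2)%:E * (f x ^+ 2)%:E)%E); first exact: integrableZl.
by apply/funext => x /=; rewrite exprMn EFinM.
Qed.

Lemma sqintD f g : sqint f -> sqint g -> sqint (f \+ g).
Proof.
move=> Hf Hg; have mfg : measurable_fun setT (f \+ g).
  by case: Hf Hg => mf _ [mg _]; exact: measurable_funD.
split=> //; have [_ If] := Hf; have [_ Ig] := Hg.
apply: (@le_integrable _ _ _ m _ _ _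
  (fun x => (2 * f x ^+ 2)%:E + (2 * g x ^+ 2)%:E)%E) => //.
- by apply/measurable_EFinP; apply: measurable_funX.
- move=> x _ /=; rewrite lee_fin ger0_norm ?sqr_ge0// ger0_norm.
    have := sqr_ge0 (f x - g x); nra.
  by rewrite addr_ge0// mulr_ge0// sqr_ge0.
- by apply: integrableD => //=; under eq_fun do rewrite EFinM;
    exact: integrableZl.
Qed.

Lemma sqintB f g : sqint f -> sqint g -> sqint (f \- g).
Proof.
move=> Hf Hg; have := sqintD Hf (sqintZ (-1) Hg).
by congr sqint; apply/funext => x /=; rewrite mulN1r.
Qed.

Lemma sqn_ge0 f : 0 <= sqn f.
Proof. by apply: Rintegral_ge0 => x _; exact: sqr_ge0. Qed.

Lemma sqnZ (a : R) f : sqint f -> sqn (fun x => a * f x) = a ^+ 2 * sqn f.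
Proof.
move=> [mf If]; rewrite /sqn -RintegralZl//.
by apply: eq_Rintegral => x _; rewrite exprMn.
Qed.

Lemma sqn_le f g : sqint g -> measurable_fun setT f ->
  (forall x, `|f x| <= `|g x|) -> sqn f <= sqn g.
Proof.
move=> Hg mf fg; apply: le_Rintegral => //.
- by have [] := sqint_le mf fg Hg.
- by case: Hg.
- move=> x _; rewrite -[f x ^+ 2]ger0_norm ?sqr_ge0//.
  rewrite -[g x ^+ 2]ger0_norm ?sqr_ge0// !normrX.
  by apply: lerXn2r; rewrite ?nnegrE.
Qed.

Lemma sqnD f g : sqint f -> sqint g -> sqn (f \+ g) <= 2 * sqn f + 2 * sqn g.
Proof.
move=> Hf Hg; have Hfg := sqintD Hf Hg.
have [_ If] := Hf; have [_ Ig] := Hg; rewrite -!RintegralZl//.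
have I2 h : sqint h -> m.-integrable setT (EFin \o (fun x => 2 * h x ^+ 2)).
  by move=> [_ Ih]; rewrite /comp; under eq_fun do rewrite EFinM;
    exact: integrableZl.
rewrite -RintegralD ?I2//; apply: le_Rintegral => //.
- by case: Hfg.
- rewrite (_ : EFin \o _ = (fun x => (2 * f x ^+ 2)%:E + (2 * g x ^+ 2)%:E)%E)//.
  by apply: integrableD => //; apply: I2.
- by move=> x _ /=; have := sqr_ge0 (f x - g x); nra.
Qed.

Lemma sqnB f g : sqint f -> sqint g -> sqn (f \- g) <= 2 * sqn f + 2 * sqn g.
Proof.
move=> Hf Hg; have := sqnD Hf (sqintZ (-1) Hg).
rewrite sqnZ// sqrrN expr1n mul1r; congr (sqn _ <= _).
by apply/funext => x /=; rewrite mulN1r.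
Qed.

Lemma sqn_ae0 f : sqint f -> sqn f = 0 -> {ae m, forall x, f x = 0}.
Proof.
move=> [mf If] f0.
have : (\int[m]_x `|(f x ^+ 2)%:E| = 0)%E.
  have -> : (\int[m]_x `|(f x ^+ 2)%:E| = \int[m]_x (f x ^+ 2)%:E)%E.
    by apply: eq_integral => x _; rewrite gee0_abs// lee_fin sqr_ge0.
  rewrite -[LHS]fineK; first by rewrite -[fine _]/(sqn f) f0.
  exact: integrable_fin_num.
move/ae_eq_integral_abs => /(_ measurableT) H.
have /H : measurable_fun setT (fun x => (f x ^+ 2)%:E).
  by apply/measurable_EFinP; apply: measurable_funX.
apply: filterS => x /(_ I) [] /eqP.
by rewrite sqrf_eq0 => /eqP.
Qed.

Lemma sqn_eq_ae f g : sqint f -> measurable_fun setT g ->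
  {ae m, forall x, f x = g x} -> sqn f = sqn g.
Proof.
move=> [mf If] mg fg; congr fine; apply: ae_eq_integral => //.
- by apply/measurable_EFinP; apply: measurable_funX.
- by apply/measurable_EFinP; apply: measurable_funX.
- by apply: filterS fg => x /= -> _.
Qed.

End square_integrable.

Lemma cvg0_le (R : realType) (a b : nat -> R) :
  (forall n, `|a n| <= b n) -> b n @[n --> \oo] --> 0 -> a n @[n --> \oo] --> 0.
Proof.
move=> ab b0; apply/norm_cvg0P.
apply: (@squeeze_cvgr _ _ _ _ (fun=> 0) b) => //; last exact: cvg_cst.
by apply: nearW => n; rewrite ab normr_ge0.
Qed.

Lemma le_of_cvg0 (R : realType) (a : R) (b : nat -> R) :
  (forall n, a <= b n) -> b n @[n --> \oo] --> 0 -> a <= 0.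
Proof.
move=> ab b0; apply: (cvgr_to_ge b0).
by apply: nearW => n.
Qed.

Lemma cvg_same (R : realType) (a : nat -> R) (x y : R) :
  a n @[n --> \oo] --> x -> a n @[n --> \oo] --> y -> x = y.
Proof.
move=> ax ay; apply/le_anti/andP; split.
  by apply: (ler_cvg_to ax ay); apply: nearW.
by apply: (ler_cvg_to ay ax); apply: nearW.
Qed.

Lemma cvg0Z (R : realType) (k : R) (a : nat -> R) :
  a n @[n --> \oo] --> 0 -> k * a n @[n --> \oo] --> 0.
Proof. by move=> a0; rewrite -(mulr0 k); exact: cvgMl_tmp. Qed.

Lemma cvg0D (R : realType) (a b : nat -> R) : a n @[n --> \oo] --> 0 ->
  b n @[n --> \oo] --> 0 -> a n + b n @[n --> \oo] --> 0.
Proof. by move=> a0 b0; rewrite -(addr0 0); exact: cvgD. Qed.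

Lemma quad_disc (R : realType) (a b c : R) : 0 <= c ->
  (forall t, 0 <= a - 2 * t * b + t ^+ 2 * c) -> b ^+ 2 <= a * c.
Proof.
move=> c0 H; have [c1|] := ltrP 0 c.
  have := H (b / c); rewrite -(ler_pM2r c1) mul0r.
  rewrite [X in 0 <= X](_ : _ = a * c - b ^+ 2) ?subr_ge0//.
  by field; rewrite gt_eqF.
move=> c2; have c3 : c = 0 by lra.
rewrite {c0 c2}c3 in H *.
have [->|b0] := eqVneq b 0; first by rewrite expr0n/= mulr0.
(* For c = 0 the expression is affine in t, and this t gives it the value -1. *)
have := H ((a + 1) / (2 * b)).
rewrite [X in 0 <= X](_ : _ = -1); first by rewrite ler0N1.
by rewrite mulr0 addr0; field.
Qed.

(** * Hilbert space calculus of a Dirichlet form *)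

Section markov.
Context {d : measure_display} {R : realType} {X : borelMetricType d R}.
Variable m : {measure set X -> \bar R}.
Variables (F : set (X -> R)) (E : (X -> R) -> (X -> R) -> R).
Hypothesis hD : dirichlet_form m F E.
Implicit Types (f g h u v w : X -> R) (a c e : R).

Lemma domD f g : F f -> F g -> F (f \+ g).
Proof.
move=> Ff Fg; rewrite (_ : _ \+ _ = fun x => 1 * f x + g x).
  exact: dirichletD hD _ _ _ Ff Fg.
by apply/funext => x /=; rewrite mul1r.
Qed.

Lemma domZ a f : F f -> F (fun x => a * f x).
Proof.
move=> Ff; rewrite (_ : (fun _ => _) = fun x => a * f x + cst 0 x).
  by apply: (dirichletD hD _ Ff); exact: dirichlet0 hD.
by apply/funext => x /=; rewrite addr0.
Qed.

Lemma domB f g : F f -> F g -> F (f \- g).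
Proof.
move=> Ff Fg; rewrite (_ : _ \- _ = fun x => (-1) * g x + f x).
  exact: dirichletD hD _ _ _ Fg Ff.
by apply/funext => x /=; lra.
Qed.

Lemma dom_sqint f : F f -> sqint m f.
Proof. by move/(dirichlet_L2 hD); exact: Lfun2_sqint. Qed.

Lemma dom_measurable f : F f -> measurable_fun setT f.
Proof. by case/dom_sqint. Qed.

Lemma formC f g : F f -> F g -> E f g = E g f.
Proof. exact: dirichlet_sym hD f g. Qed.

Lemma formDl f g h : F f -> F g -> F h -> E (f \+ g) h = E f h + E g h.
Proof.
move=> Ff Fg Fh; rewrite -[E f h]mul1r -(dirichlet_linear hD)//.
by congr E; apply/funext => x /=; rewrite mul1r.
Qed.

Lemma form0l h : F h -> E (cst 0) h = 0.
Proof.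
move=> Fh; have F0 := dirichlet0 hD.
have := formDl F0 F0 Fh; rewrite (_ : _ \+ _ = cst 0); first by lra.
by apply/funext => x /=; rewrite addr0.
Qed.

Lemma formZl a f h : F f -> F h -> E (fun x => a * f x) h = a * E f h.
Proof.
move=> Ff Fh; have F0 := dirichlet0 hD.
rewrite -[RHS]addr0 -(form0l Fh) -(dirichlet_linear hD)//.
by congr E; apply/funext => x /=; rewrite addr0.
Qed.

Lemma formBl f g h : F f -> F g -> F h -> E (f \- g) h = E f h - E g h.
Proof.
move=> Ff Fg Fh; have -> : f \- g = (fun x => (-1) * g x + f x).
  by apply/funext => x /=; lra.
by rewrite (dirichlet_linear hD)//; lra.
Qed.

Lemma formDr f g h : F f -> F g -> F h -> E h (f \+ g) = E h f + E h g.
Proof.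
move=> Ff Fg Fh; rewrite !(formC Fh)// ?formDl//; exact: domD.
Qed.

Lemma formBr f g h : F f -> F g -> F h -> E h (f \- g) = E h f - E h g.
Proof.
move=> Ff Fg Fh; rewrite !(formC Fh)// ?formBl//; exact: domB.
Qed.

Lemma formZr a f h : F f -> F h -> E h (fun x => a * f x) = a * E h f.
Proof.
move=> Ff Fh; rewrite !(formC Fh)// ?formZl//; exact: domZ.
Qed.

Lemma formD2 f g : F f -> F g ->
  E (f \+ g) (f \+ g) = E f f + 2 * E f g + E g g.
Proof.
move=> Ff Fg; have Ffg := domD Ff Fg.
by rewrite formDl// !formDr// (formC Fg Ff); lra.
Qed.

Lemma formB2 f g : F f -> F g ->
  E (f \- g) (f \- g) = E f f - 2 * E f g + E g g.
Proof.
move=> Ff Fg; have Ffg := domB Ff Fg.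
by rewrite formBl// !formBr// (formC Fg Ff); lra.
Qed.

Lemma formZ2 a f : F f -> E (fun x => a * f x) (fun x => a * f x) =
  a ^+ 2 * E f f.
Proof.
by move=> Ff; rewrite formZl ?formZr//; [rewrite mulrA | exact: domZ].
Qed.

Lemma form_cs u v : F u -> F v -> E u v ^+ 2 <= E u u * E v v.
Proof.
move=> Fu Fv; apply: quad_disc; first exact: dirichlet_ge0 hD _ Fv.
move=> t; have := dirichlet_ge0 hD (domB Fu (domZ t Fv)).
by rewrite formB2 ?formZ2 ?formZr//; [lra | exact: domZ].
Qed.

Definition enorm u : R := Num.sqrt (E u u).

Lemma enorm_ge0 u : 0 <= enorm u. Proof. exact: sqrtr_ge0. Qed.

Lemma enorm2 u : F u -> enorm u ^+ 2 = E u u.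
Proof. by move=> Fu; rewrite sqr_sqrtr// (dirichlet_ge0 hD). Qed.

Lemma form_le_enorm u v : F u -> F v -> `|E u v| <= enorm u * enorm v.
Proof.
move=> Fu Fv; rewrite -(@ler_pXn2r _ 2)// ?nnegrE ?mulr_ge0 ?enorm_ge0//.
by rewrite exprMn !enorm2// real_normK ?num_real// form_cs.
Qed.

Lemma enormD u v : F u -> F v -> enorm (u \+ v) <= enorm u + enorm v.
Proof.
move=> Fu Fv; rewrite -(@ler_pXn2r _ 2)// ?nnegrE ?addr_ge0 ?enorm_ge0//.
rewrite enorm2 ?formD2//; last exact: domD.
have := form_le_enorm Fu Fv; have := ler_norm (E u v).
by rewrite -!enorm2//; nra.
Qed.

Lemma enormZ a u : F u -> enorm (fun x => a * u x) = `|a| * enorm u.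
Proof. by move=> Fu; rewrite /enorm formZ2// sqrtrM ?sqr_ge0// sqrtr_sqr. Qed.

Lemma enormB u v : F u -> F v -> enorm (u \- v) <= enorm u + enorm v.
Proof.
move=> Fu Fv; have := enormD Fu (domZ (-1) Fv).
rewrite enormZ// normrN1 mul1r; congr (enorm _ <= _).
by apply/funext => x /=; lra.
Qed.

Lemma enorm_le u c : 0 <= c -> E u u <= c ^+ 2 -> enorm u <= c.
Proof.
by move=> c0 H; rewrite -[leRHS]ger0_norm// -sqrtr_sqr ler_wsqrtr.
Qed.

Lemma form_ae f g h : F f -> measurable_fun setT g -> F h ->
  {ae m, forall x, f x = g x} -> E f h = E g h.
Proof. by move=> Ff mg Fh fg; have [_ ->] := dirichlet_ae hD Ff mg fg. Qed.

Lemma form_ae2 f g : F f -> measurable_fun setT g ->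
  {ae m, forall x, f x = g x} -> E f f = E g g.
Proof.
move=> Ff mg fg; have [Fg H] := dirichlet_ae hD Ff mg fg.
by rewrite H// formC// H.
Qed.

(** Closedness only provides some limit. The L^2 limit [v] agrees with it almost everywhere, and the
    saturation of [F] transfers membership and convergence to [v] itself. *)
Lemma form_closed (u : nat -> X -> R) v : (forall n, F (u n)) -> sqint m v ->
  (forall e, 0 < e -> exists N, forall i j, (N <= i)%N -> (N <= j)%N ->
     E (u i \- u j) (u i \- u j) < e) ->
  sqn m (u n \- v) @[n --> \oo] --> 0 ->
  F v /\ E (u n \- v) (u n \- v) @[n --> \oo] --> 0.
Proof.
move=> Fu L2v EC uv.
have L2u n := dom_sqint (Fu n).
have [f Ff fl] : exists2 f, F f & form1 m E (u n \- f) @[n --> \oo] --> 0.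
  apply: (dirichlet_closed hD) => // e e0.
  have e2 : 0 < e / 2 by lra.
  have [N1 N1P] := EC _ e2.
  have e8 : 0 < e / 8 by lra.
  move/cvgrPdist_lt : uv => /(_ _ e8)[N2 _ N2P].
  exists (maxn N1 N2) => i j; rewrite !geq_max => /andP[i1 i2] /andP[j1 j2].
  have := N1P _ _ i1 j1.
  have := N2P _ i2; have := N2P _ j2; rewrite /= !sub0r !normrN.
  rewrite !ger0_norm ?sqn_ge0// => Hj Hi HE.
  have : sqn m (u i \- u j) <= 2 * sqn m (u i \- v) + 2 * sqn m (u j \- v).
    rewrite (_ : u i \- u j = (u i \- v) \- (u j \- v)).
      by apply: sqnB; apply: sqintB.
    by apply/funext => x /=; lra.
  by rewrite /form1 -/(sqn _ _); lra.
have L2f := dom_sqint Ff.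
have pos n : 0 <= E (u n \- f) (u n \- f).
  by apply: (dirichlet_ge0 hD); exact: domB.
have Efl : E (u n \- f) (u n \- f) @[n --> \oo] --> 0.
  apply: cvg0_le fl => n; rewrite ger0_norm//.
  by rewrite /form1 lerDl sqn_ge0.
have sfl : sqn m (u n \- f) @[n --> \oo] --> 0.
  apply: cvg0_le fl => n; rewrite ger0_norm ?sqn_ge0//.
  by rewrite /form1 lerDr.
have sfv : sqn m (f \- v) = 0.
  apply/eqP; rewrite eq_le sqn_ge0 andbT.
  apply: (@le_of_cvg0 _ _ (fun n => 2 * sqn m (u n \- v) + 2 * sqn m (u n \- f))).
    move=> n; rewrite (_ : f \- v = (u n \- v) \- (u n \- f)).
      by apply: sqnB; apply: sqintB.
    by apply/funext => x /=; lra.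
  by apply: cvg0D; exact: cvg0Z.
have fv : {ae m, forall x, f x = v x}.
  apply: filterS (sqn_ae0 (sqintB L2f L2v) sfv) => x /= /eqP.
  by rewrite subr_eq0 => /eqP.
have mv : measurable_fun setT v by case: L2v.
split; first by have [] := dirichlet_ae hD Ff mv fv.
rewrite (_ : (fun n => _) = (fun n => E (u n \- f) (u n \- f)))//.
apply/funext => n; symmetry; apply: form_ae2; first exact: domB.
  by apply: measurable_funB => //; exact: dom_measurable.
by apply: filterS fv => x /= ->.
Qed.

End markov.

Lemma lin_quad_ge0 (R : realType) (b c : R) : 0 <= c ->
  (forall t, 0 < t -> t <= 1 -> 0 <= 2 * t * b + t ^+ 2 * c) -> 0 <= b.
Proof.
move=> c0 H; rewrite leNgt; apply/negP => b0.
have cb : 0 < c - b by lra.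
(* At this t one has 2 b + t c = (1 + t) b, which is negative with b. *)
have t0 : 0 < - b / (c - b) by apply: divr_gt0 => //; lra.
have t1 : - b / (c - b) <= 1 by rewrite ler_pdivrMr// mul1r; lra.
have := H _ t0 t1; set t := - b / (c - b) in t0 t1 *.
have tE : t * (c - b) = - b by rewrite /t mulfVK// gt_eqF.
have tc : t * c = - b + t * b by lra.
have -> : t ^+ 2 * c = t * (t * c) by ring.
rewrite tc (_ : _ + _ = t * (b + t * b)); last by ring.
by rewrite pmulr_rge0//; nra.
Qed.

Definition clip (T : Type) (R : realType) (a : R) (f : T -> R) : T -> R :=
  fun x => Num.min (Num.max (f x) 0) a.

(** Case analysis on [clip] leaves linear inequalities, which [lra] settles; many pointwise
    identities below are proved in this way. *)
Variant clip_spec (R : realType) (a y : R) : R -> Type :=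
| ClipLow of y < 0 : clip_spec a y 0
| ClipMid of 0 <= y & y <= a : clip_spec a y y
| ClipHigh of a < y : clip_spec a y a.

Lemma clipP (T : Type) (R : realType) (a : R) (f : T -> R) x : 0 < a ->
  clip_spec a (f x) (clip a f x).
Proof.
rewrite /clip => a0; have [f0|f0] := ltP (f x) 0.
  by rewrite min_l ?ltW//; exact: ClipLow.
have [fa|fa] := leP (f x) a; first exact: ClipMid.
exact: ClipHigh.
Qed.

Lemma clip_clip (T : Type) (R : realType) (a b : R) (f : T -> R) :
  0 < b -> b <= a -> clip b (clip a f) = clip b f.
Proof.
move=> b0 ba; have a0 : 0 < a by lra.
apply/funext => x; have := clipP (clip a f) x b0.
have := clipP f x b0; have := clipP f x a0.
by move=> [?|? ?|?] [?|? ?|?] [?|? ?|?]; lra.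
Qed.

(** * Clipping, reflection and weak convergence *)

Section truncations.
Context {d : measure_display} {R : realType} {X : borelMetricType d R}.
Variable m : {measure set X -> \bar R}.
Variables (F : set (X -> R)) (E : (X -> R) -> (X -> R) -> R).
Hypothesis hD : dirichlet_form m F E.
Implicit Types (f g h v w : X -> R) (u : nat -> X -> R) (a c e M K : R).

Local Notation enorm := (enorm E).
Let domD := domD hD.
Let domB := domB hD.
Let domZ := domZ hD.

Lemma clip_dom a f : 0 < a -> F f ->
  F (clip a f) /\ E (clip a f) (clip a f) <= E f f.
Proof.
move=> a0 Ff; have [] := dirichlet_markov hD (domZ a^-1 Ff).
set g := (fun x => Num.min _ _) => Fg Eg.
have -> : clip a f = fun x => a * g x.
  apply/funext => x; rewrite /clip /g minr_pMr ?ltW// maxr_pMr ?ltW//.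
  by rewrite mulr1 mulr0 mulrA mulfV ?gt_eqF// mul1r.
split; first exact: domZ.
rewrite (formZ2 hD)//; move: Eg; rewrite (formZ2 hD)// exprVn => Eg.
by rewrite mulrC -ler_pdivlMr ?exprn_gt0// mulrC.
Qed.

(** With p the clip of f and q = f - p, the function p + t q is clipped to p for every t in [0, 1].
    By the Markov property t = 0 minimizes E(p + t q, p + t q) there, so the derivative 2 E(p, q) at
    0 is nonnegative. *)
Lemma clip_cross a f : 0 < a -> F f -> 0 <= E (clip a f) (f \- clip a f).
Proof.
move=> a0 Ff; have [Fp _] := clip_dom a0 Ff.
set p := clip a f in Fp *; have Fq := domB Ff Fp; set q := f \- p in Fq *.
apply: (@lin_quad_ge0 _ _ (E q q)); first exact: (dirichlet_ge0 hD).
move=> t t0 t1; have Ftq := domZ t Fq.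
have [_] := clip_dom a0 (domD Fp Ftq).
have -> : clip a (p \+ (fun x => t * q x)) = p.
  apply/funext => x; have := clipP (p \+ (fun x => t * q x)) x a0.
  rewrite /q /p/=; have := clipP f x a0.
  by case=> [? []|? ? []|? []] => *; nra.
by rewrite (formD2 hD)// (formZ2 hD)// (formZr hD)//; lra.
Qed.

Lemma clip_split a f : 0 < a -> F f ->
  E (clip a f) (clip a f) + E (f \- clip a f) (f \- clip a f) <= E f f.
Proof.
move=> a0 Ff; have [Fp _] := clip_dom a0 Ff; have := clip_cross a0 Ff.
set p := clip a f in Fp *; have Fq := domB Ff Fp; set q := f \- p in Fq *.
have -> : f = p \+ q by apply/funext => x; rewrite /q/=; lra.
by rewrite (formD2 hD)//; lra.
Qed.

(** The function p - q is f reflected at the levels 0 and a. Its energy differs from that of f = p +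
    q only by the sign of the cross term. *)
Lemma clip_reflect a f : 0 < a -> F f ->
  E (clip a f \- (f \- clip a f)) (clip a f \- (f \- clip a f)) <= E f f.
Proof.
move=> a0 Ff; have [Fp _] := clip_dom a0 Ff; have := clip_cross a0 Ff.
set p := clip a f in Fp *; have Fq := domB Ff Fp; set q := f \- p in Fq *.
have -> : f = p \+ q by apply/funext => x; rewrite /q/=; lra.
move=> pq; rewrite (formD2 hD)// (formB2 hD)//.
by lra.
Qed.

Lemma abs_dom M f : F f -> (forall x, `|f x| <= M) ->
  F (fun x => `|f x|) /\
  E (fun x => `|f x|) (fun x => `|f x|) <= E f f.
Proof.
move=> Ff fM; have [M0|M0] := leP M 0.
  rewrite (_ : (fun x => _) = f) //; apply/funext => x.
  by have := le_trans (fM x) M0; rewrite normr_le0 => /eqP ->; rewrite normr0.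
have [Fp _] := clip_dom M0 Ff; have := clip_cross M0 Ff.
set p := clip M f in Fp *; have Fq := domB Ff Fp; set q := f \- p in Fq *.
(* As f <= M, p is the positive part of f and q is minus its negative part. *)
have -> : (fun x => `|f x|) = p \- q.
  apply/funext => x; rewrite /q /p/=; have := fM x; rewrite ler_norml.
  move=> /andP[h1 h2]; case: (clipP f x M0) => *.
  - by rewrite ltr0_norm//; lra.
  - by rewrite ger0_norm//; lra.
  - by lra.
have -> : f = p \+ q by apply/funext => x; rewrite /q/=; lra.
move=> pq; split; first exact: domB.
by rewrite (formD2 hD)// (formB2 hD)//; lra.
Qed.

(** Midpoints can replace general convex combinations because the parallelogram identity involves
    nothing else, and convex properties pass to the hull by a two-case induction. *)
Inductive hull (u : nat -> X -> R) (N : nat) : (X -> R) -> Prop :=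
| hull_base n : (N <= n)%N -> hull u N (u n)
| hull_mid v w : hull u N v -> hull u N w ->
    hull u N (fun x => 2^-1 * (v \+ w) x).

Lemma hull_mono u (N N' : nat) v : (N <= N')%N -> hull u N' v -> hull u N v.
Proof.
move=> NN'; elim=> [n Nn|v1 v2 _ H1 _ H2]; last exact: hull_mid.
by apply: hull_base; exact: leq_trans Nn.
Qed.

Lemma hull_dom u N v : (forall n, F (u n)) -> hull u N v -> F v.
Proof. by move=> Fu; elim=> // v1 v2 _ F1 _ F2; apply: domZ; exact: domD. Qed.

Lemma hull_form u N v K : (forall n, F (u n)) -> (forall n, E (u n) (u n) <= K) ->
  hull u N v -> E v v <= K.
Proof.
move=> Fu EK; elim=> [n _|v1 v2 h1 H1 h2 H2]; first exact: EK.
have F1 := hull_dom Fu h1; have F2 := hull_dom Fu h2; have F3 := domD F1 F2.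
rewrite (formZ2 hD)// (formD2 hD)//.
have := dirichlet_ge0 hD (domB F1 F2); rewrite (formB2 hD)//.
by rewrite exprVn; lra.
Qed.

Lemma hull_sqn u N v w e : (forall n, F (u n)) -> sqint m w ->
  (forall n, (N <= n)%N -> sqn m (u n \- w) <= e) ->
  hull u N v -> sqn m (v \- w) <= e.
Proof.
move=> Fu L2w sK; elim=> [n Nn|v1 v2 h1 H1 h2 H2]; first exact: sK.
have F1 := dom_sqint hD (hull_dom Fu h1).
have F2 := dom_sqint hD (hull_dom Fu h2).
rewrite (_ : _ \- w = fun x => 2^-1 * ((v1 \- w) \+ (v2 \- w)) x); last first.
  by apply/funext => x /=; lra.
rewrite sqnZ; last by apply: sqintD; exact: sqintB.
have := sqnD (sqintB F1 L2w) (sqintB F2 L2w).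
by rewrite exprVn; lra.
Qed.

(* Banach-Saks: the midpoint hulls of the tails of a bounded sequence have
   almost minimal elements, which form a Cauchy sequence by the parallelogram
   identity. *)
Lemma banach_saks u v K : (forall n, F (u n)) -> (forall n, E (u n) (u n) <= K) ->
  sqint m v -> sqn m (u n \- v) @[n --> \oo] --> 0 ->
  F v /\ exists w : nat -> X -> R, [/\ forall N, hull u N (w N),
    E (w n \- v) (w n \- v) @[n --> \oo] --> 0 &
    sqn m (w n \- v) @[n --> \oo] --> 0].
Proof.
move=> Fu EK L2v uv.
pose S N := [set E w w | w in hull u N].
have S0 N : S N !=set0 by exists (E (u N) (u N)), (u N) => //; exact: hull_base.
have Slb N : has_lbound (S N).
  by exists 0 => _ [w hw <-]; apply: (dirichlet_ge0 hD); exact: hull_dom hw.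
have Sinf N : has_inf (S N) by [].
pose dd N := inf (S N).
have ddle N w : hull u N w -> dd N <= E w w.
  by move=> hw; apply: ge_inf => //; exists w.
have dsup : has_sup (range dd).
  split; first by exists (dd 0%N), 0%N.
  exists K => _ [N _ <-]; apply: le_trans (EK N).
  by apply: ddle; exact: hull_base.
have [w wP] : {w : nat -> X -> R & forall N,
    hull u N (w N) /\ E (w N) (w N) < dd N + N.+1%:R^-1}.
  apply: (@choice _ _ (fun N w => hull u N w /\ E w w < dd N + N.+1%:R^-1)).
  move=> N; have N0 : 0 < N.+1%:R^-1 :> R by rewrite invr_gt0.
  have [_ [w hw <-] wlt] := inf_adherent N0 (Sinf N).
  by exists w.
have Fw N : F (w N) by case: (wP N) => hw _; exact: hull_dom hw.
have sw : sqn m (w n \- v) @[n --> \oo] --> 0.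
  apply/cvgrPdist_le => e e0; move/cvgrPdist_le : uv => /(_ _ e0)[N _ NP].
  exists N => // n /= Nn; rewrite sub0r normrN ger0_norm ?sqn_ge0//.
  have [hw _] := wP n; apply: (hull_sqn Fu L2v _ hw) => k nk.
  have := NP k (leq_trans Nn nk).
  by rewrite sub0r normrN ger0_norm ?sqn_ge0.
suff H : forall e, 0 < e -> exists N, forall i j, (N <= i)%N -> (N <= j)%N ->
     E (w i \- w j) (w i \- w j) < e.
  have [Fv wv] := form_closed hD Fw L2v H sw.
  by split=> //; exists w; split=> // N; case: (wP N).
move=> e e0; have e8 : 0 < e / 8 by lra.
have [_ [N1 _ <-] N1P] := sup_adherent e8 dsup.
have [N2 N2P] : exists N2 : nat, N2.+1%:R^-1 < e / 8.
  have := near_infty_natSinv_lt (PosNum e8).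
  by move=> [N2 _ H]; exists N2; exact: (H N2 (leqnn N2)).
exists (maxn N1 N2) => i j; rewrite !geq_max => /andP[i1 i2] /andP[j1 j2].
have bnd k : (N1 <= k)%N -> (N2 <= k)%N ->
    E (w k) (w k) < sup (range dd) + e / 8.
  move=> k1 k2; have [_ wk] := wP k; apply: (lt_le_trans wk); apply: lerD.
    by apply: sup_upper_bound => //; exists k.
  apply: le_trans (ltW N2P); rewrite lef_pV2 ?posrE// ler_nat//.
have [hi _] := wP i; have [hj _] := wP j.
have := ddle _ _ (hull_mid (hull_mono i1 hi) (hull_mono j1 hj)).
have := bnd _ i1 i2; have := bnd _ j1 j2.
rewrite (formZ2 hD); last exact: domD.
rewrite (formD2 hD)// (formB2 hD)// exprVn.
by lra.
Qed.

Definition bounded_functional (l : (X -> R) -> R) : Prop :=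
  (forall a f g, F f -> F g -> l (fun x => a * f x + g x) = a * l f + l g) /\
  exists c, forall f, F f -> `|l f| <= c * enorm f.

Lemma cvg0_enorm u v :
  E (u n \- v) (u n \- v) @[n --> \oo] --> 0 ->
  enorm (u n \- v) @[n --> \oo] --> 0.
Proof.
move=> uv; rewrite -[X in _ --> X](sqrtr0 R).
exact: (cvg_comp _ _ uv (@sqrt_continuous R 0)).
Qed.

Lemma bounded_functional_lb l u v K e : bounded_functional l ->
  (forall n, F (u n)) -> (forall n, E (u n) (u n) <= K) ->
  sqint m v -> sqn m (u n \- v) @[n --> \oo] --> 0 ->
  (forall n, l (u n) <= l v - e) -> e <= 0.
Proof.
move=> [llin [c lc]] Fu EK L2v uv ule.
have [Fv [w [hw wv _]]] := banach_saks Fu EK L2v uv.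
have F0 := dirichlet0 hD.
have l0 : l (cst 0) = 0.
  have := llin 1 _ _ F0 F0; rewrite (_ : (fun _ => _) = cst 0); first by lra.
  by apply/funext => x /=; lra.
have lZ a f : F f -> l (fun x => a * f x) = a * l f.
  move=> Ff; rewrite -[RHS]addr0 -l0 -llin//.
  by congr l; apply/funext => x /=; lra.
have lD f g : F f -> F g -> l (f \+ g) = l f + l g.
  move=> Ff Fg; rewrite -[l f]mul1r -llin//.
  by congr l; apply/funext => x /=; lra.
have Hw N : l (w N) <= l v - e.
  elim: (hw N) => [n _|v1 v2 h1 H1 h2 H2]; first exact: ule.
  have F1 := hull_dom Fu h1; have F2 := hull_dom Fu h2.
  by rewrite lZ ?lD//; [lra|exact: domD].
have Fw N : F (w N) := hull_dom Fu (hw N).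
apply: (@le_of_cvg0 _ _ (fun n => c * enorm (w n \- v))); last first.
  by apply: cvg0Z; exact: cvg0_enorm.
move=> n; apply: (le_trans _ (lc _ (domB (Fw n) Fv))).
have -> : w n \- v = (fun x => (-1) * v x + w n x).
  by apply/funext => x /=; lra.
rewrite llin// -normrN; apply: le_trans (ler_norm _).
by have := Hw n; lra.
Qed.

Lemma cvg_sqn_subseq u v (s : nat -> nat) : (forall n, (n <= s n)%N) ->
  sqn m (u n \- v) @[n --> \oo] --> 0 ->
  sqn m (u (s n) \- v) @[n --> \oo] --> 0.
Proof.
move=> sn uv; apply/cvgrPdist_le => e e0.
move/cvgrPdist_le : uv => /(_ _ e0)[N _ NP].
by exists N => // n /= Nn; apply: NP; exact: leq_trans (sn n).
Qed.

(** Weak convergence is obtained without weak compactness: otherwise l stays below l(v) - e along a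
    subsequence, hence on its midpoint hulls, and [banach_saks] finds a sequence in them converging
    to v in energy. Applying this to -l gives the other side. *)
Lemma bounded_functional_cvg l u v K : bounded_functional l ->
  (forall n, F (u n)) -> (forall n, E (u n) (u n) <= K) ->
  sqint m v -> sqn m (u n \- v) @[n --> \oo] --> 0 ->
  l (u n) @[n --> \oo] --> l v.
Proof.
move=> lb Fu EK L2v uv.
have lower l' : bounded_functional l' -> forall e, 0 < e ->
    \forall n \near \oo, l' v - e < l' (u n).
  move=> lb' e e0; apply: contrapT => Hn.
  have H N : exists n, (N <= n)%N /\ l' (u n) <= l' v - e.
    apply: contrapT => HN; apply: Hn; exists N => // n /= Nn.
    by rewrite ltNge; apply/negP => H; apply: HN; exists n.
  have [s sP] := choice H.
  have := @bounded_functional_lb l' (u \o s) v K e lb'.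
  move=> /(_ (fun n => Fu _) (fun n => EK _) L2v).
  move=> /(_ (cvg_sqn_subseq (fun n => (sP n).1) uv) (fun n => (sP n).2)).
  by rewrite leNgt e0.
have lbN : bounded_functional (fun f => - l f).
  have [llin [c lc]] := lb; split.
    by move=> a f g Ff Fg; rewrite llin//; lra.
  by exists c => f Ff; rewrite normrN; exact: lc.
apply/cvgrPdist_lt => e e0.
apply: filterS2 (lower _ lb _ e0) (lower _ lbN _ e0) => n h1 h2.
by rewrite ltr_distlC; apply/andP; split; lra.
Qed.

Lemma form_functional h : F h -> bounded_functional (E ^~ h).
Proof.
move=> Fh; split.
  by move=> a f g Ff Fg; rewrite (dirichlet_linear hD).
exists (enorm h) => f Ff; rewrite mulrC; exact: (form_le_enorm hD).
Qed.

Lemma form_weak_cvg u v K h : F h ->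
  (forall n, F (u n)) -> (forall n, E (u n) (u n) <= K) ->
  sqint m v -> sqn m (u n \- v) @[n --> \oo] --> 0 ->
  E (u n) h @[n --> \oo] --> E v h.
Proof. by move=> Fh; apply: (bounded_functional_cvg (form_functional Fh)). Qed.

Lemma enorm_lim u v M : (forall n, F (u n)) -> F v ->
  (forall n, enorm (u n) <= M) ->
  enorm (u n \- v) @[n --> \oo] --> 0 -> enorm v <= M.
Proof.
move=> Fu Fv uM uv; rewrite -subr_le0; apply: le_of_cvg0 uv => n.
have := enormB hD (Fu n) (domB (Fu n) Fv).
rewrite (_ : u n \- (u n \- v) = v); last by apply/funext => x /=; lra.
by have := uM n; lra.
Qed.

End truncations.

(** * Products of bounded functions of the domain *)

Section products.
Context {d : measure_display} {R : realType} {X : borelMetricType d R}.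
Variable m : {measure set X -> \bar R}.
Variables (F : set (X -> R)) (E : (X -> R) -> (X -> R) -> R).
Hypothesis hD : dirichlet_form m F E.
Implicit Types (f g h v w : X -> R) (a c e M K : R).

Local Notation enorm := (enorm E).
Let domD := domD hD.
Let domB := domB hD.
Let domZ := domZ hD.

Lemma enormC v w : F v -> F w -> enorm (v \- w) = enorm (w \- v).
Proof.
move=> Fv Fw; rewrite -[RHS]mul1r -(normrN1 R) -(enormZ hD); last exact: domB.
by congr enorm; apply/funext => x /=; lra.
Qed.

Lemma form_closed_tail (u : nat -> X -> R) v (b : nat -> R) :
  (forall n, F (u n)) -> sqint m v ->
  (forall n k, enorm (u n \- u (n + k)%N) <= b n) ->
  b n @[n --> \oo] --> 0 -> sqn m (u n \- v) @[n --> \oo] --> 0 ->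
  F v /\ enorm (u n \- v) @[n --> \oo] --> 0.
Proof.
move=> Fu L2v ub b0 uv; suff H : forall e, 0 < e -> exists N, forall i j,
    (N <= i)%N -> (N <= j)%N -> E (u i \- u j) (u i \- u j) < e.
  by have [Fv H2] := form_closed hD Fu L2v H uv; split=> //; exact: cvg0_enorm.
(* Below 1 the square of the norm is at most the norm. *)
move=> e e0; have c0 : 0 < Num.min 1 e by rewrite lt_min ltr01.
move/cvgrPdist_lt : b0 => /(_ _ c0)[N _ NP]; exists N => i j Ni Nj.
have bN n : (N <= n)%N -> b n < Num.min 1 e.
  by move/NP => /=; rewrite sub0r normrN; apply: le_lt_trans; exact: ler_norm.
have key n k : (N <= n)%N -> enorm (u n \- u (n + k)%N) < Num.min 1 e.
  by move=> Nn; exact: le_lt_trans (ub n k) (bN _ Nn).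
have : enorm (u i \- u j) < Num.min 1 e.
  have [ij|/ltnW ji] := leqP i j; first by rewrite -(subnKC ij); exact: key.
  by rewrite enormC// -(subnKC ji); exact: key.
rewrite lt_min -(enorm2 hD); last exact: domB.
by have := enorm_ge0 E (u i \- u j); nra.
Qed.

(** For 0 <= f <= 1 this is f followed by the tent map, 2 t for t <= 1/2 and 2 - 2 t above. Written
    as a scaled reflection, it at most doubles the energy norm. *)
Definition tent (f : X -> R) : X -> R :=
  fun x => 2 * (clip 2^-1 f \- (f \- clip 2^-1 f)) x.

Lemma tent_dom f : F f -> F (tent f) /\ enorm (tent f) <= 2 * enorm f.
Proof.
move=> Ff; have h : 0 < 2^-1 :> R by rewrite invr_gt0.
have [Fp _] := clip_dom hD h Ff.
have Fr : F (clip 2^-1 f \- (f \- clip 2^-1 f)) by do 2!apply: domB => //.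
split; first exact: domZ.
rewrite (enormZ hD)// normr_nat ler_pM2l// ler_wsqrtr//.
exact: (clip_reflect hD).
Qed.

Lemma tentE f x : 0 <= f x <= 1 ->
  [/\ 0 <= tent f x <= 1, tent f x <= 2 * f x &
   f x - f x ^+ 2 = 4^-1 * tent f x + 4^-1 * (tent f x - tent f x ^+ 2)].
Proof.
move=> /andP[f0 f1]; have h : 0 < 2^-1 :> R by rewrite invr_gt0.
rewrite /tent/=; case: (clipP f x h) => *; split; first [by lra | by nra].
Qed.

Definition tents n f := iter n tent f.

Lemma tents_dom n f : F f ->
  F (tents n f) /\ enorm (tents n f) <= 2 ^+ n * enorm f.
Proof.
move=> Ff; elim: n => [|n [Fn En]]; first by rewrite expr0 mul1r.
have [FS ES] := tent_dom Fn; split=> //.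
by rewrite exprS -mulrA; apply: (le_trans ES); rewrite ler_pM2l.
Qed.

Lemma tents_bnd n f x : (forall x, 0 <= f x <= 1) -> 0 <= tents n f x <= 1.
Proof.
move=> f01; elim: n => [|n IH]; first exact: f01.
by have [] := tentE IH.
Qed.

Lemma tents_le n f x : (forall x, 0 <= f x <= 1) ->
  tents n f x <= 2 ^+ n * f x.
Proof.
move=> f01; elim: n => [|n IH]; first by rewrite expr0 mul1r.
have [_ H _] := tentE (tents_bnd n x f01); apply: (le_trans H).
by rewrite exprS -mulrA ler_pM2l.
Qed.

(* t - t^2 is the sum of the 4^-k tent^k(t), k > 0, on [0, 1] *)
Fixpoint sqr_approx n f : X -> R :=
  if n is k.+1 then sqr_approx k f \- (fun x => 4^-1 ^+ n * tents n f x) else f.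

Lemma sqr_approxE n f x : (forall x, 0 <= f x <= 1) ->
  sqr_approx n f x - f x * f x =
  4^-1 ^+ n * (tents n f x - tents n f x ^+ 2).
Proof.
move=> f01; elim: n => [|n IH]; first by rewrite expr0 mul1r /= expr2.
have [_ _ H] := tentE (tents_bnd n x f01).
have -> : sqr_approx n.+1 f x - f x * f x =
    sqr_approx n f x - f x * f x - 4^-1 ^+ n.+1 * tents n.+1 f x by rewrite /=; lra.
rewrite IH H -[tent (tents n f)]/(tents n.+1 f).
set T := tents n.+1 f x; rewrite (exprS _ n); set q := _ ^+ n.
by lra.
Qed.

Lemma sqr_approx_dom n f : F f -> F (sqr_approx n f).
Proof.
move=> Ff; elim: n => //= n IH; apply: domB => //.
by apply: domZ; case: (tents_dom n.+1 Ff).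
Qed.

(** The k-th term has norm at most 4^-k 2^k, so the bounds telescope as a geometric series of ratio
    1/2. *)
Lemma sqr_approx_cauchy n k f : F f ->
  enorm (sqr_approx n f \- sqr_approx (n + k) f) <=
  (2^-1 ^+ n - 2^-1 ^+ (n + k)) * enorm f.
Proof.
move=> Ff; elim: k => [|k IH].
  rewrite addn0 subrr mul0r (_ : _ \- _ = (fun x => 0 * f x)).
    by rewrite (enormZ hD)// normr0 mul0r.
  by apply/funext => x /=; rewrite mul0r subrr.
have [Ft Et] := tents_dom (n + k).+1 Ff.
set c := (4^-1 : R) ^+ (n + k).+1.
have c0 : 0 <= c by rewrite exprn_ge0// invr_ge0.
have -> : sqr_approx n f \- sqr_approx (n + k.+1) f =
    (sqr_approx n f \- sqr_approx (n + k) f) \+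
    (fun x => c * tents (n + k).+1 f x).
  by apply/funext => x; rewrite addnS /= /c; lra.
have F1 : F (sqr_approx n f \- sqr_approx (n + k) f).
  by apply: domB; exact: sqr_approx_dom.
apply: (le_trans (enormD hD F1 (domZ c Ft))); rewrite (enormZ hD)// ger0_norm//.
apply: (le_trans (lerD IH (ler_wpM2l c0 Et))).
have -> : c * (2 ^+ (n + k).+1 * enorm f) = 2^-1 ^+ (n + k).+1 * enorm f.
  rewrite mulrA; congr (_ * _); rewrite /c -exprMn; congr (_ ^+ _).
  by lra.
rewrite addnS -mulrDl exprS; set q := _ ^+ (n + k); set p := _ ^+ n.
by apply: ler_wpM2r; [exact: enorm_ge0 | lra].
Qed.

Lemma cvg_half_expn K : 2^-1 ^+ n * K @[n --> \oo] --> 0.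
Proof.
rewrite -(mul0r K); apply: cvgMr_tmp; apply: cvg_expr.
by rewrite ger0_norm ?invr_ge0// invf_lt1 ?ltr1n.
Qed.

(** The tent series converges in energy as well as in L^2, so squares stay in [F] by the Markov
    property alone. The factor 2 is 1 plus the sum of the 2^-k for k > 0. *)
Lemma sqr_dom01 f : F f -> (forall x, 0 <= f x <= 1) ->
  F (f \* f) /\ enorm (f \* f) <= 2 * enorm f.
Proof.
move=> Ff f01; have L2f := dom_sqint hD Ff.
have f2f x : `|(f \* f) x| <= `|f x|.
  have /andP[f0 f1] := f01 x; rewrite /= normrM ger0_norm//.
  by rewrite ler_piMl.
have mf := dom_measurable hD Ff.
have m2 : measurable_fun setT (f \* f) by exact: measurable_funM.
have L2f2 : sqint m (f \* f) := sqint_le m2 f2f L2f.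
have Fs n := sqr_approx_dom n Ff.
have Hs n k : enorm (sqr_approx n f \- sqr_approx (n + k) f) <=
    2^-1 ^+ n * enorm f.
  apply: (le_trans (sqr_approx_cauchy n k Ff)).
  by rewrite ler_wpM2r ?enorm_ge0// gerBl exprn_ge0// invr_ge0.
have [||Ff2 cv] := form_closed_tail Fs L2f2 Hs; first exact: cvg_half_expn.
  apply: (@cvg0_le _ _ (fun n => (2^-1 ^+ n) * sqn m f)); last first.
    exact: cvg_half_expn.
  move=> n; rewrite ger0_norm ?sqn_ge0//.
  have q0 : 0 <= 2^-1 ^+ n :> R by rewrite exprn_ge0// invr_ge0.
  have q1 : 2^-1 ^+ n <= 1 :> R.
    by rewrite exprn_ile1 ?invr_ge0// invf_le1 ?ler1n.
  apply: (@le_trans _ _ (sqn m (fun x => 2^-1 ^+ n * f x))).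
    apply: sqn_le; first exact: sqintZ.
      by apply: measurable_funB => //; exact: (dom_measurable hD).
    move=> x /=; rewrite sqr_approxE// !normrM [ `|f x|]ger0_norm; last first.
      by have /andP[] := f01 x.
    have /andP[t0 t1] := tents_bnd n x f01.
    rewrite !ger0_norm ?exprn_ge0 ?invr_ge0//; last by nra.
    apply: (@le_trans _ _ (4^-1 ^+ n * (2 ^+ n * f x))).
      rewrite ler_wpM2l ?exprn_ge0 ?invr_ge0//.
      by have := tents_le n x f01; nra.
    rewrite mulrA -exprMn (_ : 4^-1 * 2 = 2^-1 :> R)//; lra.
  rewrite sqnZ// ler_wpM2r ?sqn_ge0//.
  by nra.
split=> //; apply: (enorm_lim hD Fs Ff2 _ cv) => n.
have := Hs 0%N n; rewrite add0n expr0 mul1r => H.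
have -> : sqr_approx n f = f \- (f \- sqr_approx n f).
  by apply/funext => x /=; lra.
by apply: (le_trans (enormB hD Ff (domB Ff (Fs n)))); move: H => /=; lra.
Qed.

Lemma sqr_dom f M : 0 < M -> F f -> (forall x, `|f x| <= M) ->
  F (f \* f) /\ enorm (f \* f) <= 2 * M * enorm f.
Proof.
move=> M0 Ff fM; have [Fa Ea] := abs_dom hD Ff fM.
have [||F2 E2] := @sqr_dom01 (fun x => M^-1 * `|f x|); first exact: domZ.
  move=> x; rewrite mulr_ge0 ?invr_ge0 ?(ltW M0)//=.
  by rewrite mulrC ler_pdivrMr// mul1r.
have -> : f \* f = fun x => M ^+ 2 * ((fun x => M^-1 * `|f x|) \*
    (fun x => M^-1 * `|f x|)) x.
  apply/funext => x /=.
  have -> : f x * f x = `|f x| ^+ 2 by rewrite real_normK ?num_real// expr2.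
  by field; rewrite gt_eqF.
split; first exact: domZ.
rewrite (enormZ hD)// ger0_norm ?sqr_ge0//.
have -> : 2 * M * enorm f = M ^+ 2 * (2 * (M^-1 * enorm f)).
  by field; rewrite gt_eqF.
rewrite ler_pM2l ?exprn_gt0//; apply: (le_trans E2).
rewrite ler_pM2l// (enormZ hD)// ger0_norm ?invr_ge0 ?(ltW M0)//.
by rewrite ler_pM2l ?invr_gt0// ler_wsqrtr.
Qed.

(** Polarization of the squares; rescaling f and g to sup norm at most 1 beforehand gives the
    balanced bound. *)
Lemma mul_dom f g M K : 0 < M -> 0 < K -> F f -> F g ->
  (forall x, `|f x| <= M) -> (forall x, `|g x| <= K) ->
  F (f \* g) /\ enorm (f \* g) <= 2 * (K * enorm f + M * enorm g).
Proof.
move=> M0 K0 Ff Fg fM gK.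
pose a := fun x => M^-1 * f x; pose b := fun x => K^-1 * g x.
have Fa : F a by exact: domZ.
have Fb : F b by exact: domZ.
have a1 x : `|a x| <= 1.
  rewrite normrM ger0_norm ?invr_ge0 ?(ltW M0)// mulrC ler_pdivrMr//.
  by rewrite mul1r.
have b1 x : `|b x| <= 1.
  rewrite normrM ger0_norm ?invr_ge0 ?(ltW K0)// mulrC ler_pdivrMr//.
  by rewrite mul1r.
have [||FD ED] := @sqr_dom (a \+ b) 2 (ltr0Sn _ _); first exact: domD.
  by move=> x /=; apply: (le_trans (ler_normD _ _)); have := a1 x;
    have := b1 x; lra.
have [||FB EB] := @sqr_dom (a \- b) 2 (ltr0Sn _ _); first exact: domB.
  by move=> x /=; apply: (le_trans (ler_normB _ _)); have := a1 x;
    have := b1 x; lra.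
have -> : f \* g = fun x => (M * K / 4) *
    (((a \+ b) \* (a \+ b)) \- ((a \- b) \* (a \- b))) x.
  by apply/funext => x /=; rewrite /a /b; field; rewrite !gt_eqF.
split; first by apply: domZ; exact: domB.
rewrite (enormZ hD); last exact: domB.
have MK0 : 0 < M * K / 4 by rewrite divr_gt0// mulr_gt0.
rewrite gtr0_norm//.
have -> : 2 * (K * enorm f + M * enorm g) =
    M * K / 4 * (8 * (M^-1 * enorm f + K^-1 * enorm g)).
  by field; rewrite !gt_eqF.
rewrite ler_pM2l//; apply: (le_trans (enormB hD FD FB)).
have := enormD hD Fa Fb; have := enormB hD Fa Fb.
have -> : enorm a = M^-1 * enorm f.
  by rewrite (enormZ hD)// ger0_norm// invr_ge0 ltW.
have -> : enorm b = K^-1 * enorm g.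
  by rewrite (enormZ hD)// ger0_norm// invr_ge0 ltW.
lra.
Qed.

End products.

(** * Borel measurability and compact supports *)

Section borel.
Context {d : measure_display} {R : realType} {X : borelMetricType d R}.

Lemma open_borel (U : set X) : open U -> measurable U.
Proof. by move=> oU; rewrite measurable_borel; exact: sub_sigma_algebra. Qed.

Lemma closed_borel (U : set X) : closed U -> measurable U.
Proof. by move=> /closed_openC/open_borel/measurableC; rewrite setCK. Qed.

Lemma compact_borel (U : set X) : compact U -> measurable U.
Proof. by move/(compact_closed (@metric_hausdorff R X))/closed_borel. Qed.

Lemma measurable_continuous (f : X -> R) : continuous f -> measurable_fun setT f.
Proof.
move=> cf; apply: (measurability _ (RGenOpens.measurableE R)).
move=> _ [_ [a [b ->]] <-]; rewrite setTI; apply: open_borel.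
by move/continuousP : cf; apply; exact: interval_open.
Qed.

Lemma sqn_unif (m : {measure set X -> \bar R}) (f : X -> R) (a : R) (K : set X) :
  compact K -> (m K < +oo)%E -> 0 <= a -> measurable_fun setT f ->
  (forall x, `|f x| <= a) -> (forall x, ~ K x -> f x = 0) ->
  sqn m f <= a ^+ 2 * fine (m K).
Proof.
move=> cK mKoo a0 mf fa f0; have mK := compact_borel cK.
have -> : a ^+ 2 * fine (m K) = fine (\int[m]_(x in K) (a ^+ 2)%:E).
  by rewrite integral_cst// fineM// ge0_fin_numE.
have fin : (\int[m]_(x in K) (a ^+ 2)%:E < +oo)%E.
  by rewrite integral_cst// lte_mul_pinfty// lee_fin sqr_ge0.
have fE : (\int[m]_x (f x ^+ 2)%:E = \int[m]_(x in K) (f x ^+ 2)%:E)%E.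
  rewrite [RHS]integral_mkcond; apply: eq_integral => x _.
  rewrite patchE; case: ifPn => // /negP xK.
  rewrite f0 ?expr0n//; move=> Kx; apply: xK; exact: mem_set.
have le : (\int[m]_x (f x ^+ 2)%:E <= \int[m]_(x in K) (a ^+ 2)%:E)%E.
  rewrite fE; apply: ge0_le_integral => //.
  - by move=> x _; rewrite lee_fin sqr_ge0.
  - apply/measurable_EFinP; apply: measurable_funS measurableT _ _ => //.
    exact: measurable_funX.
  - by move=> x _; rewrite lee_fin -real_normK ?num_real// ler_sqr ?nnegrE.
rewrite /sqn /Rintegral fine_le// ge0_fin_numE//.
- by apply: le_lt_trans le fin.
- by apply: integral_ge0 => x _; rewrite lee_fin sqr_ge0.
- by apply: integral_ge0 => x _; rewrite lee_fin sqr_ge0.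
Qed.

End borel.

Section compact_support.
Context {R : realType} {X : metricType R}.
Implicit Types (f g h : X -> R).

Lemma continuous_clip a f : continuous f -> continuous (clip a f).
Proof.
move=> cf x.
apply: (@continuous_min _ _ (f \max cst 0) (cst a)); last exact: cvg_cst.
by apply: (@continuous_max _ _ f (cst 0)); [exact: cf | exact: cvg_cst].
Qed.

Lemma continuousZ a f : continuous f -> continuous (fun x => a * f x).
Proof. by move=> cf x; apply: cvgMl_tmp; exact: cf. Qed.

Lemma continuous_add f g : continuous f -> continuous g -> continuous (f \+ g).
Proof. by move=> cf cg x; apply: cvgD; [exact: cf|exact: cg]. Qed.

Lemma continuous_sub f g : continuous f -> continuous g -> continuous (f \- g).
Proof. by move=> cf cg x; apply: cvgB; [exact: cf|exact: cg]. Qed.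

Lemma continuous_mul f g : continuous f -> continuous g -> continuous (f \* g).
Proof. by move=> cf cg x; apply: cvgM; [exact: cf|exact: cg]. Qed.

Lemma open_gt_cont f a : continuous f -> open [set x | a < f x].
Proof. by move=> /continuousP cf; exact: (cf _ (@open_gt R a)). Qed.

Lemma open_lt_cont f a : continuous f -> open [set x | f x < a].
Proof. by move=> /continuousP cf; exact: (cf _ (@open_lt R a)). Qed.

Lemma open_neq0_cont f : continuous f -> open [set x | f x != 0].
Proof. by move=> /continuousP cf; exact: (cf _ (@open_neq R 0)). Qed.

Lemma closed_ge_cont f a : continuous f -> closed [set x | a <= f x].
Proof. by move=> /continuous_closedP cf; exact: (cf _ (@closed_ge R a)). Qed.

Definition supp f : set X := closure [set x | f x != 0].

Lemma supp_out f x : ~ supp f x -> f x = 0.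
Proof.
by move=> H; apply/eqP; apply: contrapT => /negP fx; apply: H; exact: subset_closure.
Qed.

Lemma supp_compact_sub f g h : (forall x, h x != 0 -> f x != 0 \/ g x != 0) ->
  compact (supp f) -> compact (supp g) -> compact (supp h).
Proof.
move=> hfg cf cg; apply: (subclosed_compact _ (compactU cf cg)).
  exact: closed_closure.
by rewrite -closureU; apply: closureS => x /= /hfg.
Qed.

Lemma compact_supp_bounded f : continuous f -> compact (supp f) ->
  exists2 M, 0 < M & forall x, `|f x| <= M.
Proof.
move=> cf cs; have : compact (f @` supp f).
  by apply: continuous_compact => //; exact: continuous_subspaceT.
move=> /compact_bounded[M [_ HM]].
exists (`|M| + 1); first by rewrite ltr_wpDl.
move=> x; have [sx|sx] := pselect (supp f x).
  apply: (HM (`|M| + 1)); last by exists x.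
  by apply: (le_lt_trans (ler_norm M)); rewrite ltrDl.
by rewrite (supp_out sx) normr0 addr_ge0.
Qed.

End compact_support.

(** * The core and the carre du champ *)

Section core.
Context {d : measure_display} {R : realType} {X : borelMetricType d R}.
Variable m : {measure set X -> \bar R}.
Variables (F : set (X -> R)) (E : (X -> R) -> (X -> R) -> R).
Hypothesis hD : dirichlet_form m F E.
Hypothesis hS : strongly_local m F E.
Hypothesis hK : forall K : set X, compact K -> (m K < +oo)%E.
Implicit Types (f g h u v w p q : X -> R) (a c e M K : R).

Local Notation enorm := (enorm E).
Let domD := domD hD.
Let domB := domB hD.
Let domZ := domZ hD.

Definition core f : Prop := F f /\ cont_compact_support f.

Lemma core_dom f : core f -> F f. Proof. by case. Qed.

Lemma core_cont f : core f -> continuous f. Proof. by case=> _ []. Qed.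

Lemma core_bounded f : core f -> exists2 M, 0 < M & forall x, `|f x| <= M.
Proof. by case=> _ [cf kf]; exact: compact_supp_bounded. Qed.

Lemma core_sub f g h : F h -> continuous h ->
  (forall x, h x != 0 -> f x != 0 \/ g x != 0) -> core f -> core g -> core h.
Proof.
move=> Fh ch hfg [_ [_ kf]] [_ [_ kg]]; split=> //; split=> //.
exact: supp_compact_sub kf kg.
Qed.

Lemma coreD f g : core f -> core g -> core (f \+ g).
Proof.
move=> cf cg; apply: (core_sub _ _ _ cf cg).
- by apply: domD; exact: core_dom.
- by apply: continuous_add; exact: core_cont.
- by move=> x /= fg; apply: contrapT => /not_orP[/negP + /negP];
    rewrite !negbK => /eqP f0 /eqP g0; rewrite f0 g0 addr0 eqxx in fg.
Qed.

Lemma coreZ a f : core f -> core (fun x => a * f x).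
Proof.
move=> cf; apply: (core_sub _ _ _ cf cf).
- by apply: domZ; exact: core_dom.
- by apply: continuousZ; exact: core_cont.
- by move=> x /= fg; left; apply: contra fg => /eqP ->; rewrite mulr0.
Qed.

Lemma coreB f g : core f -> core g -> core (f \- g).
Proof.
move=> cf cg; have := coreD cf (coreZ (-1) cg).
by congr core; apply/funext => x /=; lra.
Qed.

Lemma coreM f g : core f -> core g -> core (f \* g).
Proof.
move=> cf cg; apply: (core_sub _ _ _ cf cf).
- have [M M0 fM] := core_bounded cf; have [N N0 gN] := core_bounded cg.
  by have [] := mul_dom hD M0 N0 (core_dom cf) (core_dom cg) fM gN.
- by apply: continuous_mul; exact: core_cont.
- by move=> x /= fg; left; apply: contra fg => /eqP ->; rewrite mul0r.
Qed.

Lemma core_clip a f : 0 < a -> core f -> core (clip a f).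
Proof.
move=> a0 cf; apply: (core_sub _ _ _ cf cf).
- by have [] := clip_dom hD a0 (core_dom cf).
- by apply: continuous_clip; exact: core_cont.
- move=> x /= fg; left; apply: contra fg => /eqP fx.
  by rewrite /clip fx maxxx min_l// ltW.
Qed.

Lemma core_abs f : core f -> core (fun x => `|f x|).
Proof.
move=> cf; apply: (core_sub _ _ _ cf cf).
- have [M M0 fM] := core_bounded cf.
  by have [] := abs_dom hD (core_dom cf) fM.
- by move=> x; apply: cvg_norm; exact: core_cont.
- by move=> x /= fg; left; apply: contra fg => /eqP ->; rewrite normr0.
Qed.

Lemma ae_support_sub f : ae_support m f `<=` supp f.
Proof.
move=> x fx; apply: contrapT => sx; apply: (fx (~` supp f)) => //.
  by apply: closed_openC; exact: closed_closure.
by apply: aeW => y; exact: supp_out.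
Qed.

Lemma ae_support_compact f : compact (supp f) -> compact (ae_support m f).
Proof.
move=> cs; apply: (subclosed_compact _ cs (@ae_support_sub f)).
rewrite -openC openE => x /= Hx.
have [U [oU Ux fU]] : exists U, [/\ open U, U x &
    {ae m, forall y, U y -> f y = 0}].
  by apply: contrapT => H; apply: Hx => U oU Ux fU; apply: H; exists U.
by rewrite /interior nbhsE; exists U => // y Uy /(_ U oU Uy fU).
Qed.

Lemma core_local u v (W : set X) c : core u -> core v -> open W ->
  supp u `<=` W -> (forall x, W x -> v x = c) -> E u v = 0.
Proof.
move=> [Fu [_ ku]] [Fv [_ kv]] oW uW vW; apply: hS => //.
- exact: ae_support_compact.
- exact: ae_support_compact.
- exists W, c; split=> //; last by apply: aeW => x /=; exact: vW.
  exact: subset_trans (@ae_support_sub u) uW.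
Qed.

(** The energies of the clips decrease, and by [clip_split] E(u_i - u_j, u_i - u_j) <= E(u_i, u_i) -
    E(u_j, u_j) for i <= j, so the clips are Cauchy. Being uniformly small on a compact set, they
    tend to 0 in L^2, which identifies the limit. *)
Lemma clip_small f : core f ->
  enorm (clip n.+1%:R^-1 f) @[n --> \oo] --> 0.
Proof.
move=> cf; pose u n := clip n.+1%:R^-1 f.
have p0 n : 0 < n.+1%:R^-1 :> R by rewrite invr_gt0.
have cu n : core (u n) by exact: core_clip.
have Fu n : F (u n) := core_dom (cu n).
have nest i j : (i <= j)%N -> u j = clip j.+1%:R^-1 (u i).
  move=> ij; rewrite /u clip_clip//.
  by rewrite lef_pV2 ?posrE// ler_nat.
have dec i j : (i <= j)%N -> E (u i \- u j) (u i \- u j) <=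
    E (u i) (u i) - E (u j) (u j).
  move=> ij; have := clip_split hD (p0 j) (Fu i).
  by rewrite -(nest _ _ ij); lra.
have inf_u : has_inf (range (fun n => E (u n) (u n))).
  split; first by exists (E (u 0%N) (u 0%N)), 0%N.
  by exists 0 => _ [n _ <-]; exact: (dirichlet_ge0 hD).
have [||Fc /cvg0_enorm] := form_closed hD Fu (dom_sqint hD (dirichlet0 hD)).
- move=> e e0; have [_ [N _ <-] NP] := inf_adherent e0 inf_u.
  have key i j : (N <= i)%N -> (i <= j)%N -> E (u i \- u j) (u i \- u j) < e.
    move=> Ni ij; have h1 := dec _ _ ij; have h2 := dec _ _ Ni.
    have h3 := dirichlet_ge0 hD (domB (Fu N) (Fu i)).
    have h4 : inf (range (fun n => E (u n) (u n))) <= E (u j) (u j).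
      by apply: ge_inf; [case: inf_u | exists j].
    lra.
  exists N => i j Ni Nj; have [ij|/ltnW ji] := leqP i j; first exact: key.
  rewrite -(enorm2 hD) ?(enormC hD (Fu i))//; last exact: domB.
  by rewrite (enorm2 hD); [exact: key|exact: domB].
- have kf : compact (supp f) by case: cf => _ [].
  apply: (@cvg0_le _ _ (fun n => fine (m (supp f)) * n.+1%:R^-1)).
    move=> n; rewrite ger0_norm ?sqn_ge0//.
    apply: (@le_trans _ _ ((n.+1%:R^-1) ^+ 2 * fine (m (supp f)))).
      apply: sqn_unif => //; first exact: hK.
      - by apply: measurable_funB => //; apply: (dom_measurable hD).
      - move=> x; rewrite /= subr0 /u; move: (n.+1%:R^-1) (p0 n) => e e0.
        by case: (clipP f x e0) => *; rewrite ?normr0 ?ger0_norm//; lra.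
      - move=> x /supp_out fx; rewrite /= subr0 /u /clip fx maxxx min_l//.
    rewrite mulrC ler_wpM2l ?fine_ge0// expr2 ger_pMl ?p0//.
    by rewrite invf_le1// ler1n.
  by apply: cvg0Z; exact: cvg_harmonic.
rewrite (_ : (fun n => _) = (fun n => enorm (u n)))//.
by apply/funext => n; congr enorm; apply/funext => x /=; rewrite subr0.
Qed.

(** Soft thresholding: removing the clips of u and -u at height 1/(n+1) leaves a function supported
    in the closed set {|u| >= 1/(n+1)}, and what is removed is small by [clip_small]. *)
Lemma core_soft u : core u -> exists v : nat -> X -> R,
  [/\ forall n, core (v n), forall n, supp (v n) `<=` [set x | u x != 0] &
   enorm (u \- v n) @[n --> \oo] --> 0].
Proof.
move=> cu; have cN : core (fun x => (-1) * u x) by exact: coreZ.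
have p0 n : 0 < n.+1%:R^-1 :> R by rewrite invr_gt0.
pose w n := clip n.+1%:R^-1 u \- clip n.+1%:R^-1 (fun x => (-1) * u x).
have cw n : core (w n) by apply: coreB; exact: core_clip.
exists (fun n => u \- w n); split; first by move=> n; exact: coreB.
  move=> n; have cl : closed [set x | n.+1%:R^-1 <= `|u x|].
    apply: closed_ge_cont => x; apply: cvg_norm; exact: core_cont.
  apply: (@subset_trans _ [set x | n.+1%:R^-1 <= `|u x|]); last first.
    by move=> x /= h; rewrite -normr_gt0; exact: lt_le_trans (p0 n) h.
  rewrite [X in _ `<=` X](closure_id _).1//; apply: closureS => x /=.
  apply: contraR; rewrite -ltNge /w /= => ux.
  have := clipP (fun x => (-1) * u x) x (p0 n).
  have := p0 n; move: ux; rewrite ltr_norml.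
  move: (n.+1%:R^-1) (p0 n) => e e0 /andP[h1 h2] _.
  move=> H; apply/eqP; move: H (clipP u x e0).
  by move=> [?|? ?|?] [?|? ?|?]; lra.
apply: (@cvg0_le _ _ (fun n => enorm (clip n.+1%:R^-1 u) +
  enorm (clip n.+1%:R^-1 (fun x => (-1) * u x)))); last first.
  by apply: cvg0D; exact: clip_small.
move=> n; rewrite ger0_norm ?enorm_ge0//.
have -> : u \- (u \- w n) = w n by apply/funext => x /=; lra.
by apply: (enormB hD); apply: core_dom; exact: core_clip.
Qed.

(** Strong locality requires v to be constant on a neighbourhood of the support of u. Soft
    thresholding of u weakens this to constancy on {u != 0}, which is all that cutting a function at
    a level provides. *)
Lemma core_orth u v c : core u -> core v -> (forall x, u x != 0 -> v x = c) ->
  E u v = 0.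
Proof.
move=> cu cv uv; have [w [cw wu uw]] := core_soft cu.
have Fw n : F (w n) := core_dom (cw n).
have Fu := core_dom cu; have Fv := core_dom cv.
have Euw n : E (w n) v = 0.
  apply: (@core_local _ _ [set x | u x != 0] c) => //.
  by apply: open_neq0_cont; exact: core_cont.
apply/eqP; rewrite -normr_le0.
apply: (@le_of_cvg0 _ _ (fun n => enorm v * enorm (u \- w n))); last exact: cvg0Z.
move=> n; have -> : E u v = E (u \- w n) v by rewrite (formBl hD)// Euw subr0.
by rewrite mulrC; apply: (form_le_enorm hD) => //; exact: domB.
Qed.

End core.

(** * Fourth-order identity and product formula *)

Section leibniz.
Context {d : measure_display} {R : realType} {X : borelMetricType d R}.
Variable m : {measure set X -> \bar R}.
Variables (F : set (X -> R)) (E : (X -> R) -> (X -> R) -> R).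
Hypothesis hD : dirichlet_form m F E.
Hypothesis hS : strongly_local m F E.
Hypothesis hK : forall K : set X, compact K -> (m K < +oo)%E.
Implicit Types (f g h u v w p q : X -> R) (a c e M K : R).

Local Notation enorm := (enorm E).
Local Notation core := (core F).
Let domD := domD hD.
Let domB := domB hD.
Let domZ := domZ hD.
Let orth := core_orth hD hS hK.
Let coreD := coreD hD.
Let coreB := coreB hD.
Let coreZ := coreZ hD.
Let coreM := coreM hD.
Let core_clip := core_clip hD.

Lemma core_halve a f : 0 < a -> core f -> (forall x, 0 <= f x <= a) ->
  exists p q, [/\ core p, core q, forall x, 0 <= p x <= a / 2,
    forall x, 0 <= q x <= a / 2 & [/\ forall x, q x != 0 -> p x = a / 2,
    f = p \+ q & p = clip (a / 2) f]].
Proof.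
move=> a0 cf fa; have a2 : 0 < a / 2 by lra.
have cp : core (clip (a / 2) f) by exact: core_clip.
exists (clip (a / 2) f), (f \- clip (a / 2) f); split=> //.
- exact: coreB.
- by move=> x; have := fa x; case: (clipP f x a2) => *; lra.
- by move=> x /=; have := fa x; case: (clipP f x a2) => *; lra.
split=> //.
- move=> x /= /eqP; have := fa x; case: (clipP f x a2) => // *; [lra|].
  by exfalso; lra.
- by apply/funext => x /=; lra.
Qed.

(** A chain rule would turn both terms into 12 times the integral of f^2 against Gamma(f, f), so
    this difference is expected to vanish; that is [quartic0]. *)
Definition quartic f : R :=
  4 * E f (f \* (f \* f)) - 3 * E (f \* f) (f \* f).

(** Since p = c on {q != 0}, the mixed terms of the powers of p + q are polynomials in q. Those
    paired with p vanish by locality, and the remaining terms in c cancel because of the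
    coefficients 4 and 3. *)
Lemma quartic_split p q c : core p -> core q ->
  (forall x, q x != 0 -> p x = c) -> quartic (p \+ q) = quartic p + quartic q.
Proof.
move=> cp cq pq; have cp2 := coreM cp cp; have cp3 := coreM cp cp2.
have cq2 := coreM cq cq; have cq3 := coreM cq cq2.
pose r := (fun x => 3 * c ^+ 2 * q x) \+ (fun x => 3 * c * (q \* q) x).
pose s := (q \* q) \+ (fun x => 2 * c * q x).
have cr : core r by apply: coreD; apply: coreZ.
have cs : core s by apply: coreD => //; apply: coreZ.
have q0 x : q x = 0 \/ p x = c.
  by have [->|/pq ->] := eqVneq (q x) 0; [left|right].
have E2 : (p \+ q) \* (p \+ q) = (p \* p) \+ s.
  by apply/funext => x; rewrite /s/=; case: (q0 x) => ->; ring.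
have E3 : (p \+ q) \* ((p \+ q) \* (p \+ q)) =
    (p \* (p \* p)) \+ ((q \* (q \* q)) \+ r).
  by apply/funext => x; rewrite /r/=; case: (q0 x) => ->; ring.
have Fp := core_dom cp; have Fq := core_dom cq.
have Fp2 := core_dom cp2; have Fq2 := core_dom cq2.
have Fp3 := core_dom cp3; have Fq3 := core_dom cq3.
have Fr := core_dom cr; have Fs := core_dom cs.
have nz x y : q x = 0 -> y = 0 -> y != 0 -> q x != 0.
  by move=> _ ->; rewrite eqxx.
have O1 : E p (q \* (q \* q)) = 0.
  rewrite (formC hD)//; apply: (orth (c := c)) => // x /=.
  by move=> h; apply: pq; apply: contra h => /eqP ->; rewrite mul0r.
have O2 : E p r = 0.
  rewrite (formC hD)//; apply: (orth (c := c)) => // x; rewrite /r /=.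
  by move=> h; apply: pq; apply: contra h => /eqP ->; rewrite !(mulr0, addr0).
have O3 : E q (p \* (p \* p)) = 0.
  by apply: (orth (c := c * (c * c))) => // x /= /pq ->.
have O4 : E (p \* p) s = 0.
  rewrite (formC hD)//; apply: (orth (c := c * c)) => // x; rewrite /s /=.
  by move=> h; rewrite pq//; apply: contra h => /eqP ->; rewrite !(mulr0, addr0).
have O5 : E p q = 0.
  by rewrite (formC hD)//; apply: (orth (c := c)).
have Eqr : E q r = 3 * c ^+ 2 * E q q + 3 * c * E q (q \* q).
  by rewrite (formDr hD) ?(formZr hD)//; exact: domZ.
have Ess : E s s = E (q \* q) (q \* q) + 4 * c * E q (q \* q) +
    4 * c ^+ 2 * E q q.
  have Fz := domZ (2 * c) Fq.
  rewrite /s (formD2 hD)// (formZ2 hD)// (formZr hD)//.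
  by rewrite (formC hD Fq2 Fq); ring.
rewrite /quartic E3 E2.
have FD := domD Fq3 Fr; have FD2 := domD Fp3 FD.
rewrite (formDl hD Fp Fq FD2) !(formDr hD Fp3 FD)// !(formDr hD Fq3 Fr)//.
rewrite (formD2 hD Fp2 Fs) O1 O2 O3 O4 Eqr Ess.
by ring.
Qed.

(** 36 is 4 times the bound 6 for E(f, f^3) plus 3 times the bound 4 for E(f^2, f^2). What matters
    is the factor a^2. *)
Lemma quartic_bound f a : 0 < a -> core f -> (forall x, 0 <= f x <= a) ->
  `|quartic f| <= 36 * a ^+ 2 * E f f.
Proof.
move=> a0 cf fa; have Ff := core_dom cf.
have fM x : `|f x| <= a by have := fa x; move=> /andP[? ?]; rewrite ger0_norm.
have [F2 E2] := sqr_dom hD a0 Ff fM.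
have a2 : 0 < a ^+ 2 by rewrite exprn_gt0.
have f2M x : `|(f \* f) x| <= a ^+ 2.
  by rewrite /= normrM expr2 ler_pM.
have [F3 E3] := mul_dom hD a0 a2 Ff F2 fM f2M.
have n0 := enorm_ge0 E f; have n2 := enorm_ge0 E (f \* f).
have H1 := form_le_enorm hD Ff F3.
have H2 : E (f \* f) (f \* f) = enorm (f \* f) ^+ 2 by rewrite (enorm2 hD).
have H3 := dirichlet_ge0 hD F2.
rewrite /quartic -(enorm2 hD Ff); apply: (le_trans (ler_normB _ _)).
rewrite !normrM !normr_nat (ger0_norm H3) H2.
have H4 : `|E f (f \* (f \* f))| <= 6 * a ^+ 2 * enorm f ^+ 2.
  apply: (le_trans H1).
  have -> : 6 * a ^+ 2 * enorm f ^+ 2 = enorm f * (6 * a ^+ 2 * enorm f) by ring.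
  rewrite ler_wpM2l//.
  by apply: (le_trans E3); nra.
have H5 : enorm (f \* f) ^+ 2 <= 4 * a ^+ 2 * enorm f ^+ 2.
  rewrite (_ : 4 * _ * _ = (2 * a * enorm f) ^+ 2); last by ring.
  by rewrite ler_pXn2r ?nnegrE// !mulr_ge0// ltW.
lra.
Qed.

(** Each cut at half height halves the range, while the energies of the two pieces add up to that of
    f by orthogonality. The factor a^2 thus shrinks without the number of pieces entering the
    bound. *)
Lemma quartic_small n f a : 0 < a -> core f -> (forall x, 0 <= f x <= a) ->
  `|quartic f| <= 36 * (a / 2 ^+ n) ^+ 2 * E f f.
Proof.
elim: n f a => [|n IH] f a a0 cf fa.
  by rewrite expr0 divr1; exact: quartic_bound.
have [p [q [cp cq pa qa [pq fpq _]]]] := core_halve a0 cf fa.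
have a2 : 0 < a / 2 by lra.
rewrite fpq (quartic_split cp cq pq); apply: (le_trans (ler_normD _ _)).
apply: (le_trans (lerD (IH _ _ a2 cp pa) (IH _ _ a2 cq qa))).
have Fp := core_dom cp; have Fq := core_dom cq.
rewrite (formD2 hD Fp Fq) (formC hD Fp Fq) (orth cq cp pq) mulr0 addr0 -mulrDr.
by have -> : a / 2 / 2 ^+ n = a / 2 ^+ n.+1 by rewrite exprS invfM mulrA.
Qed.

Lemma quarticN f : core f -> quartic (fun x => (-1) * f x) = quartic f.
Proof.
move=> cf; have Ff := core_dom cf; have F3 := core_dom (coreM cf (coreM cf cf)).
rewrite /quartic.
have -> : (fun x => (-1) * f x) \* (fun x => (-1) * f x) = f \* f.
  by apply/funext => x /=; ring.
have -> : (fun x => (-1) * f x) \* (f \* f) = (fun x => (-1) * (f \* (f \* f)) x).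
  by apply/funext => x /=; ring.
by rewrite (formZl hD) ?(formZr hD)//; [ring|exact: domZ].
Qed.

Lemma core_posneg f : core f -> exists p q, [/\ core p, core q,
  forall x, 0 <= p x, forall x, 0 <= q x &
  [/\ forall x, q x != 0 -> p x = 0, f = p \- q & (fun x => `|f x|) = p \+ q]].
Proof.
move=> cf; have [M M0 fM] := core_bounded cf.
have cp : core (clip M f) by exact: core_clip.
exists (clip M f), (clip M f \- f); split=> //.
- exact: coreB.
- by move=> x; case: (clipP f x M0) => *; lra.
- move=> x /=; have := fM x; rewrite ler_norml => /andP[_].
  by case: (clipP f x M0) => *; lra.
split.
- move=> x /= /eqP; have := fM x; rewrite ler_norml => /andP[_].
  by case: (clipP f x M0) => *; lra.
- by apply/funext => x /=; lra.
- apply/funext => x /=; have := fM x; rewrite ler_norml => /andP[_].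
  case: (clipP f x M0) => *; last by lra.
    by rewrite ltr0_norm//; lra.
  by rewrite ger0_norm//; lra.
Qed.

Lemma quartic0 f : core f -> quartic f = 0.
Proof.
have pos g : core g -> (forall x, 0 <= g x) -> quartic g = 0.
  move=> cg g0; have [M M0 gM] := core_bounded cg.
  have gM' x : 0 <= g x <= M by rewrite g0 (le_trans (ler_norm _) (gM x)).
  apply/eqP; rewrite -normr_le0.
  apply: (@le_of_cvg0 _ _ (fun n => 2^-1 ^+ n * (36 * M ^+ 2 * E g g))).
    move=> n; apply: (le_trans (quartic_small n M0 cg gM')).
    have h0 : 0 <= 2^-1 ^+ n :> R by rewrite exprn_ge0// invr_ge0.
    have h1 : 2^-1 ^+ n <= 1 :> R.
      by rewrite exprn_ile1 ?invr_ge0// invf_le1 ?ler1n.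
    have := dirichlet_ge0 hD (core_dom cg).
    rewrite -exprVn; set h := _ ^+ n in h0 h1 *; set e := E g g => e0.
    have H : 0 <= 36 * M ^+ 2 * e by rewrite !mulr_ge0// ltW.
    have -> : 36 * (M * h) ^+ 2 * e = h * (h * (36 * M ^+ 2 * e)) by ring.
    by rewrite ler_wpM2l// ler_piMl.
  exact: cvg_half_expn.
move=> cf; have [p [q [cp cq p0 q0 [pq -> _]]]] := core_posneg cf.
have cq' : core (fun x => (-1) * q x) by exact: coreZ.
have -> : p \- q = p \+ (fun x => (-1) * q x) by apply/funext => x /=; lra.
rewrite (@quartic_split _ _ 0)//; last first.
  by move=> x h; apply: pq; apply: contra h => /eqP ->; rewrite mulr0.
by rewrite quarticN// !pos// addr0.
Qed.

(* The polarization of quartic0 in the directions (f, f, g, g). *)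
Lemma form_mul2 f g : core f -> core g ->
  E (f \* g) (f \* g) = E f (f \* (g \* g)) + E g (g \* (f \* f)) -
    2^-1 * E (f \* f) (g \* g).
Proof.
move=> cf cg; have cf2 := coreM cf cf; have cg2 := coreM cg cg.
have cfg := coreM cf cg.
have cf3 := coreM cf cf2; have cg3 := coreM cg cg2.
have cfgg := coreM cf cg2; have cgff := coreM cg cf2.
have H1 := quartic0 cf; have H2 := quartic0 cg.
have H3 := quartic0 (coreD cf cg); have H4 := quartic0 (coreB cf cg).
have Ff := core_dom cf; have Fg := core_dom cg.
have Ff2 := core_dom cf2; have Fg2 := core_dom cg2; have Ffg := core_dom cfg.
have Ff3 := core_dom cf3; have Fg3 := core_dom cg3.
have Fgff := core_dom cgff; have Ffgg := core_dom cfgg.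
pose A := (f \* (f \* f)) \+ (fun x => 3 * (f \* (g \* g)) x).
pose B := (fun x => 3 * (g \* (f \* f)) x) \+ (g \* (g \* g)).
pose S := (f \* f) \+ (g \* g).
have FA : F A by apply: domD => //; exact: domZ.
have FB : F B by apply: domD => //; exact: domZ.
have FS : F S by exact: domD.
have E3p : (f \+ g) \* ((f \+ g) \* (f \+ g)) = A \+ B.
  by apply/funext => x; rewrite /A/B/=; ring.
have E3m : (f \- g) \* ((f \- g) \* (f \- g)) = A \- B.
  by apply/funext => x; rewrite /A/B/=; ring.
have E2p : (f \+ g) \* (f \+ g) = S \+ (fun x => 2 * (f \* g) x).
  by apply/funext => x; rewrite /S/=; ring.
have E2m : (f \- g) \* (f \- g) = S \- (fun x => 2 * (f \* g) x).
  by apply/funext => x; rewrite /S/=; ring.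
have Ffg2 := domZ 2 Ffg.
have FAB := domD FA FB; have FAmB := domB FA FB.
move: H1 H2 H3 H4; rewrite /quartic E3p E3m E2p E2m.
rewrite (formDl hD Ff Fg FAB) (formBl hD Ff Fg FAmB).
rewrite !(formDr hD FA FB)// !(formBr hD FA FB)//.
rewrite (formD2 hD FS Ffg2) (formB2 hD FS Ffg2) (formZ2 hD)//.
rewrite /A /B /S (formD2 hD Ff2 Fg2).
have FZ1 := domZ 3 Ffgg; have FZ2 := domZ 3 Fgff.
rewrite !(formDr hD) ?(formZr hD)//.
move: (E f (f \* (f \* f))) (E g (g \* (g \* g))) => x1 x2.
move: (E f (f \* (g \* g))) (E g (g \* (f \* f))) => x3 x4.
move: (E (f \* f) (f \* f)) (E (g \* g) (g \* g)) => x5 x6.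
move: (E (f \* f) (g \* g)) (E (f \* g) (f \* g)) => x7 x8.
move: (E (f \* f \+ g \* g) _) (E f _) (E f _) (E g _) (E g _) => *.
lra.
Qed.

(* [carre f h] is the integral of h against the energy measure of f. *)
Definition carre f h : R := E f (f \* h) - 2^-1 * E (f \* f) h.

End leibniz.

(** * Folding and positivity *)

Section carre_du_champ.
Context {d : measure_display} {R : realType} {X : borelMetricType d R}.
Variable m : {measure set X -> \bar R}.
Variables (F : set (X -> R)) (E : (X -> R) -> (X -> R) -> R).
Hypothesis hD : dirichlet_form m F E.
Hypothesis hS : strongly_local m F E.
Hypothesis hK : forall K : set X, compact K -> (m K < +oo)%E.
Implicit Types (f g h v w p q : X -> R) (a c e M K : R).

Local Notation enorm := (enorm E).
Local Notation core := (core F).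
Let domD := domD hD.
Let domB := domB hD.
Let domZ := domZ hD.
Let orth := core_orth hD hS hK.
Let coreB := coreB hD.
Let coreZ := coreZ hD.
Let coreM := coreM hD.
Let core_clip := core_clip hD.

Definition bdom f : Prop := F f /\ exists2 M, 0 < M & forall x, `|f x| <= M.

Lemma core_bdom f : core f -> bdom f.
Proof. by move=> cf; split; [exact: core_dom|exact: (core_bounded cf)]. Qed.

Lemma bdomD f g : bdom f -> bdom g -> bdom (f \+ g).
Proof.
move=> [Ff [M M0 fM]] [Fg [N N0 gN]]; split; first exact: domD.
exists (M + N); first exact: addr_gt0.
by move=> x /=; apply: (le_trans (ler_normD _ _)); exact: lerD.
Qed.

Lemma bdomZ a f : bdom f -> bdom (fun x => a * f x).
Proof.
move=> [Ff [M M0 fM]]; split; first exact: domZ.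
exists ((`|a| + 1) * M); first by rewrite mulr_gt0// ltr_wpDl//.
by move=> x /=; rewrite normrM ler_pM// lerDl.
Qed.

Lemma bdomB f g : bdom f -> bdom g -> bdom (f \- g).
Proof.
move=> bf bg; have := bdomD bf (bdomZ (-1) bg).
by congr bdom; apply/funext => x /=; lra.
Qed.

Lemma bdomM f g : bdom f -> bdom g -> bdom (f \* g).
Proof.
move=> [Ff [M M0 fM]] [Fg [N N0 gN]]; split.
  by have [] := mul_dom hD M0 N0 Ff Fg fM gN.
exists (M * N); first exact: mulr_gt0.
by move=> x /=; rewrite normrM ler_pM.
Qed.

Lemma bdom_dom f : bdom f -> F f. Proof. by case. Qed.

Lemma carre_linear f a g h : bdom f -> bdom g -> bdom h ->
  carre E f (fun x => a * g x + h x) = a * carre E f g + carre E f h.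
Proof.
move=> bf bg bh; have bfg := bdomM bf bg; have bfh := bdomM bf bh.
have bff := bdomM bf bf; rewrite /carre.
have -> : (fun x => a * g x + h x) = (fun x => a * g x) \+ h by [].
have -> : f \* ((fun x => a * g x) \+ h) =
    (fun x => a * (f \* g) x) \+ (f \* h) by apply/funext => x /=; ring.
have Zg := domZ a (bdom_dom bg); have Zfg := domZ a (bdom_dom bfg).
rewrite !(formDr hD) ?(formZr hD)//; try exact: bdom_dom.
by ring.
Qed.

Lemma carre_weak_cvg f (u : nat -> X -> R) v M K : bdom f -> bdom v ->
  0 < M -> (forall n, F (u n)) -> (forall n x, `|u n x| <= M) ->
  (forall n, enorm (u n) <= K) -> sqn m (u n \- v) @[n --> \oo] --> 0 ->
  carre E f (u n) @[n --> \oo] --> carre E f v.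
Proof.
move=> bf bv M0 Fu uM uK uv; have [Ff [N N0 fN]] := bf.
have K0 : 0 <= K := le_trans (enorm_ge0 E _) (uK 0%N).
have L2v := dom_sqint hD (bdom_dom bv).
have bfv := bdomM bf bv; have bff := bdomM bf bf.
have bu n : bdom (u n) by split=> //; exists M.
have bfu n := bdomM bf (bu n).
have EK n : E (u n) (u n) <= K ^+ 2.
  by rewrite -(enorm2 hD)// ler_pXn2r ?nnegrE// enorm_ge0.
have EK2 n : E (f \* u n) (f \* u n) <= (2 * (M * enorm f + N * K)) ^+ 2.
  have [Ffu H] := mul_dom hD N0 M0 Ff (Fu n) fN (uM n).
  rewrite -(enorm2 hD)// ler_pXn2r ?nnegrE ?enorm_ge0//; last first.
    by apply: mulr_ge0 => //; apply: addr_ge0; apply: mulr_ge0 => //;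
      first [exact: enorm_ge0 | exact: ltW].
  by apply: (le_trans H); rewrite ler_pM2l// lerD2l ler_pM2l.
apply: cvgB.
  rewrite (formC hD Ff (bdom_dom bfv)).
  rewrite (_ : (fun n => _) = (fun n => E (f \* u n) f)); last first.
    by apply/funext => n; rewrite (formC hD)//; exact: bdom_dom.
  apply: (form_weak_cvg hD Ff _ EK2).
  - by move=> n; exact: bdom_dom.
  - by apply: (dom_sqint hD); exact: bdom_dom.
  apply: (@cvg0_le _ _ (fun n => N ^+ 2 * sqn m (u n \- v))); last exact: cvg0Z.
  move=> n; rewrite ger0_norm ?sqn_ge0//.
  have L2uv : sqint m (u n \- v) by apply: sqintB => //; exact: (dom_sqint hD).
  rewrite -sqnZ//; apply: sqn_le; first exact: sqintZ.
    by apply: (dom_measurable hD); apply: domB; exact: bdom_dom.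
  move=> x /=; rewrite -mulrBr !normrM ler_wpM2r//.
  by apply: (le_trans (fN x)); exact: ler_norm.
apply: cvgMl_tmp; rewrite (formC hD (bdom_dom bff) (bdom_dom bv)).
rewrite (_ : (fun n => _) = (fun n => E (u n) (f \* f))); last first.
  by apply/funext => n; rewrite (formC hD)//; exact: bdom_dom.
by apply: (form_weak_cvg hD (bdom_dom bff) Fu EK L2v uv).
Qed.

(** The mixed term is E(p, q h) + E(q, p h) - E(p q, h). The first part vanishes by locality; the
    other two cancel because p q = c q and p h - c h vanishes on {q != 0}. Hence the sign in front
    of q is immaterial. *)
Lemma carre_split p q h c : core p -> core q -> core h ->
  (forall x, q x != 0 -> p x = c) ->
  carre E (p \+ q) h = carre E p h + carre E q h /\
  carre E (p \- q) h = carre E p h + carre E q h.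
Proof.
move=> cp cq ch pq.
have cph := coreM cp ch; have cqh := coreM cq ch.
have cp2 := coreM cp cp; have cq2 := coreM cq cq; have cpq := coreM cp cq.
have q0 x : q x = 0 \/ p x = c.
  by have [->|/pq ->] := eqVneq (q x) 0; [left|right].
have Fp := core_dom cp; have Fq := core_dom cq; have Fh := core_dom ch.
have Fph := core_dom cph; have Fqh := core_dom cqh; have Fpq := core_dom cpq.
have Fp2 := core_dom cp2; have Fq2 := core_dom cq2.
have O1 : E p (q \* h) = 0.
  rewrite (formC hD)//; apply: (orth (c := c)) => // x /= hx.
  by apply: pq; apply: contra hx => /eqP ->; rewrite mul0r.
have O2 : E q (p \* h) = E (p \* q) h.
  have -> : p \* q = fun x => c * q x.
    by apply/funext => x /=; case: (q0 x) => ->; rewrite ?mulr0.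
  rewrite (formZl hD)//; apply/eqP; rewrite -subr_eq0 -(formZr hD)//.
  have Zh := domZ c Fh; rewrite -(formBr hD)//; apply/eqP.
  apply: (orth (c := 0)) => //; first by apply: coreB => //; exact: coreZ.
  by move=> x /= /pq ->; rewrite subrr.
have F2pq := domZ 2 Fpq.
rewrite /carre; split.
- have -> : (p \+ q) \* h = (p \* h) \+ (q \* h).
    by apply/funext => x /=; ring.
  have -> : (p \+ q) \* (p \+ q) = ((p \* p) \+ (fun x => 2 * (p \* q) x)) \+ (q \* q).
    by apply/funext => x /=; ring.
  have Fs := domD Fp2 F2pq.
  rewrite (formDl hD Fp Fq); last exact: domD.
  rewrite !(formDr hD Fph Fqh)// (formDl hD Fs Fq2 Fh) (formDl hD Fp2 F2pq Fh).
  by rewrite (formZl hD)// O1 O2; lra.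
- have -> : (p \- q) \* h = (p \* h) \- (q \* h).
    by apply/funext => x /=; ring.
  have -> : (p \- q) \* (p \- q) = ((p \* p) \- (fun x => 2 * (p \* q) x)) \+ (q \* q).
    by apply/funext => x /=; ring.
  have Fs := domB Fp2 F2pq.
  rewrite (formBl hD Fp Fq); last exact: domB.
  rewrite !(formBr hD Fph Fqh)// (formDl hD Fs Fq2 Fh) (formBl hD Fp2 F2pq Fh).
  by rewrite (formZl hD)// O1 O2; lra.
Qed.

(* f folded into [0, M / 2^n].  Folding has slope +1 or -1, hence leaves the
   carre du champ unchanged, while it makes f small: [zigzag_cvg] thus writes
   [carre f (g ^ 2)] as a limit of energies, which are nonnegative and comparable. *)
Fixpoint zigzag M f n : X -> R :=
  if n is k.+1 then
    let z := zigzag M f k in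
    clip (M / 2 ^+ k / 2) z \- (z \- clip (M / 2 ^+ k / 2) z)
  else fun x => `|f x|.

Lemma zigzag_core M f n : 0 < M -> core f -> (forall x, `|f x| <= M) ->
  core (zigzag M f n) /\ forall x, 0 <= zigzag M f n x <= M / 2 ^+ n.
Proof.
move=> M0 cf fM; elim: n => [|n [cz zb]].
  split; first exact: (core_abs hD).
  by move=> x; rewrite expr0 divr1 /= normr_ge0 fM.
have a0 : 0 < M / 2 ^+ n by rewrite divr_gt0// exprn_gt0.
have a2 : 0 < M / 2 ^+ n / 2 by lra.
have cc := core_clip a2 cz; split=> /=; first by do 2!apply: coreB => //.
move=> x; have := zb x.
have -> : M / 2 ^+ n.+1 = M / 2 ^+ n / 2 by rewrite exprSr invfM mulrA.
move: (M / 2 ^+ n) a0 a2 => a a0 a2 zx.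
by case: (clipP (zigzag M f n) x a2) => *; lra.
Qed.

Lemma zigzag_carre M f n h : 0 < M -> core f -> core h ->
  (forall x, `|f x| <= M) ->
  carre E (zigzag M f n) h = carre E f h /\
  E (zigzag M f n) (zigzag M f n) = E f f.
Proof.
move=> M0 cf ch fM; elim: n => [|n [IH1 IH2]].
  have [p [q [cp cq p0 q0 [pq fE aE]]]] := core_posneg hD cf.
  rewrite /zigzag aE fE; have [-> ->] := carre_split cp cq ch pq; split=> //.
  have Fp := core_dom cp; have Fq := core_dom cq.
  by rewrite (formD2 hD)// (formB2 hD)// (formC hD Fp Fq) (orth cq cp pq); lra.
have a0 : 0 < M / 2 ^+ n by rewrite divr_gt0// exprn_gt0.
have [cz zb] := zigzag_core n M0 cf fM.
have [p [q [cp cq p0 q0 [pq zE pE]]]] := core_halve hD a0 cz zb.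
rewrite -IH1 -IH2 /= -pE.
have -> : zigzag M f n \- p = q by rewrite zE; apply/funext => x /=; lra.
rewrite zE; have [-> ->] := carre_split cp cq ch pq; split=> //.
have Fp := core_dom cp; have Fq := core_dom cq.
by rewrite (formD2 hD)// (formB2 hD)// (formC hD Fp Fq) (orth cq cp pq); lra.
Qed.

Lemma zigzag_cvg M f g : 0 < M -> core f -> core g -> (forall x, `|f x| <= M) ->
  E (zigzag M f n \* g) (zigzag M f n \* g) @[n --> \oo] --> carre E f (g \* g).
Proof.
move=> M0 cf cg fM; have [G G0 gG] := core_bounded cg.
have cgg := coreM cg cg; have Ff := core_dom cf; have Fg := core_dom cg.
have [n1 n2] := (enorm_ge0 E f, enorm_ge0 E g).
pose B := enorm g * (2 * (M ^+ 2 * enorm g + G * (2 * M * enorm f))).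
apply/subr_cvg0; apply: (@cvg0_le _ _ (fun n => 2^-1 ^+ n * B)); last first.
  exact: cvg_half_expn.
move=> n; have [cz zb] := zigzag_core n M0 cf fM.
have [<- Ez] := zigzag_carre n M0 cf cgg fM.
set z := zigzag M f n in cz zb Ez *.
(* By the product formula the energy of z g exceeds [carre] of z on g^2 by exactly E(g, g z^2), and
   z^2 tends to 0 in energy because z is bounded by M / 2^n with the energy of f. *)
rewrite (form_mul2 hD hS hK cz cg) /carre.
rewrite (_ : _ - _ - _ = E g (g \* (z \* z))); last by ring.
set h := 2^-1 ^+ n : R.
have h0 : 0 < h by rewrite exprn_gt0// invr_gt0.
have h1 : h <= 1 by rewrite exprn_ile1 ?invr_ge0// invf_le1 ?ler1n.
have a0 : 0 < M * h by exact: mulr_gt0.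
have Fz := core_dom cz.
have zM x : `|z x| <= M * h.
  by have /andP[z0 z1] := zb x; rewrite ger0_norm// /h exprVn.
have [Fz2 Ez2] := sqr_dom hD a0 Fz zM.
have a2 : 0 < (M * h) ^+ 2 by rewrite exprn_gt0.
have z2M x : `|(z \* z) x| <= (M * h) ^+ 2.
  by rewrite /= normrM expr2 ler_pM.
have [Fg3 Eg3] := mul_dom hD G0 a2 Fg Fz2 gG z2M.
apply: (le_trans (form_le_enorm hD Fg Fg3)).
have -> : h * B = enorm g * (h * (2 * (M ^+ 2 * enorm g + G * (2 * M * enorm f)))).
  by rewrite /B; ring.
rewrite ler_wpM2l//; apply: (le_trans Eg3).
have zf : enorm z = enorm f by rewrite /enorm Ez.
rewrite zf in Ez2; have H1 : G * enorm (z \* z) <= G * (2 * (M * h) * enorm f).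
  by rewrite ler_pM2l.
have H2 : (M * h) ^+ 2 * enorm g <= h * (M ^+ 2 * enorm g).
  rewrite (_ : (M * h) ^+ 2 * _ = h * (h * (M ^+ 2 * enorm g))); last by ring.
  by rewrite ler_pM2l// ler_piMl// mulr_ge0// sqr_ge0.
by nra.
Qed.

(* k - k^2 = t/4 + (t - t^2)/4 for the tent t of k; iterating, l k is at least
   the limit of l (2^-j (t_j - t_j^2)). *)
Lemma functional_ge0 (l : (X -> R) -> R) :
  (forall a f g, core f -> core g ->
     l (fun x => a * f x + g x) = a * l f + l g) ->
  (forall g, core g -> 0 <= l (g \* g)) ->
  (forall (u : nat -> X -> R) K, (forall n, core (u n)) ->
     (forall n x, `|u n x| <= 1) -> (forall n, enorm (u n) <= K) ->
     sqn m (u n) @[n --> \oo] --> 0 -> l (u n) @[n --> \oo] --> 0) ->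
  forall k, core k -> (forall x, 0 <= k x) -> 0 <= l k.
Proof.
move=> llin lsq lweak.
have main k : core k -> (forall x, 0 <= k x <= 1) -> 0 <= l k.
  move=> ck k01; have h : 0 < 2^-1 :> R by rewrite invr_gt0.
  have ct j : core (tents j k).
    elim: j => // j cj; apply: coreZ; apply: coreB; first exact: core_clip.
    by apply: coreB => //; exact: core_clip.
  pose r j := tents j k \- (tents j k \* tents j k).
  have cr j : core (r j) by apply: coreB => //; exact: coreM.
  have lZ a f : core f -> l (fun x => a * f x) = a * l f.
    move=> cf; have cz := coreZ 0 cf.
    have := llin a _ _ cf cz; have := llin 0 _ _ cf cz; have := llin 0 _ _ cf cf.
    rewrite (_ : (fun x => 0 * f x + f x) = f); last by apply/funext=> x; lra.
    rewrite (_ : (fun x => 0 * f x + 0 * f x) = (fun x => 0 * f x)); last first.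
      by apply/funext=> x; lra.
    rewrite (_ : (fun x => a * f x + 0 * f x) = (fun x => a * f x)); last first.
      by apply/funext=> x; lra.
    have := llin (-1) _ _ cf cf.
    rewrite (_ : (fun x => -1 * f x + f x) = (fun x => 0 * f x)); last first.
      by apply/funext=> x; lra.
    by lra.
  have lD f g : core f -> core g -> l (f \+ g) = l f + l g.
    move=> cf cg; rewrite -[l f]mul1r -llin//.
    by congr l; apply/funext => x /=; lra.
  (* For t = tents j.+1 k: 4 l(r_j) = l(t) + l(r_{j+1}) and l(t) = l(t^2) + l(r_{j+1}), where l(t^2)
     >= 0. *)
  have step j : l (r j.+1) <= 2 * l (r j).
    have cj := ct j.+1; have cj2 := coreM cj cj.
    have : l (tents j.+1 k) = l (tents j.+1 k \* tents j.+1 k) + l (r j.+1).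
      by rewrite -lD//; congr l; apply/funext => x; rewrite /r/=; lra.
    have -> : l (r j) = 4^-1 * l (tents j.+1 k) + 4^-1 * l (r j.+1).
      rewrite -!lZ// -lD; [|exact: coreZ..]; congr l; apply/funext => x.
      rewrite /r/=; have [_ _] := tentE (tents_bnd j x k01).
      by rewrite !expr2.
    by have := lsq _ cj; lra.
  have lr j : l (r j) <= 2 ^+ j * l (r 0%N).
    elim: j => [|j IH]; first by rewrite expr0 mul1r.
    by apply: (le_trans (step j)); rewrite exprS -mulrA ler_pM2l.
  have r0 : 0 <= l (r 0%N).
    rewrite -oppr_le0; apply: (@le_of_cvg0 _ _ (fun j => - l (fun x => 2^-1 ^+ j * r j x))).
      move=> j; rewrite lerN2 lZ// -(ler_pM2l (exprn_gt0 j (ltr0Sn R 1))).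
      by rewrite mulrA -exprMn mulfV// expr1n mul1r.
    rewrite -oppr0; apply: cvgN; apply: (lweak _ (3 * enorm k)).
    - by move=> j; exact: coreZ.
    - move=> j x; have /andP[t0 t1] := tents_bnd j x k01.
      rewrite normrM ger0_norm ?exprn_ge0 ?invr_ge0//.
      rewrite mulr_ile1 ?exprn_ge0 ?invr_ge0// ?exprn_ile1 ?invr_ge0//.
        by rewrite invf_le1 ?ler1n.
      by rewrite /r/= ger0_norm; nra.
    - move=> j; rewrite (enormZ hD); last exact: core_dom.
      rewrite ger0_norm ?exprn_ge0 ?invr_ge0//.
      have [Ft Et] := tents_dom hD j (core_dom ck).
      have [F2 E2] := sqr_dom01 hD Ft (fun x => tents_bnd j x k01).
      have H : enorm (r j) <= 2 ^+ j * (3 * enorm k).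
        by apply: (le_trans (enormB hD Ft F2)); lra.
      rewrite -(ler_pM2l (exprn_gt0 j (ltr0Sn R 1))) mulrA -exprMn mulfV//.
      by rewrite expr1n mul1r.
    - have kk : compact (supp k) by case: ck => _ [].
      apply: (@cvg0_le _ _ (fun n => 2^-1 ^+ n * fine (m (supp k)))); last first.
        exact: cvg_half_expn.
      move=> j; rewrite ger0_norm ?sqn_ge0//.
      have hj0 : 0 <= 2^-1 ^+ j :> R by rewrite exprn_ge0// invr_ge0.
      apply: (@le_trans _ _ ((2^-1 ^+ j) ^+ 2 * fine (m (supp k)))).
        apply: sqn_unif => //; first exact: hK.
        + by apply: (dom_measurable hD); apply: domZ; exact: core_dom.
        + move=> x; have /andP[t0 t1] := tents_bnd j x k01.
          rewrite normrM ger0_norm// ler_piMr//.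
          by rewrite /r/= ger0_norm; nra.
        + move=> x /supp_out kx; have /andP[t0 _] := tents_bnd j x k01.
          have := tents_le j x k01; rewrite kx mulr0 => t1.
          have tj : tents j k x = 0 by apply: le_anti; rewrite t0 t1.
          by rewrite /r/= tj mulr0 subrr mulr0.
      rewrite ler_wpM2r ?fine_ge0// expr2 ler_piMl//.
      by rewrite exprn_ile1 ?invr_ge0// invf_le1 ?ler1n.
  have : l k = l (k \* k) + l (r 0%N).
    rewrite -lD//; last exact: coreM.
    by congr l; apply/funext => x; rewrite /r/=; lra.
  by have := lsq k ck; lra.
move=> k ck k0; have [M M0 kM] := core_bounded ck.
have lk : l (fun x => M^-1 * k x) = M^-1 * l k.
  have cz := coreZ 0 ck.
  have := llin M^-1 _ _ ck cz; have := llin 0 _ _ ck cz; have := llin 0 _ _ ck ck.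
  rewrite (_ : (fun x => 0 * k x + k x) = k); last by apply/funext=> x; lra.
  rewrite (_ : (fun x => 0 * k x + 0 * k x) = (fun x => 0 * k x)); last first.
    by apply/funext=> x; lra.
  rewrite (_ : (fun x => M^-1 * k x + 0 * k x) = (fun x => M^-1 * k x)); last first.
    by apply/funext=> x; lra.
  have := llin (-1) _ _ ck ck.
  rewrite (_ : (fun x => -1 * k x + k x) = (fun x => 0 * k x)); last first.
    by apply/funext=> x; lra.
  by lra.
have := main _ (coreZ M^-1 ck); rewrite lk pmulr_rge0 ?invr_gt0//; apply.
move=> x; rewrite mulr_ge0 ?invr_ge0 ?(ltW M0)//= mulrC ler_pdivrMr// mul1r.
by apply: (le_trans (ler_norm _)).
Qed.

End carre_du_champ.

(** * Approximation by the core *)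

Section approximation.
Context {d : measure_display} {R : realType} {X : borelMetricType d R}.
Variable m : {measure set X -> \bar R}.
Variables (F : set (X -> R)) (E : (X -> R) -> (X -> R) -> R).
Hypothesis hD : dirichlet_form m F E.
Implicit Types (f g h v w p q : X -> R) (u : nat -> X -> R) (a c e M K : R).

Local Notation enorm := (enorm E).
Local Notation core := (core F).
Local Notation bdom := (bdom F).
Let domB := domB hD.
Let domZ := domZ hD.
Let bdomM := bdomM hD.

(** A mode of convergence which forms respect weakly and which is stable under products with bounded
    functions. *)
Definition weakly_bounded u v M K : Prop :=
  [/\ forall n, F (u n), F v, forall n x, `|u n x| <= M,
    forall n, enorm (u n) <= K & sqn m (u n \- v) @[n --> \oo] --> 0].

Lemma weakly_bounded_mul u v M K f : 0 < M -> bdom v -> weakly_bounded u v M K ->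
  bdom f -> exists M' K', 0 < M' /\ weakly_bounded (fun n => f \* u n) (f \* v) M' K'.
Proof.
move=> M0 bv [Fu Fv uM uK uv] bf; have [Ff [N N0 fN]] := bf.
exists (N * M), (2 * (M * enorm f + N * K)); split; first exact: mulr_gt0.
split.
- by move=> n; have [] := mul_dom hD N0 M0 Ff (Fu n) fN (uM n).
- exact: bdom_dom (bdomM bf bv).
- by move=> n x; rewrite normrM ler_pM.
- move=> n; have [_ H] := mul_dom hD N0 M0 Ff (Fu n) fN (uM n).
  by apply: (le_trans H); rewrite ler_pM2l// lerD2l ler_pM2l.
apply: (@cvg0_le _ _ (fun n => N ^+ 2 * sqn m (u n \- v))); last exact: cvg0Z.
move=> n; rewrite ger0_norm ?sqn_ge0//.
have L2uv : sqint m (u n \- v) by apply: (dom_sqint hD); exact: domB.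
have bu : bdom (u n) by split=> //; exists M.
rewrite -sqnZ//; apply: sqn_le; first exact: sqintZ.
  by apply: (dom_measurable hD); apply: domB; apply: bdom_dom; exact: bdomM.
move=> x /=; rewrite -mulrBr !normrM ler_wpM2r//.
by apply: (le_trans (fN x)); exact: ler_norm.
Qed.

Lemma weakly_bounded_sqr u v M K : 0 < M -> bdom v -> weakly_bounded u v M K ->
  exists K', weakly_bounded (fun n => u n \* u n) (v \* v) (M * M) K'.
Proof.
move=> M0 bv [Fu Fv uM uK uv]; have [_ [N N0 vN]] := bv.
exists (2 * (M * K + M * K)); split.
- by move=> n; have [] := mul_dom hD M0 M0 (Fu n) (Fu n) (uM n) (uM n).
- exact: bdom_dom (bdomM bv bv).
- by move=> n x; rewrite normrM ler_pM.
- move=> n; have [_ H] := mul_dom hD M0 M0 (Fu n) (Fu n) (uM n) (uM n).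
  by apply: (le_trans H); rewrite ler_pM2l// lerD// ler_pM2l.
apply: (@cvg0_le _ _ (fun n => (M + N) ^+ 2 * sqn m (u n \- v))); last exact: cvg0Z.
move=> n; rewrite ger0_norm ?sqn_ge0//.
have L2uv : sqint m (u n \- v) by apply: (dom_sqint hD); exact: domB.
have bu : bdom (u n) by split=> //; exists M.
rewrite -sqnZ//; apply: sqn_le; first exact: sqintZ.
  by apply: (dom_measurable hD); apply: domB; apply: bdom_dom; exact: bdomM.
move=> x /=.
have -> : u n x * u n x - v x * v x = (u n x + v x) * (u n x - v x) by ring.
rewrite !normrM ler_wpM2r// (gtr0_norm (addr_gt0 M0 N0)).
by apply: (le_trans (ler_normD _ _)); exact: lerD.
Qed.

Lemma weakly_bounded_cvg u v M K h : weakly_bounded u v M K -> F h ->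
  E (u n) h @[n --> \oo] --> E v h.
Proof.
move=> [Fu Fv uM uK uv] Fh; apply: (form_weak_cvg hD Fh Fu _ (dom_sqint hD Fv) uv).
move=> n; rewrite -(enorm2 hD)//; apply: (@lerXn2r _ 2 _ K) => //.
  by rewrite nnegrE enorm_ge0.
by rewrite nnegrE (le_trans (enorm_ge0 E _) (uK 0%N)).
Qed.

(** In E(u_n, u_n h) both arguments vary, so one of them has to converge strongly in energy; the
    other is then handled weakly. *)
Lemma carre_cvg u f h M K : 0 < M -> bdom f -> bdom h ->
  weakly_bounded u f M K -> enorm (u n \- f) @[n --> \oo] --> 0 ->
  carre E (u n) h @[n --> \oo] --> carre E f h.
Proof.
move=> M0 bf bh wu uf; have [Fu Ff uM uK _] := wu.
have [M' [K' [M'0 wuh]]] := weakly_bounded_mul M0 bf wu bh.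
have [K2 wu2] := weakly_bounded_sqr M0 bf wu.
have Fh := bdom_dom bh; have Ffh := bdom_dom (bdomM bh bf).
have [Fuh _ _ uhK _] := wuh.
apply: cvgB; last first.
  by apply: cvgMl_tmp; exact: weakly_bounded_cvg wu2 Fh.
have fhE w : w \* h = h \* w by apply/funext => x; exact: mulrC.
rewrite fhE (_ : (fun n => _) =
  (fun n => E (u n \- f) (h \* u n) + E (h \* u n) f)); last first.
  apply/funext => n; rewrite fhE (formBl hD)// (formC hD Ff (Fuh n)).
  by rewrite subrK.
rewrite -[X in _ --> X]add0r; apply: cvgD; last first.
  by rewrite (formC hD)//; exact: weakly_bounded_cvg wuh Ff.
apply: (@cvg0_le _ _ (fun n => K' * enorm (u n \- f))); last exact: cvg0Z.
move=> n; have FB := domB (Fu n) Ff.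
apply: (le_trans (form_le_enorm hD FB (Fuh n))); rewrite mulrC.
by rewrite ler_wpM2r// enorm_ge0.
Qed.

Lemma carre_cvgr f u h M K : 0 < M -> bdom f -> bdom h ->
  weakly_bounded u h M K -> carre E f (u n) @[n --> \oo] --> carre E f h.
Proof.
by move=> M0 bf bh [Fu Fh uM uK uh]; exact: (carre_weak_cvg hD bf bh M0 Fu uM uK uh).
Qed.

Hypothesis hR : regular_form m F E.

(** Regularity gives approximations without bounds, and truncating them leaves only bounded energies
    and L^2 convergence. Midpoint hulls restore convergence in energy, and preserve the core, the
    bound and nonnegativity. *)
Lemma core_approx f M : 0 < M -> F f -> (forall x, `|f x| <= M) ->
  exists u K, [/\ forall n, core (u n), weakly_bounded u f M K,
    enorm (u n \- f) @[n --> \oo] --> 0 &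
    (forall x, 0 <= f x) -> forall n x, 0 <= u n x].
Proof.
move=> M0 Ff fM.
have [g gP] : {g : nat -> X -> R & forall n, core (g n) /\
    form1 m E (f \- g n) < n.+1%:R^-1}.
  apply: (@choice _ _ (fun n g => core g /\ form1 m E (f \- g) < n.+1%:R^-1)).
  move=> n; have n0 : 0 < n.+1%:R^-1 :> R by rewrite invr_gt0.
  by have [g [Fg cg] fg] := (hR.1 f Ff _ n0); exists g.
have cg n : core (g n) by case: (gP n).
have Fg n := core_dom (cg n).
pose N w := (fun x => (-1) * w x).
(* For f >= 0 the range is cut to [0, M] instead of [-M, M], which makes the approximations
   nonnegative. *)
pose T w := if pselect (forall x, 0 <= f x) then clip M w
  else clip M w \- clip M (N w).
have cT w : core w -> core (T w).
  move=> cw; rewrite /T; case: (pselect _) => ? /=; first exact: (core_clip hD).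
  apply: (coreB hD); apply: (core_clip hD) => //; exact: (coreZ hD).
have ET w : core w -> enorm (T w) <= 2 * enorm w.
  move=> cw; have Fw := core_dom cw; rewrite /T.
  have [F1 E1] := clip_dom hD M0 Fw.
  have E1' : enorm (clip M w) <= enorm w by rewrite ler_wsqrtr.
  case: (pselect _) => ? /=; first by have := enorm_ge0 E w; lra.
  have Fn : F (N w) by exact: domZ.
  have [F2 E2] := clip_dom hD M0 Fn.
  have E2' : enorm (clip M (N w)) <= enorm w.
    rewrite ler_wsqrtr//; apply: (le_trans E2).
    by rewrite (formZ2 hD)// sqrrN expr1n mul1r.
  by apply: (le_trans (enormB hD F1 F2)); lra.
have bT w x : `|T w x| <= M.
  rewrite /T /N; case: (pselect _) => ? /=.
    by case: (clipP w x M0) => *; rewrite ger0_norm//; lra.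
  rewrite ler_norml; have /= := clipP (fun x => -1 * w x) x M0.
  by move: (clipP w x M0) => [?|? ?|?] [?|? ?|?]; lra.
have dT w x : `|T w x - f x| <= `|w x - f x|.
  rewrite /T /N; have := fM x; rewrite ler_norml => /andP[f1 f2].
  case: (pselect _) => [f0|?] /=.
    have := f0 x; move: (clipP w x M0) => [?|? ?|?] ?; last 2 first.
    - by [].
    - by rewrite !ger0_norm ?subr_ge0//; lra.
    - by rewrite !ler0_norm ?subr_le0//; lra.
  have : (clip M w x - clip M (fun x => -1 * w x) x = w x) \/
     (w x <= - M /\ clip M w x - clip M (fun x => -1 * w x) x = - M) \/
     (M <= w x /\ clip M w x - clip M (fun x => -1 * w x) x = M).
    have /= := clipP (fun x => -1 * w x) x M0.
    move: (clipP w x M0) => [?|? ?|?] [?|? ?|?]; lra.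
  move=> [->//|[[h1 ->]|[h1 ->]]].
  - by rewrite !ler0_norm ?subr_le0//; lra.
  - by rewrite !ger0_norm ?subr_ge0//; lra.
pose u n := T (g n).
have cu n : core (u n) by exact: cT.
have Fu n := core_dom (cu n).
have small n : n.+1%:R^-1 <= 1 :> R by rewrite invf_le1// ler1n.
have Eg n : E (f \- g n) (f \- g n) < n.+1%:R^-1.
  have [_] := gP n; apply: le_lt_trans; rewrite /form1 lerDl; exact: sqn_ge0.
have ng n : enorm (g n) <= enorm f + 1.
  have -> : g n = f \- (f \- g n) by apply/funext => x /=; lra.
  apply: (le_trans (enormB hD Ff (domB Ff (Fg n)))); rewrite lerD2l.
  apply: enorm_le => //; rewrite expr1n.
  exact: ltW (lt_le_trans (Eg n) (small n)).
have EK n : E (u n) (u n) <= (2 * (enorm f + 1)) ^+ 2.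
  rewrite -(enorm2 hD)//; apply: lerXn2r; rewrite ?nnegrE ?enorm_ge0//.
    by rewrite mulr_ge0// addr_ge0// enorm_ge0.
  by apply: (le_trans (ET _ (cg n))); rewrite ler_pM2l.
have uf : sqn m (u n \- f) @[n --> \oo] --> 0.
  apply: (@cvg0_le _ _ (fun n => n.+1%:R^-1)); last exact: cvg_harmonic.
  move=> n; rewrite ger0_norm ?sqn_ge0//.
  have [_] := gP n; rewrite /form1 => H; apply: (le_trans _ (ltW H)).
  apply: (@le_trans _ _ (sqn m (f \- g n))); last first.
    by rewrite lerDr; apply: (dirichlet_ge0 hD); exact: domB.
  apply: sqn_le; first by apply: (dom_sqint hD); exact: domB.
    by apply: (dom_measurable hD); exact: domB.
  by move=> x /=; rewrite [leRHS]distrC; exact: dT.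
have [_ [w [hw wf wsf]]] := banach_saks hD Fu EK (dom_sqint hD Ff) uf.
have cw n : core (w n).
  elim: (hw n) => [k _|v1 v2 _ c1 _ c2]; first exact: cu.
  by apply: (coreZ hD); exact: (coreD hD).
have Fw n := core_dom (cw n).
exists w, (2 * (enorm f + 1)); split=> //; last 2 first.
- exact: cvg0_enorm.
- move=> f0 n; elim: (hw n) => [k _|v1 v2 _ c1 _ c2] x.
    rewrite /u /T; case: (pselect _) => //= ?.
    by case: (clipP (g k) x M0) => *; lra.
  by rewrite /= mulr_ge0// addr_ge0.
split=> //.
- move=> n; elim: (hw n) => [k _|v1 v2 _ c1 _ c2] x; first exact: bT.
  rewrite normrM ger0_norm ?invr_ge0//=.
  have := ler_normD (v1 x) (v2 x); have := c1 x; have := c2 x; lra.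
- move=> n; apply: enorm_le; first by rewrite mulr_ge0// addr_ge0// enorm_ge0.
  exact: (hull_form hD Fu EK (hw n)).
Qed.

End approximation.

(** * Comparison of the carre du champ of two forms *)

Section comparison.
Context {d : measure_display} {R : realType} {X : borelMetricType d R}.
Variable m : {measure set X -> \bar R}.
Variables (F : set (X -> R)) (E1 E2 : (X -> R) -> (X -> R) -> R) (C : R).
Hypothesis hD1 : dirichlet_form m F E1.
Hypothesis hS1 : strongly_local m F E1.
Hypothesis hD2 : dirichlet_form m F E2.
Hypothesis hR2 : regular_form m F E2.
Hypothesis hS2 : strongly_local m F E2.
Hypothesis hK : forall K : set X, compact K -> (m K < +oo)%E.
Hypothesis C0 : 0 <= C.
Hypothesis hC : forall u, F u -> E1 u u <= C * E2 u u.
Implicit Types (f g h : X -> R).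

Lemma enorm_comparison u : F u -> enorm E1 u <= Num.sqrt C * enorm E2 u.
Proof. by move=> Fu; rewrite /enorm -sqrtrM// ler_wsqrtr// hC. Qed.

(** On a square weight this is the limit of the hypothesis applied to the functions
    [zigzag M f n \* g]; [functional_ge0] extends it to nonnegative weights. *)
Lemma carre_core_le f h : core F f -> core F h -> (forall x, 0 <= h x) ->
  carre E1 f h <= C * carre E2 f h.
Proof.
move=> cf ch h0; rewrite -subr_ge0.
have bf := core_bdom cf.
pose l h := C * carre E2 f h - carre E1 f h.
rewrite -[X in 0 <= X]/(l h).
apply: (functional_ge0 (l := l) hD2 hK) => //; rewrite /l.
- move=> a g k /core_bdom bg /core_bdom bk.
  by rewrite (carre_linear hD1)// (carre_linear hD2)//; ring.
- move=> g cg; rewrite subr_ge0; have [M M0 fM] := core_bounded cf.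
  apply: (ler_cvg_to (zigzag_cvg hD1 hS1 hK M0 cf cg fM)
    (cvgMl_tmp (a := C) (zigzag_cvg hD2 hS2 hK M0 cf cg fM))).
  apply: nearW => n; apply: hC.
  have [cz _] := zigzag_core hD2 n M0 cf fM.
  by apply: core_dom; exact: (coreM hD2).
- move=> u K cu u1 uK u0.
  have b0 : bdom F (cst 0).
    by split; [exact: (dirichlet0 hD1)|exists 1 => // x; rewrite normr0].
  have u0' : sqn m (u n \- cst 0) @[n --> \oo] --> 0.
    rewrite (_ : (fun n => _) = (fun n => sqn m (u n)))//.
    by apply/funext => n; congr (sqn m); apply/funext => x /=; rewrite subr0.
  have H E (hD : dirichlet_form m F E) : carre E f (cst 0) = 0.
    have F0 := dirichlet0 hD; rewrite /carre.
    have -> : f \* cst 0 = cst 0 by apply/funext => x /=; rewrite mulr0.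
    have FF := bdom_dom (bdomM hD bf bf).
    rewrite (formC hD (core_dom cf) F0) (formC hD FF F0).
    by rewrite !(form0l hD)//; [rewrite mulr0 subrr|exact: core_dom].
  have Fu n := core_dom (cu n).
  rewrite [X in _ --> X](_ : 0 = C * carre E2 f (cst 0) - carre E1 f (cst 0)).
    apply: cvgB; first apply: cvgMl_tmp.
      exact: (carre_weak_cvg hD2 bf b0 ltr01 Fu u1 uK u0').
    apply: (carre_weak_cvg (K := Num.sqrt C * K) hD1 bf b0 ltr01 Fu u1 _ u0').
    move=> n; apply: (le_trans (enorm_comparison (Fu n))).
    by rewrite ler_wpM2l ?sqrtr_ge0.
  by rewrite !H// mulr0 subrr.
Qed.

Lemma weakly_bounded_comparison (u : nat -> X -> R) f M K :
  weakly_bounded m F E2 u f M K ->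
  weakly_bounded m F E1 u f M (Num.sqrt C * K).
Proof.
move=> [Fu Ff uM uK uf]; split=> // n.
apply: (le_trans (enorm_comparison (Fu n))).
by rewrite ler_wpM2l ?sqrtr_ge0.
Qed.

Lemma enorm_cvg_comparison (u : nat -> X -> R) f : (forall n, F (u n)) -> F f ->
  enorm E2 (u n \- f) @[n --> \oo] --> 0 ->
  enorm E1 (u n \- f) @[n --> \oo] --> 0.
Proof.
move=> Fu Ff uf; apply: cvg0_le (cvg0Z (Num.sqrt C) uf) => n.
by rewrite ger0_norm ?enorm_ge0// enorm_comparison//; exact: (domB hD2).
Qed.

(** First f, then h is approximated: [carre] is quadratic in f, where energy convergence is used,
    and linear in h, where weak convergence suffices. *)
Lemma carre_le f h : bdom F f -> bdom F h -> (forall x, 0 <= h x) ->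
  carre E1 f h <= C * carre E2 f h.
Proof.
move=> bf bh h0.
have [Ff [M M0 fM]] := bf; have [Fh [N N0 hN]] := bh.
have [u [K [cu wu uf _]]] := core_approx hD2 hR2 M0 Ff fM.
have [k [L [ck wk _ k0]]] := core_approx hD2 hR2 N0 Fh hN.
have {}k0 := k0 h0; have Fu n := core_dom (cu n).
have step n : carre E1 f (k n) <= C * carre E2 f (k n).
  have bk := core_bdom (ck n).
  apply: (ler_cvg_to
    (carre_cvg hD1 M0 bf bk (weakly_bounded_comparison wu)
       (enorm_cvg_comparison Fu Ff uf))
    (cvgMl_tmp (a := C) (carre_cvg hD2 M0 bf bk wu uf))).
  by apply: nearW => i; apply: carre_core_le.
apply: (ler_cvg_to
  (carre_cvgr hD1 N0 bf bh (weakly_bounded_comparison wk))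
  (cvgMl_tmp (a := C) (carre_cvgr hD2 N0 bf bh wk))).
by apply: nearW => n; exact: step.
Qed.

End comparison.

(** * Doubling spaces and cutoff functions in the core *)

Section topology.
Context {d : measure_display} {R : realType} {X : borelMetricType d R}.
Implicit Types (x y z : X) (r e : R) (K U W : set X).

Lemma ball_mdist x r y : ball x r y <-> mdist x y < r.
Proof. by rewrite ballEmdist. Qed.

Lemma open_mball x r : open (ball x r).
Proof.
rewrite openE => y /ball_mdist xy; rewrite /interior -nbhs_ballE.
exists (r - mdist x y) => /=; first by rewrite subr_gt0.
move=> z /ball_mdist yz; apply/ball_mdist.
by apply: (le_lt_trans (metric_triangle x y z)); lra.
Qed.

Lemma ball_sub x y r e : mdist x y + r <= e -> ball y r `<=` ball x e.
Proof.
move=> H z /ball_mdist yz; apply/ball_mdist.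
by apply: (le_lt_trans (metric_triangle x y z)); lra.
Qed.

Lemma open_ball_sub U x : open U -> U x -> exists2 r, 0 < r & ball x r `<=` U.
Proof.
move=> oU Ux; have : nbhs x U by exact: open_nbhs_nbhs.
by rewrite -nbhs_ballE => -[r r0 rU]; exists r.
Qed.

Lemma continuous_mdist x : continuous (mdist x : X -> R).
Proof.
move=> y; apply/cvgrPdist_lt => e e0.
have : nbhs y (ball y e) by apply: nbhsx_ballx.
apply: filterS => z /ball_mdist yz; rewrite ltr_norml.
have := metric_triangle x y z; have := metric_triangle x z y.
by rewrite (metric_sym z y); lra.
Qed.

Lemma compact_mclosed K : compact K -> closed K.
Proof. exact: (compact_closed (@metric_hausdorff R X)). Qed.

Lemma precompact_compact K : compact K -> precompact K.
Proof. by move=> cK; exists K => //; split=> //; exact: compact_mclosed. Qed.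

Lemma compact_balls K (rad : X -> R) : compact K -> (forall z, K z -> 0 < rad z) ->
  exists s : seq X, (forall z, z \in s -> K z) /\
    forall y, K y -> exists2 z, z \in s & ball z (rad z) y.
Proof.
rewrite compact_cover => cK radP.
have [|y Ky|D DK Dcov] := cK X K (fun z => ball z (rad z)).
- by move=> z _; exact: open_mball.
- by exists y => //; apply: ballxx; exact: radP.
exists (finmap.enum_fset D); split; first by move=> z /DK; rewrite inE.
by move=> y /Dcov[z zD zy]; exists z.
Qed.

Hypothesis hlc : locally_compact [set: X].

Lemma precompact_ball x : exists2 r, 0 < r & precompact (ball x r).
Proof.
have [U + [cU clU]] := hlc (x := x) I; rewrite withinET -nbhs_ballE.
move=> [r r0 rU]; exists r => //; exists U => //; exact: rU.
Qed.

(** A finite sum of cones over balls whose halves cover K. Height 4 gives at least 2 on a half ball,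
    which leaves room for an error of 1/2 when the core approximates it. *)
Lemma bump K U : compact K -> open U -> K `<=` U ->
  exists psi : X -> R, [/\ cont_compact_support psi, forall x, 0 <= psi x,
    forall x, psi x != 0 -> U x & forall x, K x -> 2 <= psi x].
Proof.
move=> cK oU KU.
have [rad radP] : {rad : X -> R & forall z, U z ->
    [/\ 0 < rad z, ball z (rad z) `<=` U & precompact (ball z (rad z))]}.
  apply: (@choice _ _ (fun z r => U z ->
    [/\ 0 < r, ball z r `<=` U & precompact (ball z r)])) => z.
  have [Uz|nU] := pselect (U z); last by exists 0.
  have [r r0 rU] := open_ball_sub oU Uz; have [e e0 pe] := precompact_ball z.
  exists (Num.min r e) => _; split; first by rewrite lt_min r0.
  - apply: subset_trans rU; apply: ball_sub.
    by rewrite mdistxx add0r ge_min lexx.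
  - apply: precompact_subset pe; apply: ball_sub.
    by rewrite mdistxx add0r ge_min lexx orbT.
have [|s [sK sc]] := @compact_balls K (fun z => rad z / 2) cK.
  by move=> z /KU /radP[? _ _]; lra.
suff [psi [ccs psi0 psiU psis]] : exists psi : X -> R,
    [/\ cont_compact_support psi, forall x, 0 <= psi x,
    forall x, psi x != 0 -> U x &
    forall z x, z \in s -> ball z (rad z / 2) x -> 2 <= psi x].
  by exists psi; split=> // x /sc[z zs zx]; exact: psis zx.
elim: s {sc} sK => [|z s IH] sK.
  exists (cst 0); split=> // [|x]; last by rewrite eqxx.
  split; first exact: cst_continuous.
  rewrite (_ : [set x | _] = set0); first by rewrite closure0; exact: compact0.
  by apply/seteqP; split=> x //=; rewrite eqxx.
have [|psi [[cpsi kpsi] psi0 psiU psis]] := IH.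
  by move=> y ys; apply: sK; rewrite inE ys orbT.
have [rz zU zp] := radP _ (KU _ (sK z (mem_head _ _))).
pose b x := 4 * Num.max (1 - mdist z x / rad z) 0.
have b0 x : 0 <= b x by rewrite mulr_ge0// le_max lexx orbT.
have bball x : b x != 0 -> ball z (rad z) x.
  move=> bx; apply/ball_mdist; rewrite ltNge; apply: contra bx => zx.
  rewrite /b max_r ?mulr0// subr_le0 ler_pdivlMr// mul1r.
  exact: zx.
have cb : continuous b.
  apply: continuousZ => x.
  apply: (@continuous_max _ _ (fun x => 1 - mdist z x / rad z) (cst 0));
    last exact: cvg_cst.
  apply: cvgB; first exact: cvg_cst.
  by apply: cvgMr_tmp; exact: continuous_mdist.
exists (psi \+ b); split.
- split; first exact: continuous_add.
  apply: (@supp_compact_sub _ _ psi b) => //.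
    move=> x /= pb; apply: contrapT => /not_orP[/negP + /negP].
    by rewrite !negbK => /eqP p1 /eqP p2; rewrite p1 p2 addr0 eqxx in pb.
  move: zp; rewrite precompactE => kz; apply: (subclosed_compact _ kz).
    exact: closed_closure.
  by apply: closureS => x; exact: bball.
- by move=> x; exact: addr_ge0.
- move=> x /= pb; have [p1|p1] := eqVneq (psi x) 0; last exact: psiU.
  by apply/zU/bball; move: pb; rewrite p1 add0r.
- move=> y x; rewrite inE => /orP[/eqP -> /ball_mdist zx|ys yx] /=.
    have : mdist z x / rad z < 2^-1.
      by rewrite ltr_pdivrMr// mulrC.
    rewrite /b; have := psi0 x => p0 h.
    by rewrite max_l; lra.
  by have := psis _ _ ys yx; have := b0 x; lra.
Qed.

End topology.

(** * Sigma-compactness from the measure *)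

Section sigma_compactness.
Context {d : measure_display} {R : realType} {X : borelMetricType d R}.
Variable m : {measure set X -> \bar R}.
Hypothesis hlc : locally_compact [set: X].
Hypothesis hrad : radon_measure m.
Hypothesis hsupp : measure_support m = [set: X].
Hypothesis hVD : volume_doubling m.

Lemma compact_fin (K : set X) : compact K -> (m K < +oo)%E.
Proof. by case: hrad => + _ _; exact. Qed.

Lemma open_pos (U : set X) x : open U -> U x -> (0 < m U)%E.
Proof.
move=> oU Ux; have : measure_support m x by rewrite hsupp.
exact.
Qed.

(** Doubling propagates finiteness from a small precompact ball to all concentric ones. *)
Lemma ball_fin (x : X) (r : R) : (m (ball x r) < +oo)%E.
Proof.
have [e e0 pe] := precompact_ball hlc x.
have mb y s : measurable (ball y s : set X) by apply: open_borel; exact: open_mball.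
have fe : (m (ball x e) < +oo)%E.
  have [K bK [cK clK]] := pe; apply: (le_lt_trans _ (compact_fin cK)).
  by apply: le_measure; rewrite ?inE//; exact: compact_borel.
have [C CP] := hVD.
have fin n : (m (ball x (2 ^+ n * e)) < +oo)%E.
  elim: n => [|n IH]; first by rewrite expr0 mul1r.
  have p0 : 0 < 2 ^+ n * e by rewrite mulr_gt0// exprn_gt0.
  rewrite exprS -mulrA; apply: (le_lt_trans (CP x _ p0)).
  have : (m (ball x (2 ^+ n * e))) \is a fin_num by rewrite ge0_fin_numE.
  by move/fineK => <-; rewrite -EFinM ltry.
have [n nr] : exists n : nat, r <= 2 ^+ n * e.
  exists (Num.truncn (r / e)).+1; rewrite -ler_pdivrMr//.
  have h := truncnS_gt (r / e); apply: (le_trans (ltW h)).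
  by rewrite -natrX ler_nat; apply: ltnW; exact: ltn_expl.
apply: (le_lt_trans _ (fin n)); apply: le_measure; rewrite ?inE//.
by apply: ball_sub; rewrite mdistxx add0r.
Qed.

(** Inner regularity gives compact sets exhausting the mass of each ball about [x0]. An open set
    charges some such ball, so it cannot miss a compact set whose defect of mass is smaller than
    that charge. *)
Lemma open_near_compact (x0 : X) : exists K : nat -> nat -> set X,
  (forall i j, compact (K i j)) /\
  forall (U : set X) x, open U -> U x -> exists i j, K i j `&` U !=set0.
Proof.
have mb y s : measurable (ball y s : set X) by apply: open_borel; exact: open_mball.
have H i j : exists K, [/\ compact K, K `<=` ball x0 i%:R &
    (m (ball x0 i%:R) - (j.+1%:R^-1)%:E < m K)%E].
  have j0 : (0 < (j.+1%:R^-1)%:E :> \bar R)%E by rewrite lte_fin invr_gt0.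
  have [_ _ /(_ _ (open_mball x0 i%:R)) mE] := hrad.
  have fin : m (ball x0 i%:R) \is a fin_num by rewrite ge0_fin_numE// ball_fin.
  have : (m (ball x0 i%:R) - (j.+1%:R^-1)%:E < m (ball x0 i%:R))%E.
    by rewrite lteBlDr// lteDl.
  rewrite [X in (_ < X)%E]mE => /ereal_sup_gt[_ [K [cK Ki] <-] lt].
  by exists K.
have Hc i : exists K : nat -> set X, forall j, [/\ compact (K j),
    K j `<=` ball x0 i%:R & (m (ball x0 i%:R) - (j.+1%:R^-1)%:E < m (K j))%E].
  by have [K KP] := choice (H i); exists K.
have [K KP] := choice Hc.
exists K; split=> [i j|U x oU Ux]; first by case: (KP i j).
pose i := (Num.truncn (mdist x0 x)).+1.
have xi : ball x0 i%:R x by apply/ball_mdist; exact: truncnS_gt.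
have oV : open (U `&` ball x0 i%:R) by apply: openI => //; exact: open_mball.
have V0 := open_pos oV (conj Ux xi).
set V := U `&` _ in oV V0.
have mV := open_borel oV.
have finV : m V \is a fin_num.
  rewrite ge0_fin_numE//; apply: (le_lt_trans _ (ball_fin x0 i%:R)).
  by apply: le_measure; rewrite ?inE// => y [].
have f0 : 0 < fine (m V) by rewrite fine_gt0// V0/= -ge0_fin_numE.
have [j _ /(_ j (leqnn j)) jV] := near_infty_natSinv_lt (PosNum f0).
exists i, j; apply: contrapT => /set0P/negP; rewrite negbK => /eqP KU0.
have [cK Ki lt] := KP i j.
have mK := compact_borel cK.
have KV0 : K i j `&` V = set0.
  by apply/seteqP; split=> // y [Ky [Uy _]]; rewrite -KU0.
have : (m (K i j) + m V <= m (ball x0 i%:R))%E.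
  rewrite -measureU//; apply: le_measure; rewrite ?inE//.
    exact: measurableU.
  by move=> y [/Ki//|[]].
apply/negP; rewrite -ltNge.
have fin : m (ball x0 i%:R) \is a fin_num by rewrite ge0_fin_numE// ball_fin.
move: lt; rewrite lteBlDr// => lt; apply: (lt_le_trans lt).
rewrite leeD2l// -(fineK finV) lee_fin ltW//.
Qed.

(** The compact sets of [open_near_compact] have dense union, so small balls about their points
    cover the space. Only centres whose threefold ball is precompact are kept: the twofold balls
    about a finite net of a compact set then remain precompact and contain the whole union. *)
Lemma precompact_cover : exists G : nat -> set X,
  [/\ forall n, open (G n), forall n, precompact (G n) & forall x, exists n, G n x].
Proof.
have [K [cK Kd]] := open_near_compact point.
pose e j : R := j.+1%:R^-1.
have e0 j : 0 < e j by rewrite invr_gt0.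
pose G i j k := [set y | exists2 z, K i j z &
  precompact (ball z (3 * e k)) /\ ball z (e k) y].
have oG i j k : open (G i j k).
  rewrite openE => y [z Kz [pz zy]]; rewrite /interior.
  have : nbhs y (ball z (e k)).
    by apply: open_nbhs_nbhs; split => //; exact: open_mball.
  by apply: filterS => w zw; exists z.
have pG i j k : precompact (G i j k).
  have [//|s [sK sc]] := compact_balls (rad := fun=> e k) (cK i j).
  pose B := \big[setU/set0]_(z <- s | `[< precompact (ball z (2 * e k)) >])
    closure (ball z (2 * e k)).
  have cB : compact B.
    apply: bigsetU_compact => z /asboolP.
    by rewrite precompactE.
  apply: precompact_subset (precompact_compact cB) => y [z Kz [pz zy]].
  have [w ws wz] := sc z Kz.
  have wpre : precompact (ball w (2 * e k)).
    apply: precompact_subset pz; apply: ball_sub.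
    by move: wz => /ball_mdist; rewrite metric_sym; lra.
  rewrite /B -bigcup_seq_cond; exists w => /=; first by rewrite ws; apply/asboolP.
  apply: subset_closure; apply/ball_mdist.
  apply: (le_lt_trans (metric_triangle w z y)).
  by move: wz zy => /ball_mdist ? /ball_mdist ?; lra.
pose GG n := if unpickle n is Some (i, (j, k)) then G i j k else set0.
exists GG; split.
- by move=> n; rewrite /GG; case: unpickle => [[i [j k]]|]; [exact: oG|exact: open0].
- move=> n; rewrite /GG; case: unpickle => [[i [j k]]|]; first exact: pG.
  by apply: precompact_compact; exact: compact0.
move=> y; have [r r0 pr] := precompact_ball hlc y.
have r4 : 0 < r / 4 by lra.
have [k _ /(_ k (leqnn k)) kr] := near_infty_natSinv_lt (PosNum r4).
have kr' : e k < r / 4 := kr.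
have [i [j [z [Kz yz]]]] := Kd _ _ (open_mball y (e k)) (ballxx _ (e0 k)).
exists (pickle (i, (j, k))); rewrite /GG pickleK; exists z => //; split.
  apply: precompact_subset pr; apply: ball_sub.
  by move: yz => /ball_mdist; lra.
exact: ball_sym.
Qed.

End sigma_compactness.

(** * Cutoff functions and exhaustions in the core *)

Section urysohn.
Context {d : measure_display} {R : realType} {X : borelMetricType d R}.
Variable m : {measure set X -> \bar R}.
Variables (F : set (X -> R)) (E : (X -> R) -> (X -> R) -> R).
Hypothesis hD : dirichlet_form m F E.
Hypothesis hR : regular_form m F E.
Hypothesis hlc : locally_compact [set: X].
Implicit Types (f g h : X -> R) (K U : set X).

(** A core function g within 1/2 of the bump exceeds 3/2 on K, so clipping g - clip 2^-1 g at 1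
    gives 1 there. Its support lies in {g >= 1/2}, where the bump is positive. *)
Lemma core_urysohn K U : compact K -> open U -> K `<=` U ->
  exists a : X -> R, [/\ core F a, forall x, 0 <= a x <= 1,
    forall x, K x -> a x = 1 & supp a `<=` U].
Proof.
move=> cK oU KU; have [psi [cpsi psi0 psiU psiK]] := bump hlc cK oU KU.
have h : 0 < 2^-1 :> R by rewrite invr_gt0.
have [g cg gpsi] := hR.2 psi cpsi _ h.
have {}cg : core F g by [].
exists (clip 1 (g \- clip 2^-1 g)); split.
- apply: (core_clip hD) => //; apply: (coreB hD) => //.
  exact: (core_clip hD).
- by move=> x; case: (clipP (g \- clip 2^-1 g) x (@ltr01 R)) => *; lra.
- move=> x /psiK px; have := gpsi x; rewrite ltr_norml => /andP[g1 g2].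
  have /= := clipP (g \- clip 2^-1 g) x (@ltr01 R).
  by move: (clipP g x h) => [?|? ?|?] [?|? ?|?]; lra.
have clg : closed [set x | 2^-1 <= g x].
  by apply: closed_ge_cont; exact: core_cont cg.
apply: (@subset_trans _ [set x | 2^-1 <= g x]).
  rewrite [X in _ `<=` X](closure_id _).1//; apply: closureS => x /= /eqP ax.
  rewrite leNgt; apply/negP => gx; apply: ax.
  have /= := clipP (g \- clip 2^-1 g) x (@ltr01 R).
  by move: (clipP g x h) => [?|? ?|?] [?|? ?|?]; lra.
move=> x /= gx; apply: psiU; have := gpsi x; have := psi0 x.
rewrite ltr_norml => p0 /andP[g1 g2].
by rewrite gt_eqF//; lra.
Qed.

Hypothesis hrad : radon_measure m.
Hypothesis hsupp : measure_support m = [set: X].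
Hypothesis hVD : volume_doubling m.

(** Each function is made equal to 1 on the support of the previous one and on the next set of a
    compact exhaustion of U. Being 1 where the predecessor is nonzero gives monotonicity, and cuts U
    into an inner part and a remainder of small cost. *)
Lemma core_exhaustion U : open U -> exists a : nat -> X -> R,
  [/\ forall n, core F (a n), forall n x, 0 <= a n x <= 1,
    forall n x, a n x != 0 -> U x, forall n x, a n x != 0 -> a n.+1 x = 1 &
    forall x, U x -> exists n, a n x = 1].
Proof.
move=> oU; have [G [oG pG Gcov]] := precompact_cover hlc hrad hsupp hVD.
pose e j : R := j.+1%:R^-1.
have e0 j : 0 < e j by rewrite invr_gt0.
pose Z j := [set x | ball x (e j) `<=` U].
have cZ j : closed (Z j).
  rewrite -openC openE => x /= /existsNP[y /not_implyP[xy Uy]].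
  rewrite /interior; have : nbhs x (ball y (e j)).
    apply: open_nbhs_nbhs; split; first exact: open_mball.
    exact: ball_sym.
  by apply: filterS => z yz zU; apply: Uy; apply: zU; exact: ball_sym.
pose K i j := closure (G i) `&` Z j.
have cK i j : compact (K i j).
  apply: compact_closedI => //.
  by have := pG i; rewrite precompactE.
have KU i j : K i j `<=` U.
  by move=> x [_ /(_ x)]; apply; exact: ballxx.
pose KK n := if unpickle n is Some (i, j) then K i j else set0.
have cKK n : compact (KK n).
  by rewrite /KK; case: unpickle => [[i j]|]; [exact: cK|exact: compact0].
have KKU n : KK n `<=` U.
  by rewrite /KK; case: unpickle => [[i j]|x []]; exact: KU.
have KKcov x : U x -> exists n, KK n x.
  move=> Ux; have [i Gx] := Gcov x; have [r r0 rU] := open_ball_sub oU Ux.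
  have [j _ /(_ j (leqnn j)) jr] := near_infty_natSinv_lt (PosNum r0).
  exists (pickle (i, j)); rewrite /KK pickleK; split.
    exact: subset_closure.
  apply: subset_trans rU; apply: ball_sub.
  by rewrite mdistxx add0r; exact: ltW.
pose good a := [/\ core F a, forall x, 0 <= a x <= 1 & supp a `<=` U].
have [S SP] : {S : nat -> (X -> R) -> (X -> R) & forall n a, good a ->
    [/\ good (S n a), forall x, supp a x -> S n a x = 1 &
      forall x, KK n x -> S n a x = 1]}.
  apply: (@choice _ _ (fun n S => forall a, good a -> [/\ good (S a),
    forall x, supp a x -> S a x = 1 & forall x, KK n x -> S a x = 1])) => n.
  suff H a : exists b, good a -> [/\ good b,
      forall x, supp a x -> b x = 1 & forall x, KK n x -> b x = 1].
    by have [S SP] := choice H; exists S.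
  have [ga|na] := pselect (good a); last by exists a => /na.
  have [[_ [_ ka]] _ aU] := ga.
  have [||b [cb b01 bK bU]] := @core_urysohn (supp a `|` KK n) U _ oU.
  - exact: compactU.
  - by move=> x [/aU|/KKU].
  by exists b => _; split=> // [x xa|x xK]; apply: bK; [left|right].
pose fix a n := if n is k.+1 then S k (a k) else cst 0.
have ga n : good (a n).
  elim: n => [|n IH] /=; last by have [] := SP n _ IH.
  have s0 : supp (cst 0 : X -> R) = set0.
    rewrite /supp (_ : [set x | _] = set0) ?closure0//.
    by apply/seteqP; split=> x //=; rewrite eqxx.
  split=> [|x|]; last 2 first.
  - by rewrite lexx ler01.
  - by rewrite s0.
  split; first exact: dirichlet0 hD.
  by split; [exact: cst_continuous|rewrite -/(supp _) s0; exact: compact0].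
exists a; split.
- by move=> n; case: (ga n).
- by move=> n; case: (ga n).
- move=> n x an; have [_ _ +] := ga n; apply.
  exact: subset_closure.
- by move=> n x an /=; have [_ + _] := SP n _ (ga n); apply; exact: subset_closure.
- move=> x /KKcov[n xn]; exists n.+1; have [_ _ +] := SP n _ (ga n).
  exact.
Qed.

End urysohn.

(** * Properties of the carre du champ *)

Section carre_properties.
Context {d : measure_display} {R : realType} {X : borelMetricType d R}.
Variable m : {measure set X -> \bar R}.
Variables (F : set (X -> R)) (E : (X -> R) -> (X -> R) -> R).
Hypothesis hD : dirichlet_form m F E.
Hypothesis hR : regular_form m F E.
Hypothesis hS : strongly_local m F E.
Hypothesis hlc : locally_compact [set: X].
Hypothesis hK : forall K : set X, compact K -> (m K < +oo)%E.
Implicit Types (f g h k v w p q : X -> R) (u : nat -> X -> R) (a c e M K : R).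

Local Notation enorm := (enorm E).
Local Notation core := (core F).
Local Notation bdom := (bdom F).
Local Notation carre := (carre E).
Let domD := domD hD.
Let domB := domB hD.
Let domZ := domZ hD.
Let bdomM := bdomM hD.
Let bdomD := bdomD hD.
Let bdomB := bdomB hD.
Let bdomZ := bdomZ hD.
Let coreD := coreD hD.
Let coreB := coreB hD.
Let coreZ := coreZ hD.
Let coreM := coreM hD.
Let core_clip := core_clip hD.
Let orth := core_orth hD hS hK.

(** The trivial comparison E <= 2 E of energies gives Gamma <= 2 Gamma by [carre_le], that is Gamma
    >= 0. *)
Lemma carre_ge0 f h : bdom f -> bdom h -> (forall x, 0 <= h x) -> 0 <= carre f h.
Proof.
move=> bf bh h0.
have hC v : F v -> E v v <= 2 * E v v.
  by move=> Fv; have := dirichlet_ge0 hD Fv; lra.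
have := carre_le hD hS hD hR hS hK (ler0n R 2) hC bf bh h0.
lra.
Qed.

Lemma carreB f g h : bdom f -> bdom g -> bdom h ->
  carre f (g \- h) = carre f g - carre f h.
Proof.
move=> bf bg bh; have := carre_linear hD (-1) bf bh bg.
rewrite (_ : (fun x => _) = g \- h); first by move=> ->; lra.
by apply/funext => x /=; lra.
Qed.

Lemma carre_le_weight f g h : bdom f -> bdom g -> bdom h ->
  (forall x, g x <= h x) -> carre f g <= carre f h.
Proof.
move=> bf bg bh gh; rewrite -subr_ge0 -carreB//.
apply: carre_ge0 => //; first exact: bdomB.
by move=> x /=; rewrite subr_ge0.
Qed.

(** Twice the integral of h against the mixed energy measure Gamma(f, g). *)
Definition cross f g h : R :=
  E f (g \* h) + E g (f \* h) - E (f \* g) h.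

Lemma carreD f g h : bdom f -> bdom g -> bdom h ->
  carre (f \+ g) h = carre f h + cross f g h + carre g h.
Proof.
move=> bf bg bh; have Ff := bdom_dom bf; have Fg := bdom_dom bg.
have Fh := bdom_dom bh.
have Ffh := bdom_dom (bdomM bf bh); have Fgh := bdom_dom (bdomM bg bh).
have Fff := bdom_dom (bdomM bf bf); have Fgg := bdom_dom (bdomM bg bg).
have Ffg := bdom_dom (bdomM bf bg); have F2fg := domZ 2 Ffg.
have FA := domD Fff F2fg.
rewrite /carre /cross.
have -> : (f \+ g) \* h = (f \* h) \+ (g \* h) by apply/funext => x /=; ring.
have -> : (f \+ g) \* (f \+ g) = ((f \* f) \+ (fun x => 2 * (f \* g) x)) \+ (g \* g).
  by apply/funext => x /=; ring.
rewrite (formDl hD Ff Fg (domD Ffh Fgh)) !(formDr hD Ffh Fgh)//.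
rewrite (formDl hD FA Fgg Fh) (formDl hD Fff F2fg Fh) (formZl hD)//.
by lra.
Qed.

Lemma carreZ a f h : bdom f -> bdom h ->
  carre (fun x => a * f x) h = a ^+ 2 * carre f h.
Proof.
move=> bf bh; have Ff := bdom_dom bf; have Fh := bdom_dom bh.
have Ffh := bdom_dom (bdomM bf bh); have Fff := bdom_dom (bdomM bf bf).
rewrite /carre.
have -> : (fun x => a * f x) \* h = fun x => a * (f \* h) x.
  by apply/funext => x /=; ring.
have -> : (fun x => a * f x) \* (fun x => a * f x) = fun x => a ^+ 2 * (f \* f) x.
  by apply/funext => x /=; ring.
have FZ := domZ a Ffh.
by rewrite !(formZl hD)// (formZr hD)//; lra.
Qed.

Lemma crossZ a f g h : bdom f -> bdom g -> bdom h ->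
  cross f (fun x => a * g x) h = a * cross f g h.
Proof.
move=> bf bg bh; have Ff := bdom_dom bf; have Fg := bdom_dom bg.
have Fh := bdom_dom bh; have Ffg := bdom_dom (bdomM bf bg).
have Ffh := bdom_dom (bdomM bf bh); have Fgh := bdom_dom (bdomM bg bh).
rewrite /cross.
have -> : (fun x => a * g x) \* h = fun x => a * (g \* h) x.
  by apply/funext => x /=; ring.
have -> : f \* (fun x => a * g x) = fun x => a * (f \* g) x.
  by apply/funext => x /=; ring.
by rewrite !(formZl hD)// (formZr hD)//; lra.
Qed.

Lemma cross_self f h : cross f f h = 2 * carre f h.
Proof. by rewrite /cross /carre; lra. Qed.

Lemma carreB_ge0 f g h : bdom f -> bdom g -> bdom h -> (forall x, 0 <= h x) ->
  cross f g h <= carre f h + carre g h.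
Proof.
move=> bf bg bh h0; have bN := bdomZ (-1) bg.
have := carre_ge0 (bdomD bf bN) bh h0.
by rewrite carreD// crossZ// carreZ//; lra.
Qed.

(** Positivity of Gamma(u_n - v, u_n - v) bounds [carre] of u_n below by an expression that is
    affine in u_n, hence converges weakly, with limit [carre] of v. *)
Lemma carre_lsc u v h M K (b : nat -> R) c : 0 < M -> bdom v -> bdom h ->
  (forall x, 0 <= h x) -> weakly_bounded m F E u v M K ->
  (forall n, carre (u n) h <= b n) -> b n @[n --> \oo] --> c -> carre v h <= c.
Proof.
move=> M0 bv bh h0 wu ub bc; have [Fu Fv uM _ _] := wu.
have bu n : bdom (u n) by split=> //; exists M.
have [M1 [K1 [_ wh]]] := weakly_bounded_mul hD M0 bv wu bh.
have [M2 [K2 [_ wv]]] := weakly_bounded_mul hD M0 bv wu bv.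
have bvh := bdomM bv bh.
have cv : cross (u n) v h @[n --> \oo] --> cross v v h.
  rewrite /cross; apply: cvgB; first apply: cvgD.
  - exact: (weakly_bounded_cvg hD wu (bdom_dom bvh)).
  - rewrite (_ : (fun n => _) = (fun n => E (h \* u n) v)); last first.
      apply/funext => n; rewrite (formC hD Fv (bdom_dom (bdomM (bu n) bh))).
      by congr E; apply/funext => x; exact: mulrC.
    rewrite (formC hD Fv (bdom_dom bvh)).
    rewrite (_ : v \* h = h \* v); last by apply/funext => x; exact: mulrC.
    exact: (weakly_bounded_cvg hD wh Fv).
  - rewrite (_ : (fun n => _) = (fun n => E (v \* u n) h)); last first.
      by apply/funext => n; congr E; apply/funext => x; exact: mulrC.
    exact: (weakly_bounded_cvg hD wv (bdom_dom bh)).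
have : cross v v h - carre v h <= c.
  apply: (ler_cvg_to (cvgB cv (cvg_cst (carre v h))) bc).
  apply: nearW => n; have := carreB_ge0 (bu n) bv bh h0.
  by have := ub n => h1 h2; rewrite -[leLHS]/(cross (u n) v h - carre v h); lra.
by rewrite cross_self; lra.
Qed.

Lemma core_one (K : set X) : compact K -> exists k, [/\ core k, forall x, 0 <= k x <= 1 &
  forall x, K x -> k x = 1].
Proof.
move=> cK; have [k [ck k01 k1 _]] := core_urysohn hD hR hlc cK openT (@subsetT _ K).
by exists k.
Qed.

(** A core function k equal to 1 on both supports represents the total mass: [carre] of f on k is
    E(f, f), as E(f^2, k) = 0 by locality, and h <= c k. *)
Lemma carre_core_le_form f h c : core f -> core h -> 0 <= c ->
  (forall x, h x <= c) -> carre f h <= c * E f f.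
Proof.
move=> cf ch c0 hc.
have kf : compact (supp f) by case: cf => _ [].
have kh : compact (supp h) by case: ch => _ [].
have [k [ck k01 k1]] := core_one (compactU kf kh).
have cff := coreM cf cf; have bf := core_bdom cf; have bk := core_bdom ck.
have fk x : f x != 0 -> k x = 1.
  by move=> fx; apply: k1; left; exact: subset_closure.
have -> : E f f = carre f k.
  rewrite /carre.
  have -> : f \* k = f.
    apply/funext => x /=; have [->|/fk ->] := eqVneq (f x) 0.
      by rewrite mul0r.
    by rewrite mulr1.
  rewrite (orth cff ck (c := 1)) ?mulr0 ?subr0//.
  by move=> x /= fx; apply: fk; apply: contra fx => /eqP ->; rewrite mul0r.
have := carre_linear hD c bf bk (core_bdom (coreZ 0 ch)).
have -> : carre f (fun x => 0 * h x) = 0.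
  have := carre_linear hD (-1) bf (core_bdom ch) (core_bdom ch).
  rewrite (_ : (fun x => _) = (fun x => 0 * h x)); first by move=> ->; lra.
  by apply/funext => x; lra.
rewrite addr0 => <-; apply: carre_le_weight => //.
- exact: core_bdom.
- by apply: bdomD; [exact: bdomZ|apply: bdomZ; exact: core_bdom].
move=> x; rewrite mul0r addr0; have [h0|h0] := eqVneq (h x) 0.
  by rewrite h0 mulr_ge0//; have /andP[] := k01 x.
by rewrite k1 ?mulr1//; right; exact: subset_closure.
Qed.

Lemma enorm_cvg u v : (forall n, F (u n)) -> F v ->
  enorm (u n \- v) @[n --> \oo] --> 0 -> E (u n) (u n) @[n --> \oo] --> E v v.
Proof.
move=> Fu Fv uv.
have nv : enorm (u n) @[n --> \oo] --> enorm v.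
  apply/subr_cvg0; apply: cvg0_le uv => n; rewrite ler_norml; apply/andP; split.
    rewrite lerNl opprB lerBlDr.
    have -> : enorm v = enorm (u n \- (u n \- v)).
      by congr enorm; apply/funext => x /=; lra.
    by rewrite addrC; apply: (enormB hD) => //; exact: domB.
  rewrite lerBlDr; have {1}-> : u n = (u n \- v) \+ v.
    by apply/funext => x /=; lra.
  by apply: (enormD hD) => //; exact: domB.
rewrite -(enorm2 hD Fv) (_ : (fun n => _) = (fun n => enorm (u n) * enorm (u n))).
  by rewrite expr2; exact: cvgM.
by apply/funext => n; rewrite -(enorm2 hD)// expr2.
Qed.

Lemma carre_le_form f h c : bdom f -> bdom h -> 0 < c ->
  (forall x, 0 <= h x <= c) -> carre f h <= c * E f f.
Proof.
move=> bf bh c0 hc; have [Ff [M M0 fM]] := bf.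
have [u [K [cu wu uf _]]] := core_approx hD hR M0 Ff fM.
have hN x : `|h x| <= c by have /andP[h0 h1] := hc x; rewrite ger0_norm.
have [k [L [ck wk _ k0]]] := core_approx hD hR c0 (bdom_dom bh) hN.
have {}k0 : forall n x, 0 <= k n x by apply: k0 => x; have /andP[] := hc x.
have Fu n := core_dom (cu n).
have step n : carre f (k n) <= c * E f f.
  have bk := core_bdom (ck n).
  apply: (ler_cvg_to (carre_cvg hD M0 bf bk wu uf)
    (cvgMl_tmp (a := c) (enorm_cvg Fu Ff uf))).
  apply: nearW => i; apply: carre_core_le_form => //; first exact: ltW.
  by have [_ _ kM _ _] := wk; move=> x; apply: le_trans (ler_norm _) (kM n x).
apply: (cvgr_to_le (carre_cvgr hD c0 bf bh wk)).
by apply: nearW => n; exact: step.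
Qed.

(** The function g is its clip plus the part above a minus the part below 0. Each summand is
    constant where a later one lives, so [carre_split] applies repeatedly. *)
Lemma carre_clip_split a g h : 0 < a -> core g -> core h ->
  carre g h = carre (clip a g) h + carre (g \- clip a g) h.
Proof.
move=> a0 cg ch; have cp := core_clip a0 cg.
have cr : core (g \- clip a g) by exact: coreB.
have [q1 [q2 [c1 c2 q10 q20 [q12 rE _]]]] := core_posneg hD cr.
have rEx x : g x - clip a g x = q1 x - q2 x.
  by rewrite -[LHS]/((g \- clip a g) x) rE.
have qp1 x : q1 x != 0 -> clip a g x = a.
  move=> q1x; have := rEx x; have := q10 x.
  have : q2 x = 0 by apply: contra_neq_eq q1x => /q12.
  move: q1x => /eqP; case: (clipP g x a0) => *; first [done | lra].
have qp2 x : q2 x != 0 -> (clip a g \+ q1) x = 0.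
  move=> q2x; have := rEx x; have := q20 x; have /= := q12 x q2x.
  move: q2x => /eqP; case: (clipP g x a0) => *; lra.
have cA : core (clip a g \+ q1) by exact: coreD.
have -> : g = (clip a g \+ q1) \- q2.
  by apply/funext => x; have := rEx x; rewrite /=; lra.
have [_ ->] := carre_split hD hS hK cA c2 ch qp2.
have [-> _] := carre_split hD hS hK cp c1 ch qp1.
have gE : (clip a g \+ q1) \- q2 = g.
  by apply/funext => x; have := rEx x; rewrite /=; lra.
rewrite gE rE; have [_ ->] := carre_split hD hS hK c1 c2 ch q12.
by lra.
Qed.

Lemma carre_core_clip a g h : 0 < a -> core g -> core h -> (forall x, 0 <= h x) ->
  carre (clip a g) h <= carre g h /\ carre (g \- clip a g) h <= carre g h.
Proof.
move=> a0 cg ch h0; rewrite (carre_clip_split a0 cg ch).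
have bh := core_bdom ch; have cp := core_clip a0 cg.
have := carre_ge0 (core_bdom cp) bh h0.
have := carre_ge0 (core_bdom (coreB cg cp)) bh h0.
by split; lra.
Qed.

(** The images T(u_n) of core approximations are only known to converge weakly to T(f), so the
    inequality passes to the limit by lower semicontinuity on the left and strong convergence on the
    right. *)
Lemma carre_contraction (T : (X -> R) -> (X -> R)) f h L c :
  0 < L ->
  (forall g, core g -> core (T g)) ->
  (forall g, F g -> F (T g) /\ enorm (T g) <= L * enorm g) ->
  (forall g g' x, `|T g x - T g' x| <= L * `|g x - g' x|) ->
  (forall g x, `|T g x| <= L * `|g x|) ->
  (forall g, core g -> carre (T g) h <= c * carre g h) ->
  bdom f -> core h -> (forall x, 0 <= h x) -> carre (T f) h <= c * carre f h.
Proof.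
move=> L0 Tc TE Tlip Tb Th bf ch h0; have [Ff [M M0 fM]] := bf.
have [u [K [cu wu uf _]]] := core_approx hD hR M0 Ff fM.
have bh := core_bdom ch; have [Fu _ uM uK us] := wu.
have [FT _] := TE _ Ff; have cM0 : 0 < L * M by exact: mulr_gt0.
have bT : bdom (T f).
  split=> //; exists (L * M) => // x; apply: (le_trans (Tb f x)).
  by rewrite ler_pM2l.
apply: (@carre_lsc (fun n => T (u n)) _ _ (L * M) (L * K)
  (fun n => c * carre (u n) h)) => //; last first.
- by apply: cvgMl_tmp; exact: (carre_cvg hD M0 bf bh wu uf).
- by move=> n; exact: Th.
split=> //.
- by move=> n; case: (TE _ (Fu n)).
- by move=> n x; apply: (le_trans (Tb _ x)); rewrite ler_pM2l.
- move=> n; have [_ H] := TE _ (Fu n); apply: (le_trans H).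
  by rewrite ler_pM2l.
apply: (@cvg0_le _ _ (fun n => L ^+ 2 * sqn m (u n \- f))); last exact: cvg0Z.
move=> n; rewrite ger0_norm ?sqn_ge0//.
have L2 : sqint m (u n \- f) by apply: (dom_sqint hD); exact: domB.
rewrite -sqnZ//; apply: sqn_le; first exact: sqintZ.
  apply: (dom_measurable hD); apply: domB => //; by case: (TE _ (Fu n)).
by move=> x /=; rewrite [leRHS]normrM (gtr0_norm L0).
Qed.

Lemma clip_lip a g g' (x : X) : 0 < a -> `|clip a g x - clip a g' x| <= `|g x - g' x|.
Proof.
move=> a0; rewrite ler_norml; have := ler_norm (g x - g' x).
have := ler_norm (- (g x - g' x)); rewrite normrN.
move: (clipP g x a0) (clipP g' x a0) => [?|? ?|?] [?|? ?|?]; lra.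
Qed.

Lemma enorm_clip a g : 0 < a -> F g -> F (clip a g) /\ enorm (clip a g) <= enorm g.
Proof.
by move=> a0 Fg; have [Fc Ec] := clip_dom hD a0 Fg; split=> //; exact: ler_wsqrtr.
Qed.

(* Constant on neighbourhoods of {g = 0} and of {g = 1}: the energy measure of a
   steepened cutoff function does not charge the boundary of the annulus. *)
Definition slope4 g : X -> R := fun x => 2 * (clip (3 / 4) g \- clip 4^-1 g) x.

Lemma slope4_dom g : F g -> F (slope4 g) /\ enorm (slope4 g) <= 4 * enorm g.
Proof.
move=> Fg; have a0 : 0 < 3 / 4 :> R by lra.
have b0 : 0 < 4^-1 :> R by lra.
have [F1 E1] := enorm_clip a0 Fg; have [F2 E2] := enorm_clip b0 Fg.
have FB := domB F1 F2; split; first exact: domZ.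
rewrite (enormZ hD)// normr_nat.
by have := enormB hD F1 F2; lra.
Qed.

Lemma carre_slope4 f h : bdom f -> core h -> (forall x, 0 <= h x) ->
  carre (slope4 f) h <= 4 * carre f h.
Proof.
move=> bf ch h0; have a0 : 0 < 3 / 4 :> R by lra.
have b0 : 0 < 4^-1 :> R by lra.
apply: (@carre_contraction slope4 f h 4) => //.
- move=> g cg; apply: coreZ; apply: coreB; exact: core_clip.
- exact: slope4_dom.
- move=> g g' x; rewrite /slope4/= -mulrBr normrM normr_nat.
  have := clip_lip g g' x a0; have := clip_lip g g' x b0.
  set A := clip (3/4) g x; set B := clip (3/4) g' x.
  set A' := clip 4^-1 g x; set B' := clip 4^-1 g' x => h1 h2.
  have -> : A - A' - (B - B') = (A - B) - (A' - B') by ring.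
  by have := ler_normB (A - B) (A' - B'); lra.
- move=> g x; rewrite /slope4/= normrM normr_nat; have n0 := normr_ge0 (g x).
  have n1 := ler_norm (g x); rewrite ger0_norm.
    by move: (clipP g x a0) (clipP g x b0) => [?|? ?|?] [?|? ?|?]; lra.
  by move: (clipP g x a0) (clipP g x b0) => [?|? ?|?] [?|? ?|?]; lra.
- move=> g cg; have cA := core_clip a0 cg; have cB := core_clip b0 cg.
  rewrite (carreZ 2 (core_bdom (coreB cA cB)) (core_bdom ch)).
  have -> : clip 4^-1 g = clip 4^-1 (clip (3 / 4) g) by rewrite clip_clip//; lra.
  have [_ H1] := carre_core_clip b0 cA ch h0.
  have [H2 _] := carre_core_clip a0 cg ch h0.
  by lra.
Qed.

Lemma truncationE (n : nat) g : (0 < n)%N ->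
  truncation n g = clip n%:R g \- clip n%:R (fun x => (-1) * g x).
Proof.
rewrite -(ltr0n R) => n0; apply/funext => x; rewrite /truncation /=.
have /= := clipP (fun x => (-1) * g x) x n0.
move: (n%:R) n0 => a a0.
move: (clipP g x a0) => [?|? ?|?] [?|? ?|?];
  rewrite /Order.min; case: (ltP (g x) a) => ?; rewrite /Order.max;
  by [case: (ltP (- a) (g x)) => ?; lra|case: (ltP (- a) a) => ?; lra].
Qed.

Lemma truncation0 g : truncation 0 g = cst 0.
Proof.
apply/funext => x; rewrite /truncation mulr0n oppr0.
by rewrite max_l// ge_min lexx orbT.
Qed.

Lemma truncation_dom n g : F g ->
  F (truncation n g) /\ enorm (truncation n g) <= 2 * enorm g.
Proof.
move=> Fg; have n0 := enorm_ge0 E g; case: n => [|n].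
  rewrite truncation0; split; first exact: dirichlet0 hD.
  by rewrite /enorm (form0l hD) ?sqrtr0 ?mulr_ge0//; exact: dirichlet0 hD.
have N0 : 0 < n.+1%:R :> R by [].
have FN := domZ (-1) Fg; rewrite truncationE//.
have [F1 E1] := enorm_clip N0 Fg; have [F2 E2] := enorm_clip N0 FN.
split; first exact: domB.
apply: (le_trans (enormB hD F1 F2)); move: E2; rewrite (enormZ hD)// normrN1.
by lra.
Qed.

Lemma truncation_bnd n g (x : X) : `|truncation n g x| <= n%:R.
Proof.
rewrite /truncation ler_norml le_max lexx/= ge_max ge_min lexx orbT andbT.
by have := ler0n R n; lra.
Qed.

Lemma truncation_bdom n g : F g -> bdom (truncation n g).
Proof.
move=> Fg; have [Ft _] := truncation_dom n Fg; split=> //.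
exists n.+1%:R => // x; apply: (le_trans (truncation_bnd n g x)).
by rewrite ler_nat.
Qed.

Lemma truncation_le (n k : nat) g : (n <= k)%N ->
  truncation n (truncation k g) = truncation n g.
Proof.
move=> nk; have : n%:R <= k%:R :> R by rewrite ler_nat.
have := ler0n R n; rewrite /truncation; move: (n%:R) (k%:R) => a b a0 ab.
apply/funext => x; set y := g x.
have [yb|yb] := leP y b; last first.
  by rewrite [Num.max (- b) b]max_r ?[Num.min y a]min_r ?min_r//; lra.
have [yb'|yb'] := leP (- b) y; first by [].
by rewrite min_l ?[Num.min y a]min_l ?max_l//; lra.
Qed.

(** The truncation is the clip of g minus the clip of -g, and the latter is also the clip of -(g -
    clip a g). The two pieces thus stay below the two terms of [carre_clip_split]. *)
Lemma carre_core_truncation n g h : core g -> core h -> (forall x, 0 <= h x) ->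
  carre (truncation n g) h <= carre g h.
Proof.
move=> cg ch h0; have bh := core_bdom ch; case: n => [|n].
  rewrite truncation0; have -> : cst 0 = (fun x => 0 * g x).
    by apply/funext => x; rewrite mul0r.
  rewrite carreZ//; last exact: core_bdom.
  by rewrite expr0n/= mul0r; apply: carre_ge0 => //; exact: core_bdom.
have N0 : 0 < n.+1%:R :> R by [].
rewrite truncationE//; move: (n.+1%:R : R) N0 => a a0.
have cN := coreZ (-1) cg; have cp := core_clip a0 cg; have cq := core_clip a0 cN.
have pq x : clip a (fun x => (-1) * g x) x != 0 -> clip a g x = 0.
  have /= := clipP (fun x => (-1) * g x) x a0.
  by move: (clipP g x a0) => [?|? ?|?] [?|? ?|?] /eqP ?; lra.
have [_ ->] := carre_split hD hS hK cp cq ch pq.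
have cr := coreB cg cp; have cNr := coreZ (-1) cr.
have -> : clip a (fun x => (-1) * g x) = clip a (fun x => (-1) * (g \- clip a g) x).
  apply/funext => x.
  have /= := clipP (fun x => (-1) * g x) x a0.
  have /= := clipP (fun x => (-1) * (g \- clip a g) x) x a0.
  by move: (clipP g x a0) => [?|? ?|?] [?|? ?|?] [?|? ?|?]; lra.
have [H _] := carre_core_clip a0 cNr ch h0.
move: H; rewrite (carreZ _ (core_bdom cr) bh) sqrrN expr1n mul1r.
by have := carre_clip_split a0 cg ch; lra.
Qed.

Lemma carre_truncation n f h : bdom f -> core h -> (forall x, 0 <= h x) ->
  carre (truncation n f) h <= carre f h.
Proof.
move=> bf ch h0; rewrite -[leRHS]mul1r.
have [-> |n0] := posnP n.
  rewrite truncation0; have -> : cst 0 = (fun x => 0 * f x).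
    by apply/funext => x; rewrite mul0r.
  rewrite carreZ//; last exact: core_bdom.
  rewrite expr0n/= mul0r mul1r; apply: carre_ge0 => //; exact: core_bdom.
have N0 : 0 < n%:R :> R by rewrite ltr0n.
have tlip g g' x : `|truncation n g x - truncation n g' x| <= 2 * `|g x - g' x|.
  rewrite !truncationE//=.
  have := clip_lip g g' x N0.
  have /= := clip_lip (fun x => (-1) * g x) (fun x => (-1) * g' x) x N0.
  rewrite -mulrBr normrM normrN1 mul1r.
  set A := clip _ g x; set B := clip _ g' x.
  set A' := clip _ _ x; set B' := clip _ _ x => h1 h2.
  have -> : A - A' - (B - B') = (A - B) - (A' - B') by ring.
  by have := ler_normB (A - B) (A' - B'); lra.
apply: (@carre_contraction (truncation n) f h 2) => //.
- move=> g cg; rewrite truncationE//.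
  by apply: coreB; apply: core_clip => //; exact: coreZ.
- by move=> g; exact: truncation_dom.
- move=> g x; have := tlip g (cst 0) x; rewrite /= subr0.
  rewrite (_ : truncation n (cst 0) x = 0) ?subr0//.
  by rewrite /truncation min_l// max_r// oppr_le0.
- by move=> g cg; rewrite mul1r; exact: carre_core_truncation.
Qed.

(** Here w is not in the core. With a core function a equal to 1 on the support of k, the
    orthogonality of u_n - a u_n and k passes to the limit and gives E(w, k) = E(a w, k), and a w =
    0 almost everywhere. *)
Lemma form_local w v (G : set X) : bdom w -> open G -> core v ->
  {ae m, forall x, G x -> w x = 0} -> (forall x, v x != 0 -> G x) -> E w v = 0.
Proof.
move=> bw oG cv w0 vG; have Fv := core_dom cv; have Fw := bdom_dom bw.
have main k : core k -> supp k `<=` G -> E w k = 0.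
  move=> ck kG; have kk : compact (supp k) by case: ck => _ [].
  have [a [ca a01 a1 aG]] := core_urysohn hD hR hlc kk oG kG.
  have [_ [M M0 wM]] := bw; have Fk := core_dom ck.
  have [u [K [cu wu uf _]]] := core_approx hD hR M0 Fw wM.
  have [M1 [K1 [_ wau]]] := weakly_bounded_mul hD M0 bw wu (core_bdom ca).
  have z n : E (u n) k - E (a \* u n) k = 0.
    have cau := coreM ca (cu n).
    rewrite -(formBl hD) ?(core_dom cau) ?(core_dom (cu n))//; last 2 first.
    - exact: core_dom.
    - exact: core_dom.
    rewrite (formC hD) => //; last by apply: domB; exact: core_dom.
    apply: (orth (c := 0)) => //; first exact: coreB.
    move=> x kx /=; rewrite a1 ?mul1r ?subrr//; exact: subset_closure.
  have baw := bdomM (core_bdom ca) bw.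
  have aw0 : E (a \* w) k = 0.
    rewrite (@form_ae _ _ _ _ _ _ hD _ (cst 0))//.
    - by rewrite (form0l hD).
    - exact: bdom_dom.
    - apply: filterS w0 => x /= wx; have [->|ax] := eqVneq (a x) 0.
        by rewrite mul0r.
      by rewrite wx ?mulr0//; apply: aG; exact: subset_closure.
  have : E w k - E (a \* w) k = 0.
    apply: (cvg_same (a := fun n => E (u n) k - E (a \* u n) k)).
      exact: (cvgB (weakly_bounded_cvg hD wu Fk) (weakly_bounded_cvg hD wau Fk)).
    rewrite (_ : (fun n => _) = cst 0); first exact: cvg_cst.
    by apply/funext => n; exact: z.
  by rewrite aw0 subr0.
have [k [ck kv vk]] := core_soft hD hK cv.
apply/eqP; rewrite -normr_le0.
apply: (@le_of_cvg0 _ _ (fun n => enorm w * enorm (v \- k n))); last exact: cvg0Z.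
move=> n; have Fk := core_dom (ck n).
have -> : E w v = E w (v \- k n).
  rewrite (formBr hD)// (main (k n)) ?subr0//.
  by move=> x /(kv n) /vG.
by apply: (form_le_enorm hD) => //; exact: domB.
Qed.

Lemma form_local_mul w f g (G : set X) : bdom w -> open G -> bdom f -> core g ->
  {ae m, forall x, G x -> w x = 0} -> (forall x, g x != 0 -> G x) ->
  E w (g \* f) = 0.
Proof.
move=> bw oG bf cg w0 gG; have [Ff [M M0 fM]] := bf.
have Fw := bdom_dom bw; have bg := core_bdom cg.
have [u [K [cu wu uf _]]] := core_approx hD hR M0 Ff fM.
have [M1 [K1 [_ wgu]]] := weakly_bounded_mul hD M0 bf wu bg.
have z n : E (g \* u n) w = 0.
  have cgu := coreM cg (cu n); rewrite (formC hD) => //; last exact: core_dom.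
  apply: (form_local bw oG cgu w0) => x /= gx.
  by apply: gG; apply: contra gx => /eqP ->; rewrite mul0r.
rewrite (formC hD) => //; last by apply: bdom_dom; exact: bdomM.
apply: (cvg_same (weakly_bounded_cvg hD wgu Fw)).
rewrite (_ : (fun n => _) = cst 0); first exact: cvg_cst.
by apply/funext => n; exact: z.
Qed.

(** The difference of the two sides involves only f - f' and f^2 - f'^2 = (f - f') (f + f'), both
    null on G. *)
Lemma carre_local f f' g (G : set X) : bdom f -> bdom f' -> core g -> open G ->
  {ae m, forall x, G x -> f x = f' x} -> (forall x, g x != 0 -> G x) ->
  carre f g = carre f' g.
Proof.
move=> bf bf' cg oG ff' gG; have bg := core_bdom cg.
have bw := bdomB bf bf'; have bs := bdomD bf bf'; have bws := bdomM bw bs.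
have w0 : {ae m, forall x, G x -> (f \- f') x = 0}.
  by apply: filterS ff' => x H Gx /=; rewrite H// subrr.
have ws0 : {ae m, forall x, G x -> ((f \- f') \* (f \+ f')) x = 0}.
  by apply: filterS ff' => x H Gx /=; rewrite H// subrr mul0r.
have Ff := bdom_dom bf; have Ff' := bdom_dom bf'.
have bfg := bdomM bf bg; have bfg' := bdomM bf' bg.
have bff := bdomM bf bf; have bff' := bdomM bf' bf'.
have H1 : E f (f \* g) = E f' (f' \* g).
  have -> : E f' (f' \* g) = E f' (f \* g).
    rewrite (formC hD Ff' (bdom_dom bfg')) (formC hD Ff' (bdom_dom bfg)).
    symmetry; apply: (form_ae hD (bdom_dom bfg) _ Ff').
      by apply: (dom_measurable hD); exact: bdom_dom.
    apply: filterS ff' => x H /=; have [->|gx] := eqVneq (g x) 0.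
      by rewrite !mulr0.
    by rewrite H//; exact: gG.
  apply/eqP; rewrite -subr_eq0 -(formBl hD)//; last exact: bdom_dom.
  rewrite (_ : f \* g = g \* f); last by apply/funext => x; exact: mulrC.
  by rewrite (form_local_mul bw oG bf cg w0 gG).
rewrite /carre H1; congr (_ - _ * _); apply/eqP.
rewrite -subr_eq0 -(formBl hD) ?bdom_dom//; last first.
- exact: bdom_dom.
- exact: bdom_dom.
- exact: bdom_dom.
rewrite (_ : _ \- _ = (f \- f') \* (f \+ f')).
  by rewrite (form_local bws oG cg ws0 gG).
by apply/funext => x /=; ring.
Qed.

(** The constant b is represented by b k with k in the core and equal to 1 on the support of g.
    There k has no energy, and Cauchy-Schwarz in the form of [quad_disc] removes the mixed term. *)
Lemma carre_affine f f' g c b (G : set X) : bdom f -> bdom f' -> core g ->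
  (forall x, 0 <= g x) -> open G ->
  {ae m, forall x, G x -> f x = c * f' x + b} -> (forall x, g x != 0 -> G x) ->
  carre f g = c ^+ 2 * carre f' g.
Proof.
move=> bf bf' cg g0 oG ff' gG; have bg := core_bdom cg.
have kg : compact (supp g) by case: cg => _ [].
have [k [ck k01 k1]] := core_one kg; have bk := core_bdom ck.
have gk x : g x != 0 -> k x = 1 by move=> gx; apply: k1; exact: subset_closure.
have bcf := bdomZ c bf'; have bbk := bdomZ b bk.
have og : open [set x | g x != 0] by apply: open_neq0_cont; exact: core_cont cg.
have -> : carre f g = carre ((fun x => c * f' x) \+ (fun x => b * k x)) g.
  apply: (@carre_local _ _ _ [set x | g x != 0]) => //; first exact: bdomD.
  by apply: filterS ff' => x H /= gx; rewrite (H (gG x gx)) gk// mulr1.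
have k0 : carre k g = 0.
  rewrite /carre; have -> : k \* g = g.
    apply/funext => x /=; have [->|/gk ->] := eqVneq (g x) 0.
      by rewrite mulr0.
    by rewrite mul1r.
  have ckk := coreM ck ck.
  rewrite (formC hD (core_dom ck) (core_dom cg)).
  rewrite (formC hD (core_dom ckk) (core_dom cg)).
  rewrite (orth cg ck gk) (orth cg ckk (c := 1)); first by rewrite mulr0 subrr.
  by move=> x /gk /= ->; rewrite mulr1.
have cr0 : cross (fun x => c * f' x) k g = 0.
  have : cross (fun x => c * f' x) k g ^+ 2 <= 4 * carre (fun x => c * f' x) g * 0.
    apply: quad_disc => // t.
    have := carre_ge0 (bdomD bcf (bdomZ (- (2 * t)) bk)) bg g0.
    rewrite carreD//; last exact: bdomZ.
    rewrite crossZ// (carreZ (- (2 * t)))// k0.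
    have := carre_ge0 bcf bg g0.
    by lra.
  rewrite mulr0 => H; apply/eqP; rewrite -sqrf_eq0.
  by apply/eqP/le_anti; rewrite H sqr_ge0.
by rewrite carreD// crossZ// cr0 (carreZ b)// k0 !mulr0 !addr0 carreZ.
Qed.

(** The identity [form_mul2] is kept as an inequality outside the core: its left side passes to the
    limit by lower semicontinuity, from the weak convergence of k u_n. *)
Lemma form_mul_core h k : bdom h -> core k ->
  E (k \* h) (k \* h) <=
  E h (h \* (k \* k)) + E k (k \* (h \* h)) - 2^-1 * E (h \* h) (k \* k).
Proof.
move=> bh ck; have [Fh [M M0 hM]] := bh; have bk := core_bdom ck.
have [u [K [cu wu uf _]]] := core_approx hD hR M0 Fh hM.
have [M1 [K1 [M10 wku]]] := weakly_bounded_mul hD M0 bh wu bk.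
have [K2 wuu] := weakly_bounded_sqr hD M0 bh wu.
have bhh := bdomM bh bh; have bkk := bdomM bk bk.
have [M3 [K3 [_ wkuu]]] := weakly_bounded_mul hD (mulr_gt0 M0 M0) bhh wuu bk.
have Fk := core_dom ck; have bkh := bdomM bk bh; have Fkh := bdom_dom bkh.
have H1 : carre (u n) (k \* k) + E (k \* (u n \* u n)) k @[n --> \oo] -->
    carre h (k \* k) + E (k \* (h \* h)) k.
  apply: cvgD; first exact: (carre_cvg hD M0 bh bkk wu uf).
  exact: (weakly_bounded_cvg hD wkuu Fk).
have H2 : 2 * E (k \* u n) (k \* h) - E (k \* h) (k \* h) @[n --> \oo] -->
    2 * E (k \* h) (k \* h) - E (k \* h) (k \* h).
  apply: cvgB; last exact: cvg_cst.
  by apply: cvgMl_tmp; exact: (weakly_bounded_cvg hD wku Fkh).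
have := ler_cvg_to H2 H1.
rewrite (formC hD Fk (bdom_dom (bdomM bk bhh))) /carre => H.
suff : 2 * E (k \* h) (k \* h) - E (k \* h) (k \* h) <=
  E h (h \* (k \* k)) - 2^-1 * E (h \* h) (k \* k) + E (k \* (h \* h)) k by lra.
apply: H; apply: nearW => n.
have cku := coreM ck (cu n); have Fku := core_dom cku.
have := dirichlet_ge0 hD (domB Fku Fkh); rewrite (formB2 hD)//.
have cuu := coreM (cu n) (cu n); have ckuu := coreM ck cuu.
have := form_mul2 hD hS hK (cu n) ck.
have -> : u n \* k = k \* u n by apply/funext => x; exact: mulrC.
rewrite (formC hD Fk (core_dom ckuu)).
by lra.
Qed.

(** The product rule, with the mixed term absorbed by [carreB_ge0]. It controls the energy of a
    localized cutoff function by its energy measure near the support of k, as required to put an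
    infinite series locally in [F]. *)
Lemma form_mul_le h k : bdom h -> core k -> (forall x, 0 <= h x <= 1) ->
  (forall x, 0 <= k x <= 1) ->
  E (k \* h) (k \* h) <= 2 * carre h k + 2 * E k k.
Proof.
move=> bh ck h01 k01; have bk := core_bdom ck.
have bkh := bdomM bk bh; have bhh := bdomM bh bh; have bkk := bdomM bk bk.
have kh0 x : 0 <= (k \* h) x.
  by have /andP[? _] := h01 x; have /andP[? _] := k01 x; exact: mulr_ge0.
have H1 := form_mul_core bh ck.
have H2 : cross h k (k \* h) = E h (h \* (k \* k)) + E k (k \* (h \* h)) -
    E (k \* h) (k \* h).
  rewrite /cross; congr (E _ _ + E _ _ - E _ _);
    by apply/funext => x /=; ring.
have H3 := carreB_ge0 bh bk bkh kh0.
have H4 : carre h (k \* k) <= carre h k.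
  apply: carre_le_weight => // x /=; have /andP[? ?] := k01 x.
  by rewrite ler_piMl.
have H5 : carre h (k \* h) <= carre h k.
  apply: carre_le_weight => // x /=; have /andP[? ?] := k01 x.
  by have /andP[? ?] := h01 x; rewrite ler_piMr.
have H6 : carre k (h \* h) <= 1 * E k k.
  apply: carre_le_form => // x /=; have /andP[? ?] := h01 x.
  by rewrite mulr_ge0//= mulr_ile1.
have H7 : carre k (k \* h) <= 1 * E k k.
  apply: carre_le_form => // x; rewrite kh0/=.
  by have /andP[? ?] := h01 x; have /andP[? ?] := k01 x; rewrite mulr_ile1.
have E4 : carre h (k \* k) =
  E h (h \* (k \* k)) - 2^-1 * E (h \* h) (k \* k) by [].
have E6 : carre k (h \* h) =
  E k (k \* (h \* h)) - 2^-1 * E (h \* h) (k \* k).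
  by rewrite (formC hD (bdom_dom bhh) (bdom_dom bkk)).
by move: E4 E6 H1 H2 H3 H4 H5 H6 H7; lra.
Qed.

End carre_properties.

(** * Daniell extension *)

Section daniell.
Context {d : measure_display} {R : realType} {X : borelMetricType d R}.
Variable m : {measure set X -> \bar R}.
Variables (F : set (X -> R)) (E : (X -> R) -> (X -> R) -> R).
Hypothesis hD : dirichlet_form m F E.
Hypothesis hR : regular_form m F E.
Hypothesis hlc : locally_compact [set: X].
Hypothesis hrad : radon_measure m.
Hypothesis hsupp : measure_support m = [set: X].
Hypothesis hVD : volume_doubling m.
Implicit Types (f g : X -> R) (h : nat -> X -> R) (S : set X) (a c e : R).

Local Notation core := (core F).
Let coreD := coreD hD.
Let coreB := coreB hD.
Let coreZ := coreZ hD.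
Let coreM := coreM hD.

Lemma core0 : core (cst 0).
Proof.
have s0 : supp (cst 0 : X -> R) = set0.
  rewrite /supp (_ : [set x | _] = set0) ?closure0//.
  by apply/seteqP; split=> x //=; rewrite eqxx.
split; first exact: dirichlet0 hD.
by split; [exact: cst_continuous|rewrite -/(supp _) s0; exact: compact0].
Qed.

Definition positive_functional (L : (X -> R) -> R) (M : R) : Prop :=
  [/\ forall a f g, core f -> core g -> L (fun x => a * f x + g x) = a * L f + L g,
      forall f, core f -> (forall x, 0 <= f x) -> 0 <= L f, 0 <= M &
      forall c f, core f -> 0 <= c -> (forall x, f x <= c) -> L f <= c * M].

(** An increasing sequence stands for a lower semicontinuous function that is at least 1 on S, and c
    for a bound of its integral. The slack e allows the value 1 to be reached only in the limit. *)
Definition dcover (L : (X -> R) -> R) S h c : Prop :=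
  [/\ forall n, core (h n), forall n x, 0 <= h n x,
      forall n x, h n x <= h n.+1 x,
      forall x, S x -> forall e, 0 < e -> exists n, 1 - e < h n x &
      forall n, L (h n) <= c].

Definition douter (L : (X -> R) -> R) S : \bar R :=
  ereal_inf [set c%:E | c in [set c | exists h, dcover L S h c]].

Lemma nondecreasing_le h n k x : (forall n x, h n x <= h n.+1 x) -> (n <= k)%N ->
  h n x <= h k x.
Proof.
move=> hh /subnKC <-; elim: (k - n)%N => [|j IH]; first by rewrite addn0.
by rewrite addnS; apply: le_trans (hh _ _).
Qed.

Variables (L : (X -> R) -> R) (M : R).
Hypothesis hL : positive_functional L M.

Lemma functionalD f g : core f -> core g -> L (f \+ g) = L f + L g.
Proof.
case: hL => llin _ _ _ cf cg; rewrite -[L f]mul1r -llin//.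
by congr L; apply/funext => x /=; lra.
Qed.

Lemma functionalB f g : core f -> core g -> L (f \- g) = L f - L g.
Proof.
case: hL => llin _ _ _ cf cg; have := llin (-1) _ _ cg cf.
rewrite (_ : (fun x => _) = f \- g); first by move=> ->; lra.
by apply/funext => x /=; lra.
Qed.

Lemma functional0 : L (cst 0) = 0.
Proof.
have := functionalB core0 core0; rewrite subrr => {2}<-.
by congr L; apply/funext => x /=; rewrite subrr.
Qed.

Lemma functionalZ a f : core f -> L (fun x => a * f x) = a * L f.
Proof.
case: hL => llin _ _ _ cf; have := llin a _ _ cf core0.
rewrite functional0 addr0 => <-.
by congr L; apply/funext => x /=; rewrite addr0.
Qed.

Lemma functional_le f g : core f -> core g -> (forall x, f x <= g x) -> L f <= L g.
Proof.
case: hL => _ lpos _ _ cf cg fg; rewrite -subr_ge0 -functionalB//.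
by apply: lpos; [exact: coreB|move=> x /=; rewrite subr_ge0].
Qed.

Lemma dcover_ge0 S h c : dcover L S h c -> 0 <= c.
Proof.
case: hL => _ lpos _ _ [ch h0 _ _ hc]; apply: le_trans (hc 0%N).
exact: lpos.
Qed.

(* Dini's theorem turns the pointwise cover into a uniform one. *)
Lemma dcover_dom S h c f a : dcover L S h c -> core f -> 0 <= a ->
  (forall x, 0 < f x -> S x) -> (forall x, f x <= a) -> L f <= a * c.
Proof.
move=> [ch h0 hh hS hc] cf a0 fS fa; have [_ _ M0 lM] := hL.
suff key e : 0 < e -> L f <= a * c + e * M.
  apply/ler_addgt0Pr => e e0.
  have eM : 0 < e / (M + 1) by rewrite divr_gt0// ltr_wpDl.
  apply: (le_trans (key _ eM)); rewrite lerD2l mulrAC ler_pdivrMr ?ltr_wpDl//.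
  by rewrite ler_pM2l//; lra.
move=> e0.
have kf : compact (supp f) by case: cf => _ [].
have [N HN] : exists N, forall x, supp f x -> f x <= a * h N x + e.
  have /compact_near_coveringP kf' := kf.
  have [|N _ NP] := kf' nat \oo (fun n x => f x <= a * h n x + e) _ _.
    move=> x sx.
    have cont n : nbhs x [set y | f y - a * h n y < e] -> 
        \forall x' \near x & i \near \oo, f x' <= a * h i x' + e.
      move=> nx; exists ([set y | f y - a * h n y < e], [set i | (n <= i)%N]).
        by split=> //; exists n.
      move=> [y i] [/= fy ni]; have := nondecreasing_le y hh ni.
      by move=> hni; have := ler_wpM2l a0 hni; lra.
    have copen n : open [set y | f y - a * h n y < e].
      apply: (@open_lt_cont _ _ (f \- (fun y => a * h n y))).
      apply: continuous_sub; first exact: core_cont cf.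
      by apply: continuousZ; exact: core_cont (ch n).
    have [fx|fx] := ltP 0 (f x).
      have ea : 0 < e / (a + 1) by rewrite divr_gt0// ltr_wpDl.
      have [n hn] := hS _ (fS _ fx) _ ea; apply: (cont n).
      apply: open_nbhs_nbhs; split => //=.
      have ae : a * (e / (a + 1)) < e.
        by rewrite mulrA ltr_pdivrMr ?ltr_wpDl//; lra.
      have := ler_wpM2l a0 (ltW hn); have := fa x; lra.
    apply: (cont 0%N); apply: open_nbhs_nbhs; split=> //=.
    by have := mulr_ge0 a0 (h0 0%N x); lra.
  by exists N => x sx; exact: (NP N (leqnn N) x sx).
have caN := coreZ a (ch N).
have : L (f \- (fun x => a * h N x)) <= e * M.
  apply: lM; [exact: coreB|exact: ltW|move=> x /=].
  have [sx|/supp_out ->] := pselect (supp f x); first by have := HN x sx; lra.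
  by have := mulr_ge0 a0 (h0 N x); lra.
rewrite functionalB// functionalZ//.
by have := ler_wpM2l a0 (hc N); lra.
Qed.

Lemma exhaustion_le (al : nat -> X -> R) : (forall n x, 0 <= al n x <= 1) ->
  (forall n x, al n x != 0 -> al n.+1 x = 1) -> forall n x, al n x <= al n.+1 x.
Proof.
move=> al01 alS n x; have [->|an] := eqVneq (al n x) 0.
  by have /andP[] := al01 n.+1 x.
by rewrite (alS n x an); have /andP[] := al01 n x.
Qed.

(** The cost c is the supremum of L along an exhaustion, so beyond some index the exhaustion gains
    less than e. *)
Lemma dcover_open U : open U -> exists (al : nat -> X -> R) c,
  [/\ dcover L U al c, forall n x, al n x <= 1, forall n x, al n x != 0 -> U x,
    forall n x, al n x != 0 -> al n.+1 x = 1 & forall e, 0 < e -> exists n, c - e < L (al n)].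
Proof.
move=> oU; have [_ _ M0 lM] := hL.
have [al [cal al01 alU alS al1]] := core_exhaustion hD hR hlc hrad hsupp hVD oU.
have alle := exhaustion_le al01 alS.
have hs : has_sup (range (fun n => L (al n))).
  split; first by exists (L (al 0%N)), 0%N.
  exists (1 * M) => _ [n _ <-]; apply: lM => // x.
  by have /andP[] := al01 n x.
exists al, (sup (range (fun n => L (al n)))); split=> //.
- split=> //.
  + by move=> n x; have /andP[] := al01 n x.
  + by move=> x /al1[n an] e e0; exists n; lra.
  + by move=> n; apply: sup_upper_bound => //; exists n.
- by move=> n x; have /andP[] := al01 n x.
- by move=> e e0; have [_ [n _ <-] H] := sup_adherent e0 hs; exists n.
Qed.

Lemma douter_ge0 S : (0 <= douter L S)%E.
Proof.
apply: le_ereal_inf_tmp => _ [c [h hc] <-]; rewrite lee_fin.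
exact: dcover_ge0 hc.
Qed.

Lemma douter_le S h c : dcover L S h c -> (douter L S <= c%:E)%E.
Proof. by move=> hc; apply: ereal_inf_lbound; exists c => //; exists h. Qed.

Lemma dcover_sub S T h c : S `<=` T -> dcover L T h c -> dcover L S h c.
Proof. by move=> ST [ch h0 hh hS hc]; split=> // x /ST; exact: hS. Qed.

Lemma douter_mono S T : S `<=` T -> (douter L S <= douter L T)%E.
Proof.
move=> ST; apply: le_ereal_inf_tmp => _ [c [h hc] <-].
exact: douter_le (dcover_sub ST hc).
Qed.

Lemma douter_fin S : douter L S \is a fin_num.
Proof.
rewrite ge0_fin_numE ?douter_ge0//.
have [al [c [hc _ _ _ _]]] := dcover_open openT.
apply: (le_lt_trans (douter_mono (@subsetT _ S))).
by apply: (le_lt_trans (douter_le hc)); exact: ltry.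
Qed.

Lemma douter_adherent S e : 0 < e -> exists h c,
  dcover L S h c /\ (c%:E < douter L S + e%:E)%E.
Proof.
move=> e0; have := lb_ereal_inf_adherent e0 (douter_fin S).
by move=> [_ [c [h hc] <-] lt]; exists h, c.
Qed.

Lemma douter_set0 : douter L set0 = 0%E.
Proof.
apply/eqP; rewrite eq_le douter_ge0 andbT.
apply: (@douter_le _ (fun=> cst 0)); split=> //.
- by move=> n; exact: core0.
- by move=> n; rewrite functional0.
Qed.

(** The diagonal sums of the h i n over i < n belong to the core, increase with n, and cover the
    union at the sum of the costs. *)
Lemma douter_sigma_subadditive : sigma_subadditive (douter L).
Proof.
move=> S; apply/lee_addgt0Pr => e e0.
have H i : exists hc : (nat -> X -> R) * R, dcover L (S i) hc.1 hc.2 /\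
    (hc.2%:E < douter L (S i) + (e / (2 ^ i.+1)%:R)%:E)%E.
  have ei : 0 < e / (2 ^ i.+1)%:R by rewrite divr_gt0// ltr0n expn_gt0.
  by have [h [c [H1 H2]]] := douter_adherent (S i) ei; exists (h, c).
have [hc hcP] := choice H.
pose h i := (hc i).1; pose c i := (hc i).2.
have hP i : dcover L (S i) (h i) (c i) by case: (hcP i).
have c0 i : 0 <= c i := dcover_ge0 (hP i).
have := epsilon_trick xpredT (fun n => douter_ge0 (S n)) (ltW e0).
set tot := (\sum_(i <oo) (douter L (S i) + _))%E => Htot.
apply: (le_trans _ Htot).
have tot0 : (0 <= tot)%E.
  apply: nneseries_ge0 => n _ _; apply: adde_ge0; first exact: douter_ge0.
  by rewrite lee_fin divr_ge0 ?ltW.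
have sumc n : ((\sum_(0 <= i < n) c i)%:E <= tot)%E.
  rewrite -sumEFin; apply: (@le_trans _ _
    (\sum_(0 <= i < n) (douter L (S i) + (e / (2 ^ i.+1)%:R)%:E))%E).
    by apply: lee_sum => i _; apply: ltW; case: (hcP i).
  apply: nneseries_lim_ge => i _ _; apply: adde_ge0; first exact: douter_ge0.
  by rewrite lee_fin divr_ge0 ?ltW.
have [totoo|] := eqVneq tot +oo%E; first by rewrite totoo leey.
move=> totoo; have totfin : tot \is a fin_num.
  by rewrite ge0_fin_numE// ltey.
rewrite -(fineK totfin).
pose H' n := (\sum_(0 <= i < n) h i n : X -> R).
have H'E n x : H' n x = \sum_(0 <= i < n) h i n x by rewrite /H' fct_sumE.
have cH n j : core (fun x => \sum_(0 <= i < n) h i j x) /\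
    L (fun x => \sum_(0 <= i < n) h i j x) = \sum_(0 <= i < n) L (h i j).
  elim: n => [|n [IH1 IH2]].
    rewrite big_nil; rewrite (_ : (fun x => _) = cst 0).
      by split; [exact: core0|exact: functional0].
    by apply/funext => x; rewrite big_nil.
  have ch : core (h n j) by case: (hP n).
  rewrite (_ : (fun x => _) = (fun x => \sum_(0 <= i < n) h i j x) \+ h n j).
    split; first exact: coreD.
    by rewrite functionalD// IH2 big_nat_recr.
  by apply/funext => x; rewrite big_nat_recr.
apply: (@douter_le _ (fun n x => \sum_(0 <= i < n) h i n x)); split.
- by move=> n; case: (cH n n).
- by move=> n x; apply: sumr_ge0 => i _; case: (hP i).
- move=> n x; rewrite big_nat_recr//=; apply: ler_wpDr.
    by case: (hP n).
  by apply: ler_sum => i _; case: (hP i).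
- move=> x [i _ Six] e' e'0; have [ch h0 hh hS _] := hP i.
  have [n hn] := hS _ Six _ e'0; exists (maxn n i.+1); apply: (lt_le_trans hn).
  have := nondecreasing_le x hh (leq_maxl n i.+1); move/le_trans; apply.
  rewrite (bigD1_seq i) ?iota_uniq ?mem_index_iota ?leq_maxr//= lerDl.
  by apply: sumr_ge0 => k _; case: (hP k).
- move=> n; have [_ ->] := cH n n; rewrite -lee_fin fineK//.
  apply: (le_trans _ (sumc n)); rewrite lee_fin; apply: ler_sum => i _.
  by case: (hP i).
Qed.

HB.instance Definition _ := isOuterMeasure.Build R X (douter L)
  douter_set0 douter_ge0 douter_mono douter_sigma_subadditive.

(** A cover h of T is cut by a late function al of the exhaustion of U: h al covers the part of T
    where al = 1, h (1 - al) covers the part outside U, and their costs add up to at most that of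
    h. *)
Lemma open_caratheodory U : open U -> (douter L).-caratheodory U.
Proof.
move=> oU; apply: le_caratheodory_measurable => T.
apply: le_ereal_inf_tmp => _ [c [h [ch h0 hh hS hc]] <-].
apply/lee_addgt0Pr => e e0.
have [al [s [[cal al0 alle al1 als] alle1 alU alS sup]]] := dcover_open oU.
have [k sk] := sup _ e0.
(* Where al k.+1 differs from 1, al k vanishes, so the differences al (n + k) - al k still cover;
   they cost at most s - (s - e). *)
have H1 : (douter L (U `\` [set x | al k.+1 x = 1%R]) <= e%:E)%E.
  apply: (@douter_le _ (fun n => al (n + k)%N \- al k)); split.
  - by move=> n; exact: coreB.
  - move=> n x /=; rewrite subr_ge0; apply: (nondecreasing_le x alle).
    exact: leq_addl.
  - by move=> n x /=; rewrite lerD2r.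
  - move=> x [Ux /= ax] e' e'0; have [n an] := al1 _ Ux _ e'0; exists n.
    have -> : al k x = 0.
      by apply/eqP; apply: contrapT => /negP /alS.
    rewrite subr0; apply: (lt_le_trans an).
    by apply: (nondecreasing_le x alle); exact: leq_addr.
  - by move=> n; rewrite functionalB//; have := als (n + k)%N; lra.
pose f n := h n \* al k.+1; pose g n := h n \- (h n \* al k.+1).
have cf n : core (f n) by exact: coreM.
have cg n : core (g n) := coreB (ch n) (cf n).
have fle n x : f n x <= f n.+1 x by rewrite /f/=; apply: ler_wpM2r => //; exact: hh.
have gE n x : g n x = (1 - al k.+1 x) * h n x by rewrite /g/=; ring.
have gle n x : g n x <= g n.+1 x.
  by rewrite !gE; apply: ler_wpM2l => //; rewrite subr_ge0.
have fgc i j : L (f i) + L (g j) <= c.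
  apply: le_trans (hc (maxn i j)); rewrite -functionalD//.
  apply: functional_le; [exact: coreD|exact: ch|move=> x /=].
  have H2 : h (maxn i j) x = f (maxn i j) x + g (maxn i j) x.
    by rewrite /f /g /=; ring.
  rewrite H2; apply: lerD; first exact: (nondecreasing_le x fle (leq_maxl i j)).
  exact: (nondecreasing_le x gle (leq_maxr i j)).
have hs : has_sup (range (fun n => L (f n))).
  split; first by exists (L (f 0%N)), 0%N.
  by exists (c - L (g 0%N)) => _ [n _ <-]; have := fgc n 0%N; lra.
set t := reals.sup (range (fun n => L (f n))).
have H2 : (douter L (T `&` [set x | al k.+1 x = 1%R]) <= t%:E)%E.
  apply: (@douter_le _ f); split=> //.
  - by move=> n x; apply: mulr_ge0.
  - move=> x [Tx /= ax] e' e'0; have [n hn] := hS _ Tx _ e'0; exists n.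
    by rewrite /f/= ax mulr1.
  - by move=> n; apply: sup_upper_bound => //; exists n.
have H3 : (douter L (T `&` ~` U) <= (c - t)%:E)%E.
  apply: (@douter_le _ g); split=> //.
  - by move=> n x; rewrite gE mulr_ge0// subr_ge0.
  - move=> x [Tx Ux] e' e'0; have [n hn] := hS _ Tx _ e'0; exists n.
    rewrite gE (_ : al k.+1 x = 0) ?subr0 ?mul1r//.
    by apply/eqP; apply: contrapT => /negP /alU.
  - move=> n; rewrite lerBrDr -lerBrDl; apply: ge_sup; first by case: hs.
    by move=> _ [i _ <-]; have := fgc i n; lra.
have H4 : (douter L (T `&` U) <= t%:E + e%:E)%E.
  apply: (@le_trans _ _ (douter L ((T `&` [set x | al k.+1 x = 1%R]) `|`
      (U `\` [set x | al k.+1 x = 1%R])))).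
    apply: douter_mono => x [Tx Ux].
    by have [ax|ax] := pselect (al k.+1 x = 1%R); [left|right].
  apply: (le_trans (outer_measureU2 _ _ _)); exact: leeD.
apply: (le_trans (leeD H4 H3)).
by rewrite -!EFinD lee_fin; lra.
Qed.

Lemma borel_caratheodory (A : set X) : measurable A -> (douter L).-caratheodory A.
Proof.
rewrite measurable_borel; apply.
split; last exact: open_caratheodory.
split.
- exact: caratheodory_measurable_set0.
- by move=> B HB; rewrite setTD; exact: caratheodory_measurable_setC.
- by move=> B HB; exact: caratheodory_measurable_bigcup.
Qed.

Lemma douter_semi_sigma_additive :
  semi_sigma_additive (douter L : set X -> \bar R).
Proof.
move=> A mA tA mbA.
exact: (@caratheodory_measure_sigma_additive R X (douter L) A
  (fun n => borel_caratheodory (mA n)) tA (borel_caratheodory mbA)).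
Qed.

Definition daniell_measure := douter L.
HB.instance Definition _ := isMeasure.Build d X R daniell_measure
  douter_set0 douter_ge0 douter_semi_sigma_additive.

Lemma daniell_measure_exists : exists mu : {measure set X -> \bar R},
  forall A, mu A = douter L A.
Proof. by exists daniell_measure. Qed.

End daniell.

(** * Finite Borel measures as Daniell measures *)

Section finite_borel_measures.
Context {d : measure_display} {R : realType} {X : borelMetricType d R}.
Variable m : {measure set X -> \bar R}.
Variables (F : set (X -> R)) (E : (X -> R) -> (X -> R) -> R).
Hypothesis hD : dirichlet_form m F E.
Hypothesis hR : regular_form m F E.
Hypothesis hlc : locally_compact [set: X].
Hypothesis hrad : radon_measure m.
Hypothesis hsupp : measure_support m = [set: X].
Hypothesis hVD : volume_doubling m.
Implicit Types (f g : X -> R) (h : nat -> X -> R) (S A B : set X) (a c e t : R).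
Implicit Types nu mu : {measure set X -> \bar R}.

Local Notation core := (core F).
Local Notation douter := (douter F).
Local Notation dcover := (dcover F).
Local Notation positive_functional := (positive_functional F).

Definition intf nu f : R := \int[nu]_x f x.

Lemma core_measurable f : core f -> measurable_fun setT f.
Proof. by move=> /core_dom; exact: (dom_measurable hD). Qed.

Lemma bounded_integrable nu f : (nu setT < +oo)%E -> measurable_fun setT f ->
  (exists M, forall x, `|f x| <= M) -> nu.-integrable setT (EFin \o f).
Proof.
move=> fin mf [M fM]; apply: measurable_bounded_integrable => //.
exists M; split; first exact: num_real.
by move=> K MK x _; apply: (le_trans (fM x)); exact: ltW.
Qed.

Lemma core_integrable nu f : (nu setT < +oo)%E -> core f ->
  nu.-integrable setT (EFin \o f).
Proof.
move=> fin cf; apply: bounded_integrable => //; first exact: core_measurable.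
by have [M _ fM] := core_bounded cf; exists M.
Qed.

Lemma intf_fin nu f : (nu setT < +oo)%E -> core f ->
  (\int[nu]_x (f x)%:E)%E = (intf nu f)%:E.
Proof.
move=> fin cf; rewrite /intf /Rintegral fineK//.
by apply: integrable_fin_num => //; exact: core_integrable.
Qed.

Lemma measure_fin nu A : (nu setT < +oo)%E -> measurable A -> nu A \is a fin_num.
Proof.
move=> fin mA; rewrite ge0_fin_numE//; apply: le_lt_trans fin.
by apply: le_measure; rewrite ?inE.
Qed.

Lemma intf_positive nu : (nu setT < +oo)%E ->
  positive_functional (intf nu) (fine (nu setT)).
Proof.
move=> fin; split.
- move=> a f g cf cg; rewrite /intf RintegralD//.
  + by rewrite RintegralZl//; exact: core_integrable.
  + by apply: (core_integrable fin); exact: (coreZ hD).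
  + exact: core_integrable.
- by move=> f cf f0; apply: Rintegral_ge0.
- exact: fine_ge0.
- move=> c f cf c0 fc; rewrite -[c * _](Rintegral_cst _ measurableT).
  apply: le_Rintegral => //; first exact: core_integrable.
  by apply: bounded_integrable => //; exists `|c|.
Qed.

Lemma markov_le nu f a B : measurable_fun setT f -> (forall x, 0 <= f x) -> 0 <= a ->
  measurable B -> (forall x, B x -> a <= f x) ->
  (a%:E * nu B <= \int[nu]_x (f x)%:E)%E.
Proof.
move=> mf f0 a0 mB aB; rewrite -integral_cst//.
apply: (@le_trans _ _ (\int[nu]_(x in B) (f x)%:E)%E).
  apply: ge0_le_integral => //.
  by apply/measurable_EFinP; exact: measurable_funS mf.
apply: ge0_subset_integral => //; first exact/measurable_EFinP.
by move=> x _; rewrite lee_fin.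
Qed.

Lemma bigcup_measure_le nu (B : nat -> set X) b : (forall n, measurable (B n)) ->
  (forall n, B n `<=` B n.+1) -> (forall n, nu (B n) <= b)%E ->
  (nu (\bigcup_n B n) <= b)%E.
Proof.
move=> mB BS Bb.
have nd : nondecreasing_seq B by apply/nondecreasing_seqP => n; exact/subsetPset.
have mU : measurable (\bigcup_n B n) by exact: bigcup_measurable.
have cv := nondecreasing_cvg_mu mB mU nd (mu := nu).
have -> : nu (\bigcup_n B n) = limn (nu \o B) by apply/esym/cvg_lim.
apply: lime_le; first by apply/cvg_ex; exists (nu (\bigcup_n B n)).
by apply: nearW => n; exact: Bb.
Qed.

Definition level h t n := [set x | 1 - t < h n x].

(** Markov's inequality on the open level sets {1 - t < h n}, which increase with n. *)
Lemma level_le nu S h c t : (nu setT < +oo)%E -> dcover (intf nu) S h c ->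
  0 < t -> t < 1 ->
  [/\ open (\bigcup_n level h t n), S `<=` \bigcup_n level h t n &
   (nu (\bigcup_n level h t n) <= (c / (1 - t))%:E)%E].
Proof.
move=> fin [ch h0 hh hS hc] t0 t1.
have oB n : open (level h t n) by apply: open_gt_cont; exact: core_cont (ch n).
have t10 : 0 < 1 - t by lra.
split; first exact: bigcup_open.
  by move=> x Sx; have [n hn] := hS x Sx t t0; exists n.
apply: bigcup_measure_le.
- by move=> n; exact: open_borel.
- by move=> n x; rewrite /level /=; move/lt_le_trans; apply.
move=> n; have mB := open_borel (oB n).
rewrite -(fineK (measure_fin fin mB)) lee_fin ler_pdivlMr// mulrC -lee_fin.
rewrite EFinM fineK ?measure_fin//; apply: (@le_trans _ _ (intf nu (h n))%:E).
  rewrite -intf_fin//; apply: markov_le => //.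
  - exact: core_measurable.
  - exact: ltW.
  - by move=> x /ltW.
by rewrite lee_fin.
Qed.

(** Covers bound nu from above through their level sets, so nu <= [douter] on Borel sets. The total
    masses agree, and the inequality for the complement of A gives the reverse one for A. *)
Lemma daniell_unique nu L M : positive_functional L M -> (nu setT < +oo)%E ->
  (forall g, core g -> (forall x, 0 <= g x) -> intf nu g = L g) ->
  forall A, measurable A -> nu A = douter L A.
Proof.
move=> hL fin nuL.
have [mu muE] := daniell_measure_exists hD hR hlc hrad hsupp hVD hL.
have ofin S : douter L S \is a fin_num by exact: (douter_fin hD hR hlc hrad hsupp hVD hL).
have le A : measurable A -> (nu A <= douter L A)%E.
  move=> mA; apply: le_ereal_inf_tmp => _ [c [h hc] <-].
  have hc' : dcover (intf nu) A h c.
    by have [ch h0 hh hS hc'] := hc; split=> // n; rewrite nuL.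
  have c0 := dcover_ge0 hL hc.
  have bnd t : 0 < t -> t < 1 -> (1 - t) * fine (nu A) <= c.
    move=> t0 t1; have [oU AU Uc] := level_le fin hc' t0 t1.
    have t10 : 0 < 1 - t by lra.
    rewrite mulrC -ler_pdivlMr// -lee_fin fineK ?measure_fin//.
    apply: le_trans Uc; apply: le_measure; rewrite ?inE//.
    exact: open_borel.
  rewrite -(fineK (measure_fin fin mA)) lee_fin; set r := fine (nu A) in bnd *.
  have r0 : 0 <= r by exact: fine_ge0.
  rewrite leNgt; apply/negP => cr.
  have rp : 0 < r by lra.
  have r2 : 0 < 2 * r by rewrite mulr_gt0.
  (* This t makes (1 - t) r the mean of r and c, which exceeds c. *)
  have t0 : 0 < (r - c) / (2 * r) by rewrite divr_gt0// subr_gt0.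
  have t1 : (r - c) / (2 * r) < 1 by rewrite ltr_pdivrMr//; lra.
  have := bnd _ t0 t1.
  have -> : (1 - (r - c) / (2 * r)) * r = (r + c) / 2 by field; rewrite gt_eqF.
  lra.
have top : (douter L setT <= nu setT)%E.
  have [al [c [hc al1 alU alS sup]]] := dcover_open hD hR hlc hrad hsupp hVD hL openT.
  have [cal al0 _ _ _] := hc.
  apply: (le_trans (douter_le hc)).
  rewrite -(fineK (measure_fin fin measurableT)) lee_fin.
  apply/ler_addgt0Pr => e e0; have [n] := sup e e0.
  rewrite -nuL// => H.
  have [_ _ _ bnd] := intf_positive fin.
  by have := bnd 1 (al n) (cal n) ler01 (al1 n); lra.
move=> A mA; apply/eqP; rewrite eq_le le//=.
have mC := measurableC mA.
have H1 : (mu A + mu (~` A) = mu setT)%E.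
  rewrite -measureU//; first by rewrite setUv.
  by rewrite setICr.
have H2 : (nu A + nu (~` A) = nu setT)%E.
  rewrite -measureU//; first by rewrite setUv.
  by rewrite setICr.
have := le _ mC; rewrite !muE in H1; move: top; rewrite -H1 -H2.
rewrite -(fineK (ofin A)) -(fineK (ofin (~` A))) -(fineK (measure_fin fin mA)).
by rewrite -(fineK (measure_fin fin mC)) -!EFinD !lee_fin; lra.
Qed.

Lemma finite_measure_douter nu A : (nu setT < +oo)%E -> measurable A ->
  nu A = douter (intf nu) A.
Proof. by move=> fin; apply: (daniell_unique (intf_positive fin) fin). Qed.

(** The measure is the Daniell extension of its own integral, so a nearly optimal cover of A has
    open level sets of nearly the measure of A. The t chosen below ensures c / (1 - t) <= c + e /
    2. *)
Lemma outer_regular nu A e : (nu setT < +oo)%E -> measurable A -> 0 < e ->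
  exists U, [/\ open U, A `<=` U & (nu U <= nu A + e%:E)%E].
Proof.
move=> fin mA e0; have e2 : 0 < e / 2 by lra.
have hL := intf_positive fin.
have [h [c [hc]]] := douter_adherent hD hR hlc hrad hsupp hVD hL A e2.
rewrite -finite_measure_douter// => lt.
have c0 := dcover_ge0 hL hc.
pose t := (e / 4) / (c + e / 2).
have ce : 0 < c + e / 2 by lra.
have t0 : 0 < t by rewrite divr_gt0//; lra.
have t1 : t < 1 by rewrite ltr_pdivrMr// mul1r; lra.
have [oU AU Uc] := level_le fin hc t0 t1.
exists (\bigcup_n level h t n); split=> //; apply: (le_trans Uc).
have ct : c / (1 - t) <= c + e / 2.
  have -> : 1 - t = (c + e / 4) / (c + e / 2).
    apply: (mulIf (lt0r_neq0 ce)); rewrite mulrBl mul1r /t.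
    by rewrite !(divfK (lt0r_neq0 ce)); lra.
  rewrite invf_div mulrA ler_pdivrMr; last by lra.
  nra.
move: lt; rewrite -(fineK (measure_fin fin mA)) -!EFinD lte_fin lee_fin.
lra.
Qed.

(** Open subsets of G are compared through exhaustions by core functions; Borel subsets follow by
    outer regularity of nu'. *)
Lemma measure_comp nu nu' G A c : 0 <= c -> (nu setT < +oo)%E -> (nu' setT < +oo)%E -> open G ->
  (forall g, core g -> (forall x, 0 <= g x) -> (forall x, g x != 0 -> G x) ->
     intf nu g <= c * intf nu' g) ->
  measurable A -> A `<=` G -> (nu A <= c%:E * nu' A)%E.
Proof.
move=> c0 fin fin' oG H mA AG.
have opn W : open W -> W `<=` G -> (nu W <= c%:E * nu' W)%E.
  move=> oW WG; have mW := open_borel oW.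
  have hL := intf_positive fin.
  have [al [s [[cal al0 alle al1 _] alle1 alW alS _]]] :=
    dcover_open hD hR hlc hrad hsupp hVD hL oW.
  have mB n : measurable [set x | 1 <= al n x].
    by apply: closed_borel; apply: closed_ge_cont; exact: core_cont (cal n).
  have -> : W = \bigcup_n [set x | 1 <= al n x].
    apply/seteqP; split=> [x Wx|x [n _ /= an]]; last first.
      by apply: (alW n); rewrite gt_eqF//; lra.
    have h2 : 0 < 2^-1 :> R by rewrite invr_gt0.
    have [n an] := al1 x Wx _ h2; exists n.+1 => //=.
    by rewrite (alS n x)// gt_eqF//; lra.
  apply: bigcup_measure_le => // [n x /= an|n].
    by apply: (le_trans an); exact: alle.
  apply: (@le_trans _ _ (c * intf nu' (al n))%:E).
    apply: (@le_trans _ _ (intf nu (al n))%:E).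
      rewrite -intf_fin// -[leLHS]mul1e; apply: markov_le => //.
      exact: core_measurable.
    by rewrite lee_fin; apply: H => // x /alW; exact: WG.
  have -> : \bigcup_n [set x | 1 <= al n x] = W.
    apply/seteqP; split=> [x [k _ /= an]|x Wx].
      by apply: (alW k); rewrite gt_eqF//; lra.
    have h2 : 0 < 2^-1 :> R by rewrite invr_gt0.
    have [k an] := al1 x Wx _ h2; exists k.+1 => //=.
    by rewrite (alS k x)// gt_eqF//; lra.
  have -> : nu' W = (\int[nu']_x (\1_W x)%:E)%E by rewrite integral_indic// setIT.
  rewrite EFinM lee_wpmul2l ?lee_fin// -intf_fin//; apply: ge0_le_integral => //.
  - by move=> x _; rewrite lee_fin.
  - by apply/measurable_EFinP; exact: core_measurable.
  - by apply/measurable_EFinP; exact: measurable_indic.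
  - move=> x _; rewrite lee_fin indicE; have [Wx|Wx] := pselect (W x).
      by rewrite mem_set.
    rewrite memNset//=; have [->//|/alW] := eqVneq (al n x) 0; exact.
apply/lee_addgt0Pr => e e0.
have e1 : 0 < e / (c + 1) by rewrite divr_gt0// ltr_wpDl.
have [U [oU AU Ue]] := outer_regular fin' mA e1.
apply: (@le_trans _ _ (nu (U `&` G))).
  apply: le_measure; rewrite ?inE//; first by apply: open_borel; exact: openI.
  by move=> x Ax; split; [exact: AU|exact: AG].
apply: (le_trans (opn _ (openI oU oG) (@subIsetr _ _ _))).
apply: (@le_trans _ _ (c%:E * (nu' A + (e / (c + 1))%:E))%E).
  rewrite lee_wpmul2l ?lee_fin//; apply: le_trans Ue.
  apply: le_measure; rewrite ?inE//; first by apply: open_borel; exact: openI.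
  exact: open_borel.
rewrite muleDr ?fin_num_adde_defl// leeD2l// -EFinM lee_fin mulrA.
by rewrite ler_pdivrMr ?ltr_wpDl//; lra.
Qed.

Lemma daniell_integral_sandwich L M (mu : {measure set X -> \bar R}) f a :
  positive_functional L M -> (mu setT < +oo)%E -> (forall A, mu A = douter L A) ->
  0 < a -> core f -> (forall x, 0 <= f x <= a) ->
  [/\ a * fine (mu [set x | a <= f x]) <= L f,
      L f <= a * fine (mu [set x | 0 < f x]),
      a * fine (mu [set x | a <= f x]) <= intf mu f &
      intf mu f <= a * fine (mu [set x | 0 < f x])].
Proof.
move=> hL fin muE a0 cf fa.
have cont := core_cont cf; have mf := core_measurable cf.
have mge : measurable [set x | a <= f x] by apply/closed_borel/closed_ge_cont.
have mgt : measurable [set x | 0 < f x] by apply/open_borel/open_gt_cont.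
split.
- rewrite mulrC -ler_pdivlMr// -lee_fin fineK ?measure_fin// muE.
  have caf := coreZ hD a^-1 cf.
  apply: (douter_le (h := fun=> (fun x => a^-1 * f x))); split=> //.
  + move=> _ x; rewrite mulr_ge0 ?invr_ge0 ?(ltW a0)//.
    by have /andP[] := fa x.
  + move=> x /= ax e e0; exists 0%N; rewrite mulrC.
    have : 1 <= f x / a by rewrite ler_pdivlMr// mul1r.
    lra.
  + by move=> _; rewrite (functionalZ hD hL)// mulrC.
- rewrite mulrC -ler_pdivrMr// -lee_fin fineK ?measure_fin// muE.
  apply: le_ereal_inf_tmp => _ [c [h hc] <-]; rewrite lee_fin ler_pdivrMr// mulrC.
  apply: (dcover_dom hD hL hc cf (ltW a0)) => // x.
  by have /andP[] := fa x.
- rewrite -lee_fin -intf_fin// EFinM fineK ?measure_fin//.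
  apply: markov_le => //; [|exact: ltW].
  by move=> x; have /andP[] := fa x.
- rewrite -lee_fin -intf_fin// EFinM fineK ?measure_fin// -integral_cst//.
  rewrite [leRHS]integral_mkcond.
  apply: ge0_le_integral => //.
  + by move=> x _; rewrite lee_fin; have /andP[] := fa x.
  + exact/measurable_EFinP.
  + apply/(measurable_restrict _ mgt measurableT).1; exact: measurable_cst.
  + move=> x _; rewrite patchE; have /andP[f0 f1] := fa x.
    have [fx|fx] := ltP 0 (f x); first by rewrite mem_set//= lee_fin.
    rewrite memNset/=; first by rewrite lee_fin.
    by apply/negP; rewrite -leNgt.
Qed.

(** For 0 <= f <= a both the integral and L f lie between a mu{f >= a} and a mu{f > 0}. Halving the
    range n times reduces a to a / 2^n, while the differences of level set measures telescope. *)
Lemma daniell_integral L M (mu : {measure set X -> \bar R}) f :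
  strongly_local m F E ->
  positive_functional L M -> (mu setT < +oo)%E -> (forall A, mu A = douter L A) ->
  core f -> intf mu f = L f.
Proof.
move=> hS hL fin muE.
have hK K : compact K -> (m K < +oo)%E by case: hrad => + _ _; exact.
have [hIl _ _ _] := intf_positive fin; have hI := intf_positive fin.
pose r A := fine (mu A).
have rle A B : measurable A -> measurable B -> A `<=` B -> r A <= r B.
  move=> mA mB AB; apply: fine_le; rewrite ?measure_fin//.
  by apply: le_measure; rewrite ?inE.
have key n g a : 0 < a -> core g -> (forall x, 0 <= g x <= a) ->
    `|intf mu g - L g| <= a / 2 ^+ n * (r [set x | 0 < g x] - r [set x | a <= g x]).
  elim: n g a => [|n IH] g a a0 cg ga.
    have [h1 h2 h3 h4] := daniell_integral_sandwich hL fin muE a0 cg ga.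
    by rewrite expr0 divr1 /r ler_norml; lra.
  have a2 : 0 < a / 2 by lra.
  have cp := core_clip hD a2 cg; have cq := coreB hD cg cp.
  set p := clip (a / 2) g in cp cq; set q := g \- p in cq.
  have gE : g = p \+ q by apply/funext => x; rewrite /q/=; lra.
  have pb x : 0 <= p x <= a / 2.
    by rewrite /p; have := ga x; case: (clipP g x a2) => *; lra.
  have qb x : 0 <= q x <= a / 2.
    by rewrite /q /p/=; have := ga x; case: (clipP g x a2) => *; lra.
  have := IH _ _ a2 cp pb; have := IH _ _ a2 cq qb.
  have -> : intf mu g - L g = (intf mu p - L p) + (intf mu q - L q).
    by rewrite {1 2}gE (functionalD hI)// (functionalD hL)//; ring.
  have -> : a / 2 / 2 ^+ n = a / 2 ^+ n.+1 by rewrite exprS invfM mulrA.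
  have -> : [set x | 0 < p x] = [set x | 0 < g x].
    apply/seteqP; split=> x /=; rewrite /p; have := ga x;
      case: (clipP g x a2) => *; lra.
  have -> : [set x | a / 2 <= p x] = [set x | a / 2 <= g x].
    apply/seteqP; split=> x /=; rewrite /p; have := ga x;
      case: (clipP g x a2) => *; lra.
  have -> : [set x | 0 < q x] = [set x | a / 2 < g x].
    apply/seteqP; split=> x /=; rewrite /q /p/=; have := ga x;
      case: (clipP g x a2) => *; lra.
  have -> : [set x | a / 2 <= q x] = [set x | a <= g x].
    apply/seteqP; split=> x /=; rewrite /q /p/=; have := ga x;
      case: (clipP g x a2) => *; lra.
  have h1 : r [set x | a / 2 < g x] <= r [set x | a / 2 <= g x].
    apply: rle; last by move=> x /=; exact: ltW.
      by apply/open_borel/open_gt_cont; exact: core_cont cg.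
    by apply/closed_borel/closed_ge_cont; exact: core_cont cg.
  have e0 : 0 <= a / 2 ^+ n.+1 by rewrite divr_ge0 ?exprn_ge0// ltW.
  move: (a / 2 ^+ n.+1) e0 => e e0 h2 h3.
  apply: (le_trans (ler_normD _ _)); apply: (le_trans (lerD h3 h2)).
  by rewrite -mulrDr ler_wpM2l//; lra.
have pos g : core g -> (forall x, 0 <= g x) -> intf mu g = L g.
  move=> cg g0; have [a a0 ga] := core_bounded cg.
  have ga' x : 0 <= g x <= a by rewrite g0 (le_trans (ler_norm _) (ga x)).
  apply/eqP; rewrite -subr_eq0 -normr_le0.
  set rr := r [set x | 0 < g x] - r [set x | a <= g x].
  apply: (@le_of_cvg0 _ _ (fun n => 2^-1 ^+ n * (a * rr))); last first.
    exact: cvg_half_expn.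
  move=> n; apply: (le_trans (key n _ _ a0 cg ga')).
  by rewrite -/rr exprVn; lra.
move=> cf; have [p [q [cp cq p0 q0 [_ -> _]]]] := core_posneg hD cf.
by rewrite (functionalB hI)// (functionalB hL)// !pos.
Qed.

End finite_borel_measures.

(** * Increasing limits of measures *)

Section measure_limits.
Context {d : measure_display} {R : realType} {X : measurableType d}.
Implicit Types (mu : {measure set X -> \bar R}) (A B S : set X).
Local Open Scope ereal_scope.

Variable nu : nat -> {measure set X -> \bar R}.
Hypothesis nuS : forall n A, measurable A -> nu n A <= nu n.+1 A.

Definition sup_measure A : \bar R := ereal_sup (range (fun n => nu n A)).

Lemma sup_measure_cvg A : measurable A -> nu n A @[n --> \oo] --> sup_measure A.
Proof.
move=> mA; apply: ereal_nondecreasing_cvgn.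
by apply/nondecreasing_seqP => n; exact: nuS.
Qed.

Lemma sup_measure_ub n A : nu n A <= sup_measure A.
Proof. by apply: ereal_sup_ubound; exists n. Qed.

Lemma sup_measure0 : sup_measure set0 = 0.
Proof.
rewrite /sup_measure [X in ereal_sup X](_ : _ = [set 0]) ?ereal_sup1//.
apply/seteqP; split=> [_ [n _ <-]|_ ->]; first by rewrite measure0.
by exists 0%N => //; rewrite measure0.
Qed.

Lemma sup_measure_ge0 A : 0 <= sup_measure A.
Proof. by apply: le_trans (sup_measure_ub 0%N A); exact: measure_ge0. Qed.

Lemma sup_measure_sigma_additive : semi_sigma_additive sup_measure.
Proof.
move=> A mA tA mU.
have cs : cvgn (fun n => \sum_(0 <= i < n) sup_measure (A i)).
  by apply: is_cvg_nneseries => n _ _; exact: sup_measure_ge0.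
suff -> : sup_measure (\bigcup_n A n) = \sum_(i <oo) sup_measure (A i) by [].
apply/eqP; rewrite eq_le; apply/andP; split.
  apply: ge_ereal_sup => _ [n _ <-].
  rewrite measure_semi_bigcup//; apply: lee_nneseries => // i _.
  exact: sup_measure_ub.
apply: lime_le => //; apply: nearW => k.
have cv : \sum_(0 <= i < k) nu n (A i) @[n --> \oo] -->
    \sum_(0 <= i < k) sup_measure (A i).
  apply: cvg_nnesum => [i _|i _]; last exact: sup_measure_cvg.
  by apply: nearW => n.
rewrite -(cvg_lim _ cv)//; apply: lime_le.
  by apply/cvg_ex; exists (\sum_(0 <= i < k) sup_measure (A i)).
apply: nearW => n; apply: le_trans (sup_measure_ub n _).
rewrite measure_semi_bigcup//.
by apply: nneseries_lim_ge => i _ _.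
Qed.

HB.instance Definition _ := isMeasure.Build d X R sup_measure
  sup_measure0 sup_measure_ge0 sup_measure_sigma_additive.

Lemma sup_measure_exists : exists mu : {measure set X -> \bar R},
  forall A, measurable A -> nu n A @[n --> \oo] --> mu A.
Proof. by exists sup_measure; exact: sup_measure_cvg. Qed.

End measure_limits.

(** * Capacity and quasi-continuity *)

Section quasi_continuity.
Context {d : measure_display} {R : realType} {X : borelMetricType d R}.
Variable m : {measure set X -> \bar R}.
Variables (F : set (X -> R)) (E : (X -> R) -> (X -> R) -> R).
Hypothesis hD : dirichlet_form m F E.
Implicit Types (f g u v : X -> R) (G W : set X) (a e : R).

(** Clipping a competitor to [0, 1] does not increase [form1] and makes it equal to 1 almost
    everywhere on W. *)
Lemma capacity_witness G e : (capacity m F E G < e%:E)%E -> exists v W,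
  [/\ F v, open W, G `<=` W, form1 m E v < e &
   (forall x, 0 <= v x <= 1) /\ {ae m, forall x, W x -> v x = 1}].
Proof.
move=> /ereal_inf_lt[_ [u [Fu [W [oW GW uW]]] <-]]; rewrite lte_fin => ue.
have [Fc Ec] := clip_dom hD ltr01 Fu.
exists (clip 1 u), W; split=> //; last split.
- apply: le_lt_trans ue; apply: lerD => //; apply: sqn_le.
  + exact: (dom_sqint hD).
  + exact: (dom_measurable hD).
  + move=> x; case: (clipP u x (@ltr01 R)) => *;
    have := ler_norm (u x); have := normr_ge0 (u x); rewrite ?normr0 ?normr1; try lra.
- by move=> x; case: (clipP u x (@ltr01 R)) => *; lra.
- apply: filterS uW => x H /H; case: (clipP u x (@ltr01 R)) => *; lra.
Qed.

Lemma quasi_open g G a : open G -> {within ~` G, continuous g} ->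
  open ([set x | a < g x] `|` G).
Proof.
move=> oG /subspace_continuousP cg; rewrite openE => x H.
have [Gx|nGx] := pselect (G x).
  apply: filterS (open_nbhs_nbhs (conj oG Gx)) => y Gy; by right.
case: H => // ax; have /= := cg x nGx [set y | a < y].
have na : nbhs (g x) [set y | a < y].
  exact: (open_nbhs_nbhs (conj (@open_gt R a) ax)).
move=> /(_ na) H.
have {}H : nbhs x [set y | (~` G) y -> a < g y] by exact: H.
apply: filterS H => y /= H.
by have [Gy|/H] := pselect (G y); [right|left].
Qed.

Lemma capacity0 : capacity m F E set0 = 0%E.
Proof.
apply/eqP; rewrite eq_le; apply/andP; split.
  apply: ereal_inf_lbound; exists (cst 0).
    split; first exact: dirichlet0 hD.
    by exists set0; split=> //; [exact: open0|apply: aeW].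
  rewrite /form1 (form0l hD); last exact: dirichlet0 hD.
  rewrite add0r /Rintegral integral0_eq//.
  by move=> x _ /=; rewrite expr0n.
apply: le_ereal_inf_tmp => _ [u [Fu _] <-]; rewrite lee_fin addr_ge0//.
  exact: (dirichlet_ge0 hD).
exact: sqn_ge0.
Qed.

Lemma continuous_quasi g : continuous g -> quasi_continuous m F E g.
Proof.
move=> cg e e0; exists set0; split; first exact: open0.
  by rewrite capacity0 lte_fin.
by rewrite setC0; apply: continuous_subspaceT.
Qed.

End quasi_continuity.

(** As C >= 1, the same factor covers the L^2 part of [form1], so capacities are comparable and the
    exceptional open sets can be shared. *)
Lemma quasi_continuous_comparison {d : measure_display} {R : realType}
  {X : borelMetricType d R} (m : {measure set X -> \bar R})
  (F : set (X -> R)) (E1 E2 : (X -> R) -> (X -> R) -> R) (C : R) (g : X -> R) :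
  1 <= C -> (forall f, F f -> E1 f f <= C * E2 f f) ->
  quasi_continuous m F E2 g -> quasi_continuous m F E1 g.
Proof.
move=> C1 hC qg e e0; have C0 : 0 < C by lra.
have eC : 0 < e / C by rewrite divr_gt0.
have [G [oG capG cG]] := qg _ eC; exists G; split=> //.
move: capG => /ereal_inf_lt[_ [u [Fu uW] <-]]; rewrite lte_fin => ue.
apply: (@le_lt_trans _ _ (form1 m E1 u)%:E).
  by apply: ereal_inf_lbound; exists u.
rewrite lte_fin; move: ue; rewrite ltr_pdivlMr// mulrC; apply: le_lt_trans.
have := hC u Fu; have := sqn_ge0 m u; rewrite /form1 -/(sqn m u).
by nra.
Qed.

(** * Energy measures *)

Section energy_measures.
Context {d : measure_display} {R : realType} {X : borelMetricType d R}.
Variable m : {measure set X -> \bar R}.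
Variables (F : set (X -> R)) (E : (X -> R) -> (X -> R) -> R).
Hypothesis hD : dirichlet_form m F E.
Hypothesis hR : regular_form m F E.
Hypothesis hS : strongly_local m F E.
Hypothesis hlc : locally_compact [set: X].
Hypothesis hrad : radon_measure m.
Hypothesis hsupp : measure_support m = [set: X].
Hypothesis hVD : volume_doubling m.
Implicit Types (f g h u v w : X -> R) (A B G W : set X) (a b c e : R).
Implicit Types nu mu : {measure set X -> \bar R}.

Local Notation enorm := (enorm E).
Local Notation core := (core F).
Local Notation bdom := (bdom F).
Local Notation carre := (carre E).
Local Notation capacity := (capacity m F E).
Local Notation form1 := (form1 m E).
Let hK := compact_fin hrad.

Lemma carre_positive f : bdom f -> positive_functional F (carre f) (E f f).
Proof.
move=> bf; have [Ff [M M0 fM]] := bf; split.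
- by move=> a g h cg ch; apply: (carre_linear hD); [|exact: core_bdom..].
- by move=> g cg g0; apply: (carre_ge0 hD hR hS hK) => //; exact: core_bdom.
- exact: (dirichlet_ge0 hD).
move=> c g cg c0 gc.
have [u [K [cu wu uf _]]] := core_approx hD hR M0 Ff fM.
apply: (ler_cvg_to (carre_cvg hD M0 bf (core_bdom cg) wu uf)
  (cvgMl_tmp (a := c) (enorm_cvg hD (fun n => core_dom (cu n)) Ff uf))).
by apply: nearW => i; exact: (carre_core_le_form hD hR hS hlc hK).
Qed.

Lemma carre_measure f : bdom f -> exists mu : {measure set X -> \bar R},
  [/\ (mu setT <= (E f f)%:E)%E, forall A, mu A = douter F (carre f) A &
   forall g, core g -> intf mu g = carre f g].
Proof.
move=> bf; have hL := carre_positive bf.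
have [mu muE] := daniell_measure_exists hD hR hlc hrad hsupp hVD hL.
have mass : (mu setT <= (E f f)%:E)%E.
  have [al [c [hal al1 _ _ alc]]] := dcover_open hD hR hlc hrad hsupp hVD hL openT.
  rewrite muE (le_trans (douter_le hal))// lee_fin; apply/ler_addgt0Pr => e e0.
  have [n ce] := alc e e0; have [_ _ _ LM] := hL.
  have [cal _ _ _ _] := hal; have := LM 1 _ (cal n) ler01 (al1 n); lra.
exists mu; split=> // g cg.
by apply: (daniell_integral hD hrad hS hL) => //; exact: le_lt_trans mass (ltry _).
Qed.

Lemma form1_eq_ae u v : F u -> measurable_fun setT v ->
  {ae m, forall x, u x = v x} -> form1 u = form1 v.
Proof.
move=> Fu mv uv; rewrite /form1 (form_ae2 hD Fu mv uv); congr (_ + _).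
exact: (sqn_eq_ae (dom_sqint hD Fu)).
Qed.

Lemma form1_le_add a u v : F u -> F v ->
  form1 (fun x => a * u x + v x) <= 2 * a ^+ 2 * form1 u + 2 * form1 v.
Proof.
move=> Fu Fv; have Fau := domZ hD a Fu.
have -> : (fun x => a * u x + v x) = (fun x => a * u x) \+ v by [].
have := sqnD (dom_sqint hD Fau) (dom_sqint hD Fv).
rewrite (sqnZ a (dom_sqint hD Fu)) => sD.
have := dirichlet_ge0 hD (domB hD Fau Fv).
rewrite (formB2 hD Fau Fv) => dB.
rewrite /form1 (formD2 hD Fau Fv) -!/(sqn m _).
by move: dB; rewrite (formZ2 hD a Fu); lra.
Qed.

(* [clip a w / a] is at least 1 on {a < w}, which is open up to the small open
   set outside which [w] is continuous. *)
Lemma capacity_level w a e : 0 < a -> 0 < e -> F w -> quasi_continuous m F E w ->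
  form1 w < a ^+ 2 * e / 4 -> (capacity [set x | (a < w x)%R] < e%:E)%E.
Proof.
move=> a0 e0 Fw qw we; have e4 : 0 < e / 4 by lra.
have [G [oG capG cG]] := qw _ e4.
have [v [W [Fv oW GW ve [v01 vW]]]] := capacity_witness hD capG.
have oV := quasi_open a oG cG; have [Fc Ec] := clip_dom hD a0 Fw.
have f1c : form1 (clip a w) <= form1 w.
  apply: lerD => //; apply: sqn_le; [exact: (dom_sqint hD)|exact: (dom_measurable hD)|].
  by move=> x; have := ler_norm (w x); have := normr_ge0 (w x);
    case: (clipP w x a0) => *; rewrite ?normr0 ?(ger0_norm (ltW a0))//; lra.
pose u x := a^-1 * clip a w x + v x.
apply: (@le_lt_trans _ _ (form1 u)%:E).
  apply: ereal_inf_lbound; exists u => //; split.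
    by apply: (domD hD) => //; exact: (domZ hD).
  exists ([set x | a < w x] `|` G); split=> //.
  have c0 x : 0 <= a^-1 * clip a w x.
    rewrite mulr_ge0 ?invr_ge0 ?(ltW a0)//.
    by case: (clipP w x a0) => // *; exact: ltW.
  apply: filterS vW => x vWx [ax|/GW/vWx vx]; rewrite /u; last by have := c0 x; lra.
  have /andP[vx _] := v01 x; move: ax => /=; case: (clipP w x a0) => *; try lra.
  by rewrite mulVf ?gt_eqF//; lra.
rewrite lte_fin; apply: (le_lt_trans (form1_le_add _ Fc Fv)).
have : 2 * a^-1 ^+ 2 * form1 (clip a w) <= 2 * a^-1 ^+ 2 * form1 w.
  by rewrite ler_wpM2l// mulr_ge0// sqr_ge0.
have : 2 * a^-1 ^+ 2 * form1 w < 2 * a^-1 ^+ 2 * (a ^+ 2 * e / 4).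
  by rewrite ltr_pM2l// mulr_gt0// exprn_gt0// invr_gt0.
have -> : 2 * a^-1 ^+ 2 * (a ^+ 2 * e / 4) = e / 2 by field; rewrite gt_eqF.
by lra.
Qed.

(** Otherwise sets of capacity below 1/(n+1) and measure above e give functions u_n bounded by 1
    that tend to 0 in [form1], while [carre] of f on u_n stays above e / 2, against its weak
    continuity. *)
Lemma carre_capacity f (mu : {measure set X -> \bar R}) e : bdom f ->
  (forall A, mu A = douter F (carre f) A) -> 0 < e ->
  exists2 de, 0 < de & forall A, measurable A -> (capacity A < de%:E)%E ->
    (mu A <= e%:E)%E.
Proof.
move=> bf muE e0; apply: contrapT => /forall2NP H.
have {}H n : exists u, [/\ bdom u, forall x, `|u x| <= 1, form1 u < n.+1%:R^-1 &
    e / 2 <= carre f u].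
  have n0 : 0 < n.+1%:R^-1 :> R by rewrite invr_gt0 ltr0n.
  have [//|/existsNP[A /not_implyP[mA /not_implyP[capA /negP]]]] := H n.+1%:R^-1.
  rewrite -ltNge => muA.
  have [v [W [Fv oW AW ve [v01 vW]]]] := capacity_witness hD capA.
  have [al [c [hal al1 alW _ alc]]] :=
    dcover_open hD hR hlc hrad hsupp hVD (carre_positive bf) oW.
  have ec : e < c.
    rewrite -lte_fin; apply: (lt_le_trans muA).
    apply: (@le_trans _ _ (mu W)); last by rewrite muE; exact: douter_le hal.
    by apply: le_measure; rewrite ?inE//; exact: open_borel.
  have e2 : 0 < e / 2 by lra.
  have [k ck] := alc _ e2; have [cal al0 _ _ _] := hal.
  (* As v = 1 almost everywhere on W, u equals v almost everywhere; yet it dominates the core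
     function al k everywhere, and so inherits the mass of W. *)
  pose u x := Num.max (v x) (al k x).
  have mu_ : measurable_fun setT u.
    apply: measurable_maxr; first exact: (dom_measurable hD).
    exact: (core_measurable hD (cal k)).
  have vu : {ae m, forall x, v x = u x}.
    apply: filterS vW => x vWx; rewrite /u; apply/esym/max_idPl.
    have [->|/alW/vWx ->] := eqVneq (al k x) 0; last exact: al1.
    by have /andP[] := v01 x.
  have [Fu _] := dirichlet_ae hD Fv mu_ vu.
  have u1 x : `|u x| <= 1.
    have /andP[vx v1] := v01 x; rewrite ger0_norm /u ?le_max ?vx//.
    by rewrite ge_max v1 al1.
  have bu : bdom u by split=> //; exists 1.
  exists u; split=> //; first by rewrite -(form1_eq_ae Fv mu_ vu).
  apply: (@le_trans _ _ (carre f (al k))); first by lra.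
  apply: (carre_le_weight hD hR hS hK) => //; first exact: core_bdom.
  by move=> x; rewrite /u le_max lexx orbT.
have [u /all_and4[bu u1 ue fu]] := choice H.
have Fu n := bdom_dom (bu n).
have inv1 n : n.+1%:R^-1 <= 1 :> R by rewrite invf_le1 ?ltr0n// ler1n.
have un n : enorm (u n) <= 1.
  apply: enorm_le => //; rewrite expr1n; apply: le_trans (inv1 n).
  apply: ltW; apply: le_lt_trans (ue n); rewrite lerDl; exact: sqn_ge0.
have s0 : sqn m (u n \- cst 0) @[n --> \oo] --> 0.
  have -> : (fun n => sqn m (u n \- cst 0)) = (fun n => sqn m (u n)).
    by apply/funext => n; congr sqn; apply/funext => x /=; rewrite subr0.
  apply: cvg0_le (@cvg_harmonic R) => n.
  rewrite ger0_norm ?sqn_ge0//; apply: ltW; apply: le_lt_trans (ue n).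
  by rewrite lerDr; apply: (dirichlet_ge0 hD).
have b0 := core_bdom (core0 hD).
have cv := carre_weak_cvg hD bf b0 ltr01 Fu u1 un s0.
have : e / 2 <= carre f (cst 0) by apply: (cvgr_to_ge cv); exact: nearW.
by rewrite (functional0 hD (carre_positive bf)); lra.
Qed.

Lemma intf_bound nu h A a b : (nu setT < +oo)%E -> measurable_fun setT h ->
  measurable A -> 0 <= a -> 0 <= b -> (forall x, `|h x| <= a + b * \1_A x) ->
  `|intf nu h| <= a * fine (nu setT) + b * fine (nu A).
Proof.
move=> fin mh mA a0 b0 hab.
have iA : nu.-integrable setT (EFin \o (\1_A : X -> R)).
  apply: bounded_integrable => //; exists 1 => x.
  by rewrite indicE ger0_norm//; case: (_ \in _).
have ib : nu.-integrable setT (EFin \o (fun x => b * \1_A x)).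
  apply: bounded_integrable => //; first exact: measurable_funM.
  exists b => x; rewrite indicE normrM (ger0_norm b0).
  by case: (_ \in _); rewrite ?normr1 ?mulr1// normr0 mulr0.
have ia : nu.-integrable setT (EFin \o (cst a : X -> R)).
  by apply: bounded_integrable => //; exists `|a|.
have ih : nu.-integrable setT (EFin \o h).
  apply: bounded_integrable => //; exists (a + b) => x; apply: (le_trans (hab x)).
  by rewrite lerD2l indicE ler_piMr//; case: (_ \in _).
apply: (le_trans (le_normr_Rintegral measurableT ih)).
apply: (@le_trans _ _ (\int[nu]_x (a + b * \1_A x))).
  apply: le_Rintegral => //; first exact: (integrable_norm ih).
  have -> : EFin \o (fun x => a + b * \1_A x) =
    ((EFin \o cst a) \+ (EFin \o (fun x => (b * \1_A x)%R)))%E by [].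
  exact: integrableD.
rewrite (RintegralD measurableT ia ib)// Rintegral_cst// (RintegralZl _ measurableT iA)//.
by rewrite /Rintegral integral_indic// setIT.
Qed.

Lemma measurable_gt a h : measurable_fun setT h -> measurable [set x | a < h x].
Proof.
move=> mh; rewrite [X in measurable X](_ : _ = setT `&` h @^-1` `]a, +oo[%classic).
  exact: mh.
by apply/seteqP; split=> x /=; rewrite in_itv/= andbT => // -[].
Qed.

Lemma quasi_continuous_sub g u : quasi_continuous m F E g -> continuous u ->
  quasi_continuous m F E (g \- u).
Proof.
move=> qg cu e e0; have [G [oG capG cG]] := qg e e0; exists G; split=> // x.
by apply: cvgB; [exact: cG|exact: continuous_subspaceT].
Qed.

Lemma quasi_continuous_sub_opp g u : quasi_continuous m F E g -> continuous u ->
  quasi_continuous m F E (u \- g).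
Proof.
move=> qg cu e e0; have [G [oG capG cG]] := qg e e0; exists G; split=> // x.
by apply: cvgB; [exact: continuous_subspaceT|exact: cG].
Qed.

(** Core approximations converge to a quasi-continuous g in measure for mu: the sets where g - u_n
    or u_n - g exceeds a have small capacity by [capacity_level]. *)
Lemma quasi_cvg_measure f (mu : {measure set X -> \bar R}) g (u : nat -> X -> R) a e :
  bdom f -> (forall A, mu A = douter F (carre f) A) -> F g ->
  quasi_continuous m F E g -> (forall n, core (u n)) -> 0 < a -> 0 < e ->
  form1 (u n \- g) @[n --> \oo] --> 0 ->
  \forall n \near \oo, (mu [set x | (a < `|g x - u n x|)%R] <= e%:E)%E.
Proof.
move=> bf muE Fg qg cu a0 e0 cv; have e2 : 0 < e / 2 by lra.
have [de de0 small] := carre_capacity bf muE e2.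
have r0 : 0 < a ^+ 2 * de / 4 by rewrite divr_gt0// mulr_gt0// exprn_gt0.
have small_form : \forall n \near \oo, form1 (u n \- g) < a ^+ 2 * de / 4.
  by apply: (cvgr_lt _ cv).
apply: filterS small_form => n un; have Fu := core_dom (cu n).
have cont := core_cont (cu n).
have mg := dom_measurable hD Fg; have mun := dom_measurable hD Fu.
have fE : form1 (g \- u n) = form1 (u n \- g).
  have -> : g \- u n = (fun x => (-1) * (u n \- g) x).
    by apply/funext => x /=; ring.
  have FB := domB hD Fu Fg.
  rewrite /form1 (formZ2 hD _ FB) -!/(sqn m _) (sqnZ _ (dom_sqint hD FB)).
  by rewrite sqrrN expr1n !mul1r.
have half w : F w -> quasi_continuous m F E w -> form1 w < a ^+ 2 * de / 4 ->
    (mu [set x | (a < w x)%R] <= (e / 2)%:E)%E.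
  move=> Fw qw we; apply: small; last exact: capacity_level.
  by apply: measurable_gt; exact: (dom_measurable hD).
apply: (@le_trans _ _ (mu [set x | (a < (g \- u n) x)%R] +
    mu [set x | (a < (u n \- g) x)%R])%E); last first.
  rewrite [e]splitr EFinD; apply: leeD; apply: half.
  - exact: (domB hD).
  - exact: quasi_continuous_sub.
  - by rewrite fE.
  - exact: (domB hD).
  - exact: quasi_continuous_sub_opp.
  - by [].
have m1 := measurable_gt a (measurable_funB mg mun).
have m2 := measurable_gt a (measurable_funB mun mg).
apply: le_trans (measureU2 _ _ _) => //; apply: le_measure; rewrite ?inE.
- by apply: measurable_gt; apply: measurableT_comp => //; exact: measurable_funB.
- exact: measurableU.
move=> x /=; rewrite /= ltr_normr => /orP[]; [by left|right].
by move: b; rewrite opprB.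
Qed.

(** The formula is passed to the limit along core approximations of a truncation g' of g: they are
    uniformly bounded and converge in mu-measure on the left, weakly in energy on the right. *)
Lemma carre_integral f (mu : {measure set X -> \bar R}) g : bdom f ->
  (mu setT < +oo)%E -> (forall A, mu A = douter F (carre f) A) ->
  (forall v, core v -> intf mu v = carre f v) ->
  F g -> quasi_continuous m F E g -> ess_bounded m g ->
  (\int[mu]_x (g x)%:E =
    (E f (f \* g) - 2^-1 * E (fun x => f x ^+ 2) g)%:E)%E.
Proof.
move=> bf fin muE muf Fg qg [M0 gM0].
pose M : R := `|M0| + 1; have M1 : 0 < M by rewrite ltr_wpDl.
have M0M : M0 <= M by rewrite /M; have := ler_norm M0; lra.
clearbody M; pose g' x := Num.max (- M) (Num.min (g x) M).
have mg := dom_measurable hD Fg.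
have mg' : measurable_fun setT g'.
  exact: measurable_maxr (measurable_cst _) (measurable_minr mg (measurable_cst _)).
have small x : `|g x| <= M -> g x = g' x.
  by rewrite ler_norml /g' => /andP[h1 h2]; rewrite min_l// max_r.
have gg' : {ae m, forall x, g x = g' x}.
  apply: filterS gM0 => x gx; apply: small; exact: le_trans gx M0M.
have g'M x : `|g' x| <= M.
  by rewrite ler_norml /g' le_max lexx ge_max ge_min lexx orbT andbT; lra.
have [Fg' _] := dirichlet_ae hD Fg mg' gg'.
have bg' : bdom g' by split=> //; exists M.
have [u [K [cu wu ug' _]]] := core_approx hD hR M1 Fg' g'M.
have [Fu _ uM _ us] := wu.
have f0 : form1 (u n \- g) @[n --> \oo] --> 0.
  have -> : (fun n => form1 (u n \- g)) =
      (fun n => enorm (u n \- g') * enorm (u n \- g') + sqn m (u n \- g')).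
    apply/funext => n; rewrite -expr2 (enorm2 hD); last exact: (domB hD).
    apply: (form1_eq_ae (domB hD (Fu n) Fg)).
      by apply: measurable_funB => //; exact: (dom_measurable hD).
    by apply: filterS gg' => x /= ->.
  by apply: cvg0D => //; have := cvgM ug' ug'; rewrite mul0r; exact.
have conv a e (a0 : 0 < a) (e0 : 0 < e) :=
  quasi_cvg_measure bf muE Fg qg cu a0 e0 f0.
(* An m-almost everywhere identity is not enough for mu. Where |g| > M + 1/(k+1), however, g is at
   distance more than 1/(k+1) from every u_n, so this set is mu-null by convergence in measure. *)
have mugg' : {ae mu, forall x, g x = g' x}.
  pose B k := [set x | M + k.+1%:R^-1 < `|g x|].
  have mB k : measurable (B k) by apply: measurable_gt; exact: measurableT_comp.
  have BS k : B k `<=` B k.+1.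
    move=> x; rewrite /B /=; apply: le_lt_trans.
    by rewrite lerD2l lef_pV2 ?posrE ?ltr0n// ler_nat.
  have B0 k : (mu (B k) <= 0)%E.
    apply/lee_addgt0Pr => e e0; rewrite add0e.
    have k0 : 0 < k.+1%:R^-1 :> R by rewrite invr_gt0 ltr0n.
    have [n muBn] := @filter_ex _ \oo _ _ (conv _ _ k0 e0); apply: le_trans muBn.
    apply: le_measure; rewrite ?inE//.
      apply: measurable_gt; apply: measurableT_comp => //.
      by apply: measurable_funB => //; exact: (dom_measurable hD).
    move=> x; rewrite /B /= => gx; have := ler_normD (g x - u n x) (u n x).
    by rewrite subrK; have := uM n x; move: (_^-1) gx => q gx; lra.
  exists (\bigcup_k B k); split; first exact: bigcup_measurable.
    by apply/eqP; rewrite -measure_le0 bigcup_measure_le.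
  move=> x /= gx; have [/small//|/ltr_add_invr[k]] := leP `|g x| M.
  by exists k.
have cv : intf mu (u n) @[n --> \oo] --> intf mu g'.
  apply/cvgrPdist_le => e e0; pose T := fine (mu setT).
  have T0 : 0 <= T by exact: fine_ge0.
  have a0 : 0 < e / 2 / (T + 1) by rewrite !divr_gt0// ltr_wpDl.
  have b0 : 0 < e / 2 / (2 * M) by rewrite !divr_gt0// mulr_gt0.
  apply: filterS (conv _ _ a0 b0) => n; set A := [set _ | _] => muA.
  have mun := dom_measurable hD (Fu n).
  have mA : measurable A.
    by apply: measurable_gt; apply: measurableT_comp => //; exact: measurable_funB.
  rewrite /intf -RintegralB//; last 2 first.
  - by apply: bounded_integrable => //; exists M.
  - by apply: bounded_integrable => //; exists M.
  have M2 : 0 <= 2 * M by lra.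
  apply: (le_trans (intf_bound fin (measurable_funB mg' mun) mA (ltW a0) M2 _)).
    move=> x; rewrite indicE; have := uM n x; have := g'M x.
    have [Ax|] := pselect (A x).
      rewrite mem_set//= mulr1 => h1 h2; apply: (le_trans (ler_normB _ _)).
      by lra.
    move=> nA; rewrite memNset//= mulr0 addr0 => _ un.
    move/negP: nA; rewrite -leNgt; apply: le_trans.
    move/ler_normlP: un => [u1 u2]; rewrite /g'.
    have [gM|gM] := leP (g x) M.
      have [gN|gN] := leP (- M) (g x); first by rewrite lexx.
      have h := ler_norm (- (g x - u n x)); rewrite normrN in h.
      by apply/ler_normlP; split; lra.
    rewrite max_r; last by lra.
    have h := ler_norm (g x - u n x); apply/ler_normlP; split; lra.
  have muA' : fine (mu A) <= e / 2 / (2 * M).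
    by rewrite -lee_fin fineK// measure_fin.
  have : e / 2 / (T + 1) * T <= e / 2.
    by rewrite mulrAC ler_pdivrMr ?ltr_wpDl//; nra.
  have : 2 * M * fine (mu A) <= e / 2.
    by rewrite mulrC -ler_pdivlMr// mulr_gt0.
  by rewrite -/T; lra.
have gE : intf mu g' = carre f g'.
  apply: (cvg_same cv).
  have -> : (fun n => intf mu (u n)) = (fun n => carre f (u n)).
    by apply/funext => n; exact: muf.
  exact: (carre_cvgr hD M1 bf bg' wu).
have bfg' := bdomM hD bf bg'; have bff := bdomM hD bf bf.
have mf := dom_measurable hD (bdom_dom bf).
have fg'g : {ae m, forall x, (f \* g') x = (f \* g) x}.
  by apply: filterS gg' => x /= ->.
have [Ffg hfg] := dirichlet_ae hD (bdom_dom bfg') (measurable_funM mf mg) fg'g.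
rewrite (ae_eq_integral (fun x => (g' x)%:E))//; last 3 first.
- exact/measurable_EFinP.
- exact/measurable_EFinP.
- by apply: filterS mugg' => x /= -> _.
have -> : (\int[mu]_x (g' x)%:E)%E = (intf mu g')%:E.
  rewrite /intf /Rintegral fineK//; apply: integrable_fin_num => //.
  by apply: bounded_integrable => //; exists M.
rewrite gE /carre; congr ((_ - _ * _)%:E).
  rewrite (formC hD (bdom_dom bf) (bdom_dom bfg')) (formC hD (bdom_dom bf) Ffg).
  apply: (form_ae hD (bdom_dom bfg')) => //; last exact: bdom_dom.
  exact: measurable_funM.
have -> : (fun x => f x ^+ 2) = f \* f by apply/funext => x /=; rewrite expr2.
have Fff := bdom_dom bff.
rewrite (formC hD Fff Fg') (formC hD Fff Fg).
by apply: (form_ae hD Fg') => //; apply: filterS gg' => x ->.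
Qed.

Lemma the_measureP (P : {measure set X -> \bar R} -> Prop) :
  (exists mu, P mu) -> P (the_measure P).
Proof. by rewrite /the_measure; case: pselect => // exP _; exact: svalP (cid exP). Qed.

(** The chosen measure is known only through its defining property, not as the measure constructed
    above, so the bound on its mass is derived anew from that property along an exhaustion. *)
Lemma energy_measure_boundedP f : bdom f ->
  (energy_measure_bounded m F E f setT <= (E f f)%:E)%E /\
  forall g, core g -> intf (energy_measure_bounded m F E f) g = carre f g.
Proof.
move=> bf; rewrite /energy_measure_bounded.
set P := (P in the_measure P); set nu := the_measure P.
have Pnu : P nu.
  apply: the_measureP; have [mu [mass muE muf]] := carre_measure bf.
  exists mu => g Fg qg bg; apply: carre_integral => //.
  exact: le_lt_trans mass (ltry _).
have nuf g : core g -> (\int[nu]_x (g x)%:E = (carre f g)%:E)%E.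
  move=> cg; have [M M0 gM] := core_bounded cg.
  rewrite (Pnu g (core_dom cg) (continuous_quasi hD (core_cont cg))).
    have -> : (fun x => f x ^+ 2) = f \* f by apply/funext => x /=; rewrite expr2.
    by [].
  by exists M; exact: aeW.
have hL := carre_positive bf.
split; last by move=> g cg; rewrite /intf /Rintegral nuf.
have [al [cal al1 _ alS alT]] := core_exhaustion hD hR hlc hrad hsupp hVD openT.
pose B n := [set x | 1 <= al n x].
have mB n : measurable (B n) by apply/closed_borel/closed_ge_cont/core_cont.
have -> : [set: X] = \bigcup_n B n.
  apply/seteqP; split=> // x _; have [n an] := alT x I; exists n => //.
  by rewrite /B /= an.
apply: bigcup_measure_le => // n.
  move=> x; rewrite /B /= => a1; rewrite alS//; apply/eqP => a0.
  by move: a1; rewrite a0; lra.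
have al0 x : 0 <= al n x by have /andP[] := al1 n x.
have := markov_le nu (core_measurable hD (cal n)) al0 ler01 (mB n) (fun _ Bx => Bx).
rewrite mul1e nuf// => /le_trans; apply; rewrite lee_fin -[leRHS]mul1r.
have [_ _ _ LM] := hL.
by apply: LM => // x; have /andP[] := al1 n x.
Qed.

End energy_measures.

(** * Comparison of energy measures of bounded functions *)

Section energy_comparison.
Context {d : measure_display} {R : realType} {X : borelMetricType d R}.
Variable m : {measure set X -> \bar R}.
Variables (F : set (X -> R)) (E E' : (X -> R) -> (X -> R) -> R).
Hypothesis hD : dirichlet_form m F E.
Hypothesis hR : regular_form m F E.
Hypothesis hS : strongly_local m F E.
Hypothesis hD' : dirichlet_form m F E'.
Hypothesis hR' : regular_form m F E'.
Hypothesis hS' : strongly_local m F E'.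
Hypothesis hlc : locally_compact [set: X].
Hypothesis hrad : radon_measure m.
Hypothesis hsupp : measure_support m = [set: X].
Hypothesis hVD : volume_doubling m.
Implicit Types (f g h : X -> R) (A G : set X) (c : R).

Local Notation core := (core F).
Local Notation bdom := (bdom F).
Local Notation EB := (energy_measure_bounded m F E).
Local Notation EB' := (energy_measure_bounded m F E').

Lemma energy_bounded_finite f : bdom f -> (EB f setT < +oo)%E.
Proof.
move=> bf; have [mass _] := energy_measure_boundedP hD hR hS hlc hrad hsupp hVD bf.
exact: le_lt_trans mass (ltry _).
Qed.

Lemma energy_bounded_le f f' G A c :
  (EB' f' setT < +oo)%E -> bdom f -> bdom f' -> 0 <= c -> open G ->
  (forall g, core g -> (forall x, 0 <= g x) -> (forall x, g x != 0 -> G x) ->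
     carre E f g <= c * carre E' f' g) ->
  measurable A -> A `<=` G -> (EB f A <= c%:E * EB' f' A)%E.
Proof.
move=> fin' bf bf' c0 oG H mA AG.
have fin := energy_bounded_finite bf.
have [_ If] := energy_measure_boundedP hD hR hS hlc hrad hsupp hVD bf.
have [_ If'] := energy_measure_boundedP hD' hR' hS' hlc hrad hsupp hVD bf'.
apply: (measure_comp hD hR hlc hrad hsupp hVD c0 fin fin' oG) => // g cg g0 gG.
by rewrite If// If'//; exact: H.
Qed.

End energy_comparison.

(** * Energy measures of unbounded functions *)

Section energy_limits.
Context {d : measure_display} {R : realType} {X : borelMetricType d R}.
Variable m : {measure set X -> \bar R}.
Variables (F : set (X -> R)) (E : (X -> R) -> (X -> R) -> R).
Hypothesis hD : dirichlet_form m F E.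
Hypothesis hR : regular_form m F E.
Hypothesis hS : strongly_local m F E.
Hypothesis hlc : locally_compact [set: X].
Hypothesis hrad : radon_measure m.
Hypothesis hsupp : measure_support m = [set: X].
Hypothesis hVD : volume_doubling m.
Implicit Types (f g h : X -> R) (A G : set X) (c : R).

Local Notation bdom := (bdom F).
Local Notation EB := (energy_measure_bounded m F E).
Local Notation EM := (energy_measure m F E).
Let hK := compact_fin hrad.
Let finite := energy_bounded_finite hD hR hS hlc hrad hsupp hVD.

(** Truncating does not increase Gamma, so the measures of the truncations increase with n and their
    limit is again a measure. *)
Lemma energy_measureP f A : F f -> measurable A ->
  EB (truncation n f) A @[n --> \oo] --> EM f A.
Proof.
move=> Ff; move: A; rewrite /energy_measure; set P := (P in the_measure P).
apply: (@the_measureP _ _ _ P); apply: sup_measure_exists => n A mA.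
have bt k := truncation_bdom hD k Ff.
rewrite -[leRHS]mul1e.
apply: (energy_bounded_le hD hR hS hD hR hS hlc hrad hsupp hVD (G := setT)) => //.
- exact: finite.
- exact: openT.
move=> g cg g0 _; rewrite mul1r.
have := carre_truncation hD hR hS hK n (bt n.+1) cg g0.
by rewrite truncation_le.
Qed.

Lemma energy_measure_fin f : F f ->
  (EM f setT <= ((2 * enorm E f) ^+ 2)%:E)%E.
Proof.
move=> Ff; apply: (cvge_to_le (energy_measureP Ff measurableT)).
apply: nearW => n; have bt := truncation_bdom hD n Ff.
have [mass _] := energy_measure_boundedP hD hR hS hlc hrad hsupp hVD bt.
apply: (le_trans mass); rewrite lee_fin -(enorm2 hD (bdom_dom bt)).
have [_ le2] := truncation_dom hD n Ff.
by rewrite ler_sqr// nnegrE ?enorm_ge0// mulr_ge0// enorm_ge0.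
Qed.

Lemma truncation_id M f n : (forall x, `|f x| <= M) -> M <= n%:R ->
  truncation n f = f.
Proof.
move=> fM Mn; apply/funext => x; have /ler_normlP[h1 h2] := fM x.
by rewrite /truncation min_l ?max_r//; lra.
Qed.

Lemma energy_measure_bdom f A : bdom f -> measurable A -> EM f A = EB f A.
Proof.
move=> bf mA; have [Ff [M M0 fM]] := bf.
have cv := energy_measureP Ff mA.
suff cst : EB (truncation n f) A @[n --> \oo] --> EB f A by exact: cvg_unique cv cst.
apply: cvg_near_cst; near=> n; rewrite (truncation_id fM)//.
near: n; exact: nbhs_infty_ger.
Unshelve. all: by end_near.
Qed.

End energy_limits.

Section energy_measure_properties.
Context {d : measure_display} {R : realType} {X : borelMetricType d R}.
Variable m : {measure set X -> \bar R}.
Variables (F : set (X -> R)).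
Hypothesis hlc : locally_compact [set: X].
Hypothesis hrad : radon_measure m.
Hypothesis hsupp : measure_support m = [set: X].
Hypothesis hVD : volume_doubling m.
Implicit Types (E : (X -> R) -> (X -> R) -> R).
Implicit Types (f g h phi : X -> R) (A G O : set X) (c b : R).

Local Notation core := (core F).
Local Notation bdom := (bdom F).
Local Notation EB := (energy_measure_bounded m F).
Local Notation EM := (energy_measure m F).
Let hK := compact_fin hrad.

Definition strongly_local_form E :=
  [/\ dirichlet_form m F E, regular_form m F E & strongly_local m F E].

Lemma energy_measure_le E E' f f' G A c :
  strongly_local_form E -> strongly_local_form E' -> F f -> F f' -> 0 <= c ->
  open G -> (forall n g, core g -> (forall x, 0 <= g x) -> (forall x, g x != 0 -> G x) ->
    carre E (truncation n f) g <= c * carre E' (truncation n f') g) ->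
  measurable A -> A `<=` G -> (EM E f A <= c%:E * EM E' f' A)%E.
Proof.
move=> [hD hR hS] [hD' hR' hS'] Ff Ff' c0 oG H mA AG.
have cv := energy_measureP hD hR hS hlc hrad hsupp hVD Ff mA.
have cv' := energy_measureP hD' hR' hS' hlc hrad hsupp hVD Ff' mA.
have {}cv' : (c%:E * EB E' (truncation n f') A)%E @[n --> \oo] --> (c%:E * EM E' f' A)%E.
  exact: cvgeZl.
rewrite -(cvg_lim _ cv)// -(cvg_lim _ cv')//; apply: lee_lim.
- by apply/cvg_ex; eexists; exact: cv.
- by apply/cvg_ex; eexists; exact: cv'.
apply: nearW => n; have bt := truncation_bdom hD n Ff.
have bt' := truncation_bdom hD n Ff'.
have fin' := energy_bounded_finite hD' hR' hS' hlc hrad hsupp hVD bt'.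
apply: (energy_bounded_le hD hR hS hD' hR' hS' hlc hrad hsupp hVD fin' bt bt' c0 oG) => //.
exact: H.
Qed.

Lemma energy_measure_comparison E E' C f A :
  strongly_local_form E -> strongly_local_form E' -> 0 <= C ->
  (forall u, F u -> E u u <= C * E' u u) -> F f -> measurable A ->
  (EM E f A <= C%:E * EM E' f A)%E.
Proof.
move=> hE hE' C0 hC Ff mA.
apply: (energy_measure_le (G := setT)) => // [|n g cg g0 _]; first exact: openT.
have [hD hR hS] := hE; have [hD' hR' hS'] := hE'.
apply: (carre_le hD hS hD' hR' hS' hK C0 hC) => //; last exact: core_bdom.
exact: (truncation_bdom hD).
Qed.

Section one_form.
Variable E : (X -> R) -> (X -> R) -> R.
Hypothesis hE : strongly_local_form E.
Let hD : dirichlet_form m F E. Proof. by case: hE. Qed.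
Let hR : regular_form m F E. Proof. by case: hE. Qed.
Let hS : strongly_local m F E. Proof. by case: hE. Qed.

Lemma energy_measure_local f f' G A : F f -> F f' -> open G ->
  {ae m, forall x, G x -> f x = f' x} -> measurable A -> A `<=` G ->
  EM E f A = EM E f' A.
Proof.
move=> Ff Ff' oG ff' mA AG.
have le1 h h' : F h -> F h' -> {ae m, forall x, G x -> h x = h' x} ->
    (EM E h A <= EM E h' A)%E.
  move=> Fh Fh' hh'; rewrite -[leRHS]mul1e.
  apply: (energy_measure_le (G := G)) => // n g cg g0 gG; rewrite mul1r.
  have := truncation_bdom hD n Fh; have := truncation_bdom hD n Fh' => bt' bt.
  rewrite (carre_local hD hR hS hlc hK bt bt' cg oG)//.
  by apply: filterS hh' => x + Gx; rewrite /truncation => ->.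
apply/eqP; rewrite eq_le !le1//.
by apply: filterS ff' => x + Gx => ->.
Qed.

Lemma energy_measure_bdom_le f f' G A c : bdom f -> bdom f' -> 0 <= c -> open G ->
  (forall g, core g -> (forall x, 0 <= g x) -> (forall x, g x != 0 -> G x) ->
    carre E f g <= c * carre E f' g) ->
  measurable A -> A `<=` G -> (EM E f A <= c%:E * EM E f' A)%E.
Proof.
move=> bf bf' c0 oG H mA AG.
rewrite !(energy_measure_bdom hD hR hS hlc hrad hsupp hVD)//.
have fin' := energy_bounded_finite hD hR hS hlc hrad hsupp hVD bf'.
exact: (energy_bounded_le hD hR hS hD hR hS hlc hrad hsupp hVD fin' bf bf' c0 oG).
Qed.

Lemma energy_measure_affine_le f f' G A c b : bdom f -> bdom f' -> open G ->
  {ae m, forall x, G x -> f x = c * f' x + b} -> measurable A -> A `<=` G ->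
  (EM E f A <= (c ^+ 2)%:E * EM E f' A)%E.
Proof.
move=> bf bf' oG ff'; apply: energy_measure_bdom_le => //; first exact: sqr_ge0.
by move=> g cg g0 gG; rewrite (carre_affine hD hR hS hlc hK bf bf' cg g0 oG ff').
Qed.

Lemma energy_measure_slope4_le f A : bdom f -> bdom (slope4 f) -> measurable A ->
  (EM E (slope4 f) A <= 4%:E * EM E f A)%E.
Proof.
move=> bf bf' mA; apply: (energy_measure_bdom_le (G := setT)) => //; first exact: openT.
by move=> g cg g0 _; exact: (carre_slope4 hD hR hS hK).
Qed.

End one_form.

End energy_measure_properties.

(** * Energy measures of functions locally in the domain *)

Section gluing.
Context {d : measure_display} {R : realType} {X : borelMetricType d R}.
Variable m : {measure set X -> \bar R}.
Variables (F : set (X -> R)).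
Hypothesis hlc : locally_compact [set: X].
Hypothesis hrad : radon_measure m.
Hypothesis hsupp : measure_support m = [set: X].
Hypothesis hVD : volume_doubling m.
Implicit Types (E : (X -> R) -> (X -> R) -> R).
Implicit Types (f g h phi : X -> R) (A B O : set X) (c b : R).
Implicit Types (nu : {measure set X -> \bar R}) (G : nat -> set X).

Local Notation bdom := (bdom F).
Local Notation EM := (energy_measure m F).
Local Notation LM := (local_energy_measure m F).
Local Notation locdom := (locally_in_domain m F).
Local Notation strongly_local_form := (strongly_local_form m F).

Lemma measure_cover_sum nu G A : (forall n, open (G n)) ->
  (forall x, exists n, G n x) -> measurable A ->
  nu A = (\sum_(n <oo) nu (A `&` seqDU G n))%E.
Proof.
move=> oG cG mA; have mD := seqDU_measurable (fun n => open_borel (oG n)).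
rewrite -measure_semi_bigcup; last 3 first.
- by move=> n; exact: measurableI.
- by apply: trivIset_setIl; exact: trivIset_seqDU.
- by apply: bigcup_measurable => n _; exact: measurableI.
rewrite -setI_bigcupr -seqDU_bigcup_eq; congr (nu _).
by apply/seteqP; split=> [x Ax|x []//]; split=> //; have [n Gn] := cG x; exists n.
Qed.

Lemma measure_cover_le nu nu' G A c : (forall n, open (G n)) ->
  (forall x, exists n, G n x) -> measurable A -> 0 <= c ->
  (forall n B, measurable B -> B `<=` A -> B `<=` G n -> (nu B <= c%:E * nu' B)%E) ->
  (nu A <= c%:E * nu' A)%E.
Proof.
move=> oG cG mA c0 H; have mD := seqDU_measurable (fun n => open_borel (oG n)).
rewrite (measure_cover_sum nu oG cG mA) (measure_cover_sum nu' oG cG mA).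
rewrite -nneseriesZl//; apply: lee_nneseries => // n _.
apply: (H n); first exact: measurableI.
  exact: subIsetl.
by move=> x [_]; exact: subset_seqDU.
Qed.

(** The measure is the sum of restrictions of energy measures of local representatives to the
    disjoint pieces of a countable precompact cover. Locality makes it agree with any other
    representative. *)
Lemma local_energy_measureP E phi : strongly_local_form E -> locdom phi ->
  forall (G : set X) h, open G -> precompact G -> F h ->
    {ae m, forall x, G x -> phi x = h x} ->
    forall A, measurable A -> A `<=` G -> LM E phi A = EM E h A.
Proof.
move=> hE lphi; rewrite /local_energy_measure; set P := (P in the_measure P).
apply: (@the_measureP _ _ _ P).
have [G [oG pG cG]] := precompact_cover hlc hrad hsupp hVD.
have /choice[h /all_and2[Fh phih]] n : exists h, F h /\
    {ae m, forall x, G n x -> phi x = h x}.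
  by have [h Fh phih] := lphi _ (oG n) (pG n); exists h.
have mD := seqDU_measurable (fun n => open_borel (oG n)).
pose mu : {measure set X -> \bar R} :=
  mseries (fun n => mrestr (EM E (h n)) (mD n) : {measure set X -> \bar R}) 0.
exists mu => H k oH pH Fk phik A mA AH.
rewrite (measure_cover_sum (EM E k) oG cG mA) /mu /= /mseries.
apply: eq_eseriesr => n _; rewrite /mrestr.
apply: (energy_measure_local hlc hrad hsupp hVD hE (G := H `&` G n)) => //.
- exact: openI.
- by apply: filterS2 phik (phih n) => x e1 e2 [Hx Gx]; rewrite -e1// e2.
- exact: measurableI.
- by move=> x [Ax Dx]; split; [exact: AH|exact: (subset_seqDU Dx)].
Qed.

Lemma local_energy_measure_le E E' phi phi' O A c :
  strongly_local_form E -> strongly_local_form E' -> locdom phi -> locdom phi' ->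
  0 <= c ->
  (forall G : set X, open G -> precompact G -> exists h h',
    [/\ F h, F h', {ae m, forall x, G x -> phi x = h x},
        {ae m, forall x, G x -> phi' x = h' x} &
        forall B, measurable B -> B `<=` G -> B `<=` O ->
          (EM E h B <= c%:E * EM E' h' B)%E]) ->
  measurable A -> A `<=` O -> (LM E phi A <= c%:E * LM E' phi' A)%E.
Proof.
move=> hE hE' lphi lphi' c0 H mA AO.
have [G [oG pG cG]] := precompact_cover hlc hrad hsupp hVD.
apply: (measure_cover_le oG cG) => // n B mB BA BG.
have [h [h' [Fh Fh' ph ph' hh']]] := H _ (oG n) (pG n).
rewrite (local_energy_measureP hE lphi (oG n) (pG n) Fh ph)//.
rewrite (local_energy_measureP hE' lphi' (oG n) (pG n) Fh' ph')//.
by apply: hh' => //; exact: subset_trans AO.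
Qed.

Lemma local_energy_measure_comparison E E' C phi A :
  strongly_local_form E -> strongly_local_form E' -> 0 <= C ->
  (forall u, F u -> E u u <= C * E' u u) -> locdom phi -> measurable A ->
  (LM E phi A <= C%:E * LM E' phi A)%E.
Proof.
move=> hE hE' C0 hC lphi mA.
apply: (local_energy_measure_le (O := setT)) => // G oG pG.
have [h Fh ph] := lphi _ oG pG; exists h, h; split=> // B mB _ _.
exact: (energy_measure_comparison hlc hrad hsupp hVD hE hE').
Qed.

Section unit_interval.
Variable E : (X -> R) -> (X -> R) -> R.
Hypothesis hE : strongly_local_form E.
Let hD : dirichlet_form m F E. Proof. by case: hE. Qed.

Lemma locally_bdom phi (G : set X) : locdom phi -> (forall x, 0 <= phi x <= 1) ->
  open G -> precompact G -> exists h,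
  [/\ bdom h, forall x, 0 <= h x <= 1 & {ae m, forall x, G x -> phi x = h x}].
Proof.
move=> lphi phi01 oG pG; have [h Fh ph] := lphi _ oG pG.
have c01 x : 0 <= clip 1 h x <= 1 by case: (clipP h x (@ltr01 R)) => *; lra.
have [Fc _] := clip_dom hD (@ltr01 R) Fh.
exists (clip 1 h); split=> //.
  split=> //; exists 1 => // x; have /andP[c0 c1] := c01 x.
  by rewrite ger0_norm.
apply: filterS ph => x + Gx => /(_ Gx) ph; have := phi01 x; rewrite ph.
by case: (clipP h x (@ltr01 R)) => *; lra.
Qed.

Lemma local_energy_affine_le phi phi' O A c b : locdom phi -> locdom phi' ->
  (forall x, 0 <= phi x <= 1) -> (forall x, 0 <= phi' x <= 1) -> open O ->
  (forall x, O x -> phi x = c * phi' x + b) -> measurable A -> A `<=` O ->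
  (LM E phi A <= (c ^+ 2)%:E * LM E phi' A)%E.
Proof.
move=> lphi lphi' p01 p01' oO pp'; apply: local_energy_measure_le => //.
  exact: sqr_ge0.
move=> G oG pG; have [h [bh _ ph]] := locally_bdom lphi p01 oG pG.
have [h' [bh' _ ph']] := locally_bdom lphi' p01' oG pG.
exists h, h'; split=> //; [exact: bdom_dom|exact: bdom_dom|].
move=> B mB BG BO.
apply: (energy_measure_affine_le hlc hrad hsupp hVD hE (G := G `&` O) (b := b)) => //.
- exact: openI.
- by apply: filterS2 ph ph' => x e1 e2 [Gx Ox]; rewrite -e1// -e2// pp'.
- by move=> x Bx; split; [exact: BG|exact: BO].
Qed.

Lemma slope4_01 h (x : X) : 0 <= slope4 h x <= 1.
Proof.
rewrite /slope4 /=; have p4 : (0 : R) < 4^-1 by lra.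
have p34 : (0 : R) < 3 / 4 by lra.
by case: (clipP h x p4) => *; case: (clipP h x p34) => *; lra.
Qed.

Lemma locally_slope4 phi : locdom phi -> locdom (slope4 phi).
Proof.
move=> lphi G oG pG; have [h Fh ph] := lphi _ oG pG.
exists (slope4 h); first by have [] := slope4_dom hD Fh.
by apply: filterS ph => x + Gx => /(_ Gx); rewrite /slope4 /= /clip => ->.
Qed.

Lemma local_energy_slope4_le phi A : locdom phi -> (forall x, 0 <= phi x <= 1) ->
  measurable A -> (LM E (slope4 phi) A <= 4%:E * LM E phi A)%E.
Proof.
move=> lphi p01 mA; have ls := locally_slope4 lphi.
apply: (local_energy_measure_le (O := setT)) => // G oG pG.
have [h [bh _ ph]] := locally_bdom lphi p01 oG pG.
have [Fs _] := slope4_dom hD (bdom_dom bh).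
exists (slope4 h), h; split=> //; first exact: bdom_dom.
  by apply: filterS ph => x + Gx => /(_ Gx); rewrite /slope4 /= /clip => ->.
move=> B mB _ _; apply: (energy_measure_slope4_le hlc hrad hsupp hVD hE) => //.
split=> //; exists 1 => // x; have /andP[c0 c1] := slope4_01 h x.
by rewrite ger0_norm.
Qed.

End unit_interval.

End gluing.

(** * Self-improvement of cutoff functions *)

Section geometric_series.
Context {R : realType} {X : metricType R}.
Variables (q : R) (psi : nat -> X -> R).
Hypothesis q01 : 0 < q < 1.
Hypothesis psi01 : forall n x, 0 <= psi n x <= 1.

Definition psum n : X -> R := fun x => \sum_(k < n) (1 - q) * q ^+ k * psi k x.
Definition pseries : X -> R := fun x => limn (fun n => psum n x).

Lemma psumS n x : psum n.+1 x = psum n x + (1 - q) * q ^+ n * psi n x.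
Proof. by rewrite /psum big_ord_recr. Qed.

Lemma geometric_gt0 n : 0 < q ^+ n.
Proof. by apply: exprn_gt0; case/andP: q01. Qed.

(** The remaining weights sum to q^n. Partial sums increase, and partial sums plus q^n decrease,
    which brackets the series. *)
Lemma psum_step n x : psum n x <= psum n.+1 x /\ psum n.+1 x + q ^+ n.+1 <= psum n x + q ^+ n.
Proof.
rewrite psumS exprS; have := geometric_gt0 n; have /andP[q0 q1] := q01.
have /andP[p0 p1] := psi01 n x => qn; have w0 : 0 < (1 - q) * q ^+ n by nra.
by split; nra.
Qed.

Lemma psum_bounds n j x :
  psum n x <= psum (n + j) x /\ psum (n + j) x + q ^+ (n + j) <= psum n x + q ^+ n.
Proof.
elim: j => [|j [IH1 IH2]]; first by rewrite addn0.
have [h1 h2] := psum_step (n + j) x; rewrite addnS.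
by split; [exact: le_trans h1|exact: le_trans h2 _].
Qed.

Lemma psum_cvg x : psum n x @[n --> \oo] --> pseries x.
Proof.
apply: nondecreasing_is_cvgn.
  by apply/nondecreasing_seqP => n; have [] := psum_step n x.
exists 1 => _ [n _ <-]; have [_] := psum_bounds 0 n x.
by rewrite add0n expr0 /psum big_ord0 add0r; have := geometric_gt0 n; lra.
Qed.

Lemma pseries_bounds n x : psum n x <= pseries x <= psum n x + q ^+ n.
Proof.
have near_n : \forall k \near \oo, psum n x <= psum k x <= psum n x + q ^+ n.
  exists n => // k /= nk; have [] := psum_bounds n (k - n) x.
  by rewrite subnKC// => -> h2; have := geometric_gt0 k; lra.
apply/andP; split.
- by apply: (cvgr_to_ge (@psum_cvg x)); apply: filterS near_n => k /andP[].
- by apply: (cvgr_to_le (@psum_cvg x)); apply: filterS near_n => k /andP[].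
Qed.

Lemma pseries_dist n x : `|psum n x - pseries x| <= q ^+ n.
Proof. by have /andP[] := pseries_bounds n x => h1 h2; apply/ler_normlP; split; lra. Qed.

Lemma pseries01 x : 0 <= pseries x <= 1.
Proof. by have := pseries_bounds 0 x; rewrite /psum big_ord0 expr0 add0r. Qed.

Lemma cvg_geometric_q : q ^+ n @[n --> \oo] --> 0.
Proof. by apply: cvg_expr; case/andP: q01 => q0 q1; rewrite gtr0_norm. Qed.

Lemma psum_tail n j x : (forall k, (n < k)%N -> psi k x = 1) ->
  psum (n.+1 + j) x = psum n.+1 x + q ^+ n.+1 - q ^+ (n.+1 + j).
Proof.
move=> p1; elim: j => [|j IH]; first by rewrite addn0 addrK.
rewrite addnS psumS IH p1 ?mulr1; last by rewrite ltnS leq_addr.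
by rewrite (exprS _ (n.+1 + j)); ring.
Qed.

Lemma pseries_eq n x : (forall k, (k < n)%N -> psi k x = 0) ->
  (forall k, (n < k)%N -> psi k x = 1) ->
  pseries x = (1 - q) * q ^+ n * psi n x + q ^+ n.+1.
Proof.
move=> p0 p1; set s := RHS.
have s0 : psum n x = 0.
  by rewrite /psum big1// => -[k kn] _ /=; rewrite p0// mulr0.
have d j : `|pseries x - s| <= 2 * q ^+ (n.+1 + j).
  have /andP[h1 h2] := pseries_bounds (n.+1 + j) x; move: h1 h2.
  rewrite psum_tail// psumS s0 -/s => h1 h2; have := geometric_gt0 (n.+1 + j).
  move: h1 h2; rewrite /s => h1 h2 h3; apply/ler_normlP; split; lra.
have : `|pseries x - s| <= 0.
  apply: (@le_of_cvg0 _ _ (fun j => 2 * q ^+ (n.+1 + j)) d).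
  apply: cvg0Z; have := cvg_geometric_q; rewrite -(cvg_shiftn n.+1).
  by under eq_fun do rewrite addnC.
by rewrite normr_le0 subr_eq0 => /eqP.
Qed.

Lemma pseries_eq0 x : (forall k, psi k x = 0) -> pseries x = 0.
Proof.
move=> p0; have h n : pseries x <= q ^+ n.
  have /andP[_] := pseries_bounds n x.
  by rewrite /psum big1 ?add0r// => i _; rewrite p0 mulr0.
have := le_of_cvg0 h cvg_geometric_q; have /andP[p1 _] := pseries01 x.
lra.
Qed.

Lemma pseries_continuous : (forall n, continuous (psi n)) -> continuous pseries.
Proof.
move=> cp; have cs n : continuous (psum n).
  elim: n => [|n IH].
    rewrite (_ : psum 0 = cst 0); first exact: cst_continuous.
    by apply/funext => x; rewrite /psum big_ord0.
  rewrite (_ : psum n.+1 = psum n \+ (fun x => (1 - q) * q ^+ n * psi n x)).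
    by apply: continuous_add => //; exact: continuousZ.
  by apply/funext => x; rewrite psumS.
move=> x; apply/cvgrPdist_lt => e e0; have e3 : 0 < e / 3 by lra.
have [n qn] : exists n, q ^+ n < e / 3.
  have : \forall n \near \oo, q ^+ n < e / 3 by apply: (cvgr_lt _ cvg_geometric_q).
  by move=> [n _ H]; exists n; apply: H => /=.
have /cvgrPdist_lt /(_ _ e3) := cs n x; apply: filterS => y yn.
have := pseries_dist n x; have := pseries_dist n y; move: yn.
move=> /ltr_normlP[h1 h2] /ler_normlP[h3 h4] /ler_normlP[h5 h6].
by apply/ltr_normlP; split; lra.
Qed.

End geometric_series.

(** * Scaling of Psi *)

Section scale_function.
Context {R : realType}.
Implicit Types (l r betaL beta : R).

Lemma Psi_gt0 betaL beta r : 0 < r -> 0 < Psi betaL beta r.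
Proof. by move=> r0; rewrite /Psi; case: ifP => _; exact: powR_gt0. Qed.

(** On either side of 1 the larger exponent gives the smaller power of l. If l r <= 1 < r, the
    exponent is changed at l r when betaL <= beta and at r otherwise, whichever goes in the right
    direction. *)
Lemma Psi_scale betaL beta l r : 0 < betaL -> 0 < beta -> 0 < l <= 1 -> 0 < r ->
  l `^ (Num.max betaL beta) * Psi betaL beta r <= Psi betaL beta (l * r).
Proof.
move=> bL0 b0 l01 r0; have /andP[l0 l1] := l01; set ga := Num.max _ _.
have gL : betaL <= ga by rewrite le_max lexx.
have gb : beta <= ga by rewrite le_max lexx orbT.
have mono b c p : b <= c -> 0 <= p -> l `^ c * p <= l `^ b * p.
  by move=> bc p0; rewrite ler_wpM2r// ger_powR.
have lr : l * r <= r by rewrite ger_pMl.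
have lr0 : 0 < l * r by rewrite mulr_gt0.
rewrite /Psi; have [r1|r1] := leP r 1.
  by rewrite (le_trans lr r1) powRM ?(ltW l0) ?(ltW r0)//; apply: mono; rewrite ?powR_ge0.
have [lr1|lr1] := leP (l * r) 1; last first.
  by rewrite powRM ?(ltW l0) ?(ltW r0)//; apply: mono; rewrite ?powR_ge0.
have [bb|bb] := leP betaL beta.
  apply: (@le_trans _ _ ((l * r) `^ beta)).
    by rewrite powRM ?(ltW l0) ?(ltW r0)//; apply: mono; rewrite ?powR_ge0.
  by apply: ger_powR => //; rewrite lr0 lr1.
rewrite powRM ?(ltW l0) ?(ltW r0)//.
apply: (le_trans (mono _ _ _ gL (powR_ge0 _ _))).
by rewrite ler_wpM2l ?powR_ge0// ler_powR// ltW.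
Qed.

End scale_function.

(** * Integrals against comparable measures *)

Section integral_comparison.
Context {d : measure_display} {R : realType} {X : measurableType d}.
Implicit Types (nu mu : {measure set X -> \bar R}) (S : set X) (f : X -> \bar R).
Local Open Scope ereal_scope.

Lemma le_measure_integral_on nu mu S (c : R) f : (0 <= c)%R -> measurable S ->
  (forall A, measurable A -> A `<=` S -> nu A <= c%:E * mu A) ->
  (forall x, 0 <= f x) -> measurable_fun setT f ->
  \int[nu]_(x in S) f x <= c%:E * \int[mu]_(x in S) f x.
Proof.
move=> c0 mS le_nu f0 mf.
have -> : \int[nu]_(x in S) f x = \int[mrestr nu mS]_(x in S) f x.
  apply: eq_measure_integral => A mA AS.
  by rewrite -[RHS]/(nu (A `&` S)) setIidl.
have -> : \int[mu]_(x in S) f x = \int[mrestr mu mS]_(x in S) f x.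
  apply: eq_measure_integral => A mA AS.
  by rewrite -[RHS]/(mu (A `&` S)) setIidl.
pose k : {nonneg R} := NngNum c0.
rewrite -[c%:E]/(k%:num%:E) -ge0_integral_mscale//; last exact: measurable_funS mf.
apply: ge0_le_measure_integral => // A mA; rewrite /mscale /mrestr /=.
by apply: le_nu; [exact: measurableI|exact: subIsetr].
Qed.

Lemma integral_piecewise_le (W : nat -> set X) (mu1 mu2 mu3 : {measure set X -> \bar R})
    f (g : X -> \bar R) (a b : R) :
  (forall n, measurable (W n)) -> trivIset setT W ->
  (forall x, 0 <= f x) -> (forall x, 0 <= g x) -> measurable_fun setT f ->
  measurable_fun setT g -> (0 <= a)%R -> (0 <= b)%R ->
  (forall n, \int[mu1]_(x in W n) f x <=
    a%:E * \int[mu2]_(x in W n) g x + b%:E * \int[mu3]_(x in W n) f x) ->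
  \int[mu1]_(x in \bigcup_n W n) f x <=
    a%:E * \int[mu2]_(x in \bigcup_n W n) g x + b%:E * \int[mu3]_(x in \bigcup_n W n) f x.
Proof.
move=> mW tW f0 g0 mf mg a0 b0 H.
have pos (mu : {measure set X -> \bar R}) h n : (forall x, 0 <= h x) ->
  0 <= \int[mu]_(x in W n) h x by move=> h0; apply: integral_ge0.
rewrite !ge0_integral_bigcup//; try by apply: (measurable_funS measurableT).
rewrite -!nneseriesZl; try by move=> n _; exact: pos.
rewrite -nneseriesD; try by move=> n _ _; apply: mule_ge0; rewrite ?lee_fin//; exact: pos.
apply: lee_nneseries => [n _ _|n _]; [exact: pos|exact: H].
Qed.

End integral_comparison.

(** * The series of cutoff functions on concentric annuli *)

Section layers.
Context {d : measure_display} {R : realType} {X : borelMetricType d R}.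
Variable m : {measure set X -> \bar R}.
Variables (F : set (X -> R)) (E : (X -> R) -> (X -> R) -> R).
Hypothesis hlc : locally_compact [set: X].
Hypothesis hrad : radon_measure m.
Hypothesis hsupp : measure_support m = [set: X].
Hypothesis hVD : volume_doubling m.
Hypothesis hE : strongly_local_form m F E.
Implicit Types (f g h : X -> R) (A O : set X) (a b c : R).

Local Notation core := (core F).
Local Notation EM := (energy_measure m F E).
Local Notation LM := (local_energy_measure m F E).
Local Notation locdom := (locally_in_domain m F).
Let hD : dirichlet_form m F E. Proof. by case: hE. Qed.
Let hR : regular_form m F E. Proof. by case: hE. Qed.
Let hS : strongly_local m F E. Proof. by case: hE. Qed.
Let hK := compact_fin hrad.

Lemma sqr_measurable f : measurable_fun setT f ->
  measurable_fun setT (fun x => (f x ^+ 2)%:E).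
Proof. by move=> mf; apply/measurable_EFinP; exact: measurable_funX. Qed.

Let eq_leE (y z : \bar R) : y = z -> (y <= z)%E. Proof. by move=> ->. Qed.

Lemma local_energy_const phi O A b : locdom phi -> (forall x, 0 <= phi x <= 1) ->
  open O -> (forall x, O x -> phi x = b) -> measurable A -> A `<=` O -> LM phi A = 0%E.
Proof.
move=> lphi p01 oO pb mA AO; apply/eqP; rewrite -measure_le0.
have pb' x : O x -> phi x = 0 * phi x + b by move=> /pb ->; rewrite mul0r add0r.
have := local_energy_affine_le hlc hrad hsupp hVD hE lphi lphi p01 p01 oO pb' mA AO.
by rewrite expr0n mul0e.
Qed.

Variables (x0 : X) (rho theta : nat -> R) (phi : nat -> X -> R).
Hypothesis theta0 : forall n, 0 <= theta n.

Definition layer n := ball x0 (rho n.+1) `\` closure (ball x0 (rho n)).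

Hypothesis cphi : forall n, cutoff m F (ball x0 (rho n)) (ball x0 (rho n.+1)) (phi n).
Hypothesis csd : forall n f, F f -> quasi_continuous m F E f ->
  (\int[LM (phi n)]_(x in layer n) (f x ^+ 2)%:E <=
   (8^-1)%:E * \int[EM f]_(x in layer n) (phi n x ^+ 2)%:E +
   (theta n)%:E * \int[m]_(x in layer n) (f x ^+ 2)%:E)%E.

Let psi n := slope4 (phi n).

Lemma phi_cont n : continuous (phi n). Proof. by case: (cphi n). Qed.
Lemma phi_loc n : locdom (phi n). Proof. by case: (cphi n). Qed.
Lemma phi01 n x : 0 <= phi n x <= 1. Proof. by case: (cphi n) => _ _ /(_ x). Qed.

Lemma phi_in n x : closure (ball x0 (rho n)) x -> phi n x = 1.
Proof.
have [cp _ p01 p1 _] := cphi n => clx.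
have : closure [set y | 1 <= phi n y] x.
  by move: clx; apply: closureS => y /p1 /= ->.
rewrite -((closure_id _).1 (closed_ge_cont (a := 1) cp)) /=.
by have := p01 x; lra.
Qed.

Lemma phi_out n x : ~ ball x0 (rho n.+1) x -> phi n x = 0.
Proof. by case: (cphi n) => _ _ _ _; exact. Qed.

Lemma psi_cont n : continuous (psi n).
Proof.
apply: continuousZ; apply: continuous_sub; apply: continuous_clip; exact: phi_cont.
Qed.

Lemma psi01 n x : 0 <= psi n x <= 1. Proof. exact: slope4_01. Qed.

Lemma psi_loc n : locdom (psi n).
Proof. by apply: (locally_slope4 hE); exact: phi_loc. Qed.

Lemma psi_high n x : 3 / 4 < phi n x -> psi n x = 1.
Proof.
rewrite /psi /slope4 /= => h; have p4 : (0 : R) < 4^-1 by lra.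
have p34 : (0 : R) < 3 / 4 by lra.
by case: (clipP (phi n) x p4) => *; case: (clipP (phi n) x p34) => *; lra.
Qed.

Lemma psi_low n x : phi n x < 4^-1 -> psi n x = 0.
Proof.
rewrite /psi /slope4 /= => h; have p4 : (0 : R) < 4^-1 by lra.
have p34 : (0 : R) < 3 / 4 by lra.
by case: (clipP (phi n) x p4) => *; case: (clipP (phi n) x p34) => *; lra.
Qed.

Lemma layer_measurable n : measurable (layer n).
Proof.
apply: measurableD; first exact/open_borel/open_mball.
exact/closed_borel/closed_closure.
Qed.

(** Off the layer phi n is 1 or 0, so A is covered by the open sets {phi n > 3/4} and {phi n < 1/4};
    psi n is constant on each of them. *)
Lemma psi_outside n A : measurable A -> (forall x, A x -> ~ layer n x) -> LM (psi n) A = 0%E.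
Proof.
move=> mA Al; have oh := open_gt_cont (3 / 4) (@phi_cont n).
have ol := open_lt_cont 4^-1 (@phi_cont n).
have AE : A = (A `&` [set x | 3 / 4 < phi n x]) `|` (A `&` [set x | phi n x < 4^-1]).
  rewrite -setIUr; apply/esym/setIidl => x /Al; rewrite /layer => nl /=.
  have [/phi_in ->|nclx] := pselect (closure (ball x0 (rho n)) x); first by left; lra.
  have [bx|/phi_out ->] := pselect (ball x0 (rho n.+1) x); last by right; lra.
  by exfalso; apply: nl.
apply/eqP; rewrite -measure_le0 AE.
have mh := measurableI _ _ mA (open_borel oh); have ml := measurableI _ _ mA (open_borel ol).
have h0 := local_energy_const (@psi_loc n) (@psi01 n) oh (@psi_high n) mh (@subIsetr _ _ _).
have l0 := local_energy_const (@psi_loc n) (@psi01 n) ol (@psi_low n) ml (@subIsetr _ _ _).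
apply: (le_trans (measureU2 _ mh ml)).
by rewrite -[leRHS]adde0; apply: leeD; [exact: eq_leE h0|exact: eq_leE l0].
Qed.

Lemma psi_slope n A : measurable A -> (LM (psi n) A <= 4%:E * LM (phi n) A)%E.
Proof.
by apply: (local_energy_slope4_le hlc hrad hsupp hVD hE); [exact: phi_loc|exact: phi01].
Qed.

(** The estimate [csd] with f = k, which is 1 on A, bounds the energy of phi n inside the layer;
    outside it psi n has none. The dependence on n is affine in theta n. *)
Lemma psi_mass n A k : measurable A -> core k -> (forall x, A x -> k x = 1) ->
  (LM (psi n) A <=
   (4 * (8^-1 * (2 * enorm E k) ^+ 2 + theta n * sqn m k))%:E)%E.
Proof.
move=> mA ck k1; have mU := layer_measurable n; have Fk := core_dom ck.
have mk := sqr_measurable (dom_measurable hD Fk).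
have mAU := measurableI _ _ mA mU; have splitA : LM (psi n) A =
  (LM (psi n) (A `\` layer n) + LM (psi n) (A `&` layer n))%E by exact: measureDI.
rewrite splitA (psi_outside (measurableD mA mU)); last by move=> x [].
rewrite add0e EFinM; apply: (le_trans (psi_slope n (measurableI _ _ mA mU))).
rewrite lee_wpmul2l// ?lee_fin//.
apply: (@le_trans _ _ (\int[LM (phi n)]_(x in layer n) (k x ^+ 2)%:E)%E).
  rewrite -[leLHS]mul1e -integral_cst//.
  apply: (@le_trans _ _ (\int[LM (phi n)]_(x in A `&` layer n) (k x ^+ 2)%:E)%E).
    apply: ge0_le_integral => //.
    - exact: measurable_funS mk.
    - by move=> x [/k1 -> _]; rewrite expr1n.
  apply: ge0_subset_integral => //.
  - exact: measurable_funS mk.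
  - by move=> x _; rewrite lee_fin sqr_ge0.
apply: (le_trans (csd n Fk (continuous_quasi hD (core_cont ck)))).
rewrite EFinD !EFinM; apply: leeD; apply: lee_wpmul2l; rewrite ?lee_fin ?invr_ge0//.
  apply: (@le_trans _ _ (EM k (layer n))).
    rewrite -[leRHS]mul1e -integral_cst//; apply: ge0_le_integral => //.
    - by move=> x _; rewrite lee_fin sqr_ge0.
    - by apply: measurable_funS (sqr_measurable (measurable_continuous (@phi_cont n))).
    - by move=> x _; rewrite lee_fin /=; have /andP[h0 h1] := phi01 n x; rewrite exprn_ile1.
  apply: le_trans (energy_measure_fin hD hR hS hlc hrad hsupp hVD Fk).
  by apply: le_measure; rewrite ?inE.
apply: (@le_trans _ _ (\int[m]_x (k x ^+ 2)%:E)%E).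
  by apply: ge0_subset_integral => // x _; rewrite lee_fin sqr_ge0.
have [_ ik] := dom_sqint hD Fk.
by rewrite /sqn /Rintegral fineK//; exact: integrable_fin_num.
Qed.

(** By [form_mul_le] it suffices to bound the energy measure of psi n on {chi != 0}, which is
    [psi_mass]. The constant K depends on chi only. *)
Lemma psi_mul_bound chi : core chi -> (forall x, 0 <= chi x <= 1) ->
  exists2 K, 0 <= K & forall n, F (chi \* psi n) /\
    E (chi \* psi n) (chi \* psi n) <= K * (1 + theta n).
Proof.
move=> cc c01; have [_ [_ suppc]] := cc.
have [k [ck _ k1]] := core_one hD hR hlc suppc.
pose K := (2 * enorm E k) ^+ 2 + 8 * sqn m k + 2 * E chi chi.
have e0 : 0 <= E chi chi := dirichlet_ge0 hD (core_dom cc).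
have s0 := sqn_ge0 m k; have n0 := sqr_ge0 (2 * enorm E k).
exists K; first by rewrite /K; lra.
move=> n; set G := [set x | chi x != 0].
have oG : open G := open_neq0_cont (core_cont cc).
have pG : precompact G by rewrite precompactE.
have [h [bh h01 ph]] := locally_bdom hE (@psi_loc n) (@psi01 n) oG pG.
have Fh := bdom_dom bh; have bch := bdomM hD (core_bdom cc) bh.
have mp : measurable_fun setT (chi \* psi n).
  apply: measurable_funM; first exact: (core_measurable hD).
  exact/measurable_continuous/psi_cont.
have ch : {ae m, forall x, (chi \* h) x = (chi \* psi n) x}.
  apply: filterS ph => x px /=; have [->|/px ->//] := eqVneq (chi x) 0.
  by rewrite !mul0r.
have [Fc _] := dirichlet_ae hD (bdom_dom bch) mp ch; split=> //.
rewrite -(form_ae2 hD (bdom_dom bch) mp ch).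
apply: (le_trans (form_mul_le hD hR hS hlc hK bh cc h01 c01)).
have chK : carre E h chi <= 4 * (8^-1 * (2 * enorm E k) ^+ 2 + theta n * sqn m k).
  have [_ Ih] := energy_measure_boundedP hD hR hS hlc hrad hsupp hVD bh.
  have finh := energy_bounded_finite hD hR hS hlc hrad hsupp hVD bh.
  rewrite -lee_fin -Ih// -(intf_fin hD finh cc).
  have mG := open_borel oG.
  have GM : (LM (psi n) G <= (4 * (8^-1 * (2 * enorm E k) ^+ 2 + theta n * sqn m k))%:E)%E.
    apply: psi_mass => // x Gx; apply: k1; exact: subset_closure.
  apply: le_trans GM.
  rewrite (local_energy_measureP hlc hrad hsupp hVD hE (@psi_loc n) oG pG Fh ph)//.
  rewrite (energy_measure_bdom hD hR hS hlc hrad hsupp hVD bh)//.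
  have <- : (\int[energy_measure_bounded m F E h]_x (\1_G x : R)%:E =
      energy_measure_bounded m F E h G)%E by rewrite integral_indic// setIT.
  apply: ge0_le_integral => //.
  - by move=> x _; rewrite lee_fin; have /andP[] := c01 x.
  - by apply/measurable_EFinP; exact: (core_measurable hD).
  - by apply/measurable_EFinP; exact: measurable_indic.
  - move=> x _; rewrite lee_fin indicE; have [Gx|nG] := pselect (G x).
      by rewrite mem_set//; have /andP[] := c01 x.
    by rewrite memNset//=; move/negP: nG; rewrite negbK => /eqP ->.
have := theta0 n; have := mulr_ge0 (theta0 n) n0; have := mulr_ge0 (theta0 n) e0.
have := mulr_ge0 (theta0 n) s0.
have -> : K * (1 + theta n) = K + (theta n * (2 * enorm E k) ^+ 2 +
  8 * (theta n * sqn m k) + 2 * (theta n * E chi chi)) by rewrite /K; ring.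
by rewrite /K; lra.
Qed.

Variables (q D : R).
Hypothesis q01 : 0 < q < 1.
Hypothesis thetaD : forall n, ((1 - q) * q ^+ n) ^+ 2 * theta n <= D * q ^+ n.

Let D0 : 0 <= D.
Proof.
  have := thetaD 0; have := mulr_ge0 (sqr_ge0 ((1 - q) * q ^+ 0)) (theta0 0).
  by rewrite expr0 !mulr1; lra.
Qed.

Let qpos n : 0 < q ^+ n := geometric_gt0 q01 n.
Let Phi := pseries q psi.

Lemma Phi_cont : continuous Phi.
Proof. by apply: (pseries_continuous q01 psi01); exact: psi_cont. Qed.

Lemma Phi01 x : 0 <= Phi x <= 1.
Proof. exact: (pseries01 q01 psi01). Qed.

(** The squared weight, of order q^(2n), multiplied by 1 + theta n leaves O(q^n) by [thetaD]; the
    norms of the terms are therefore summable with ratio sqrt q. *)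
Lemma psi_term_bound chi : core chi -> (forall x, 0 <= chi x <= 1) ->
  exists2 L, 0 <= L & forall n, F (chi \* psi n) /\
    enorm E (fun x => (1 - q) * q ^+ n * (chi \* psi n) x) <= L * Num.sqrt q ^+ n.
Proof.
move=> cc c01; have [K K0 hK'] := psi_mul_bound cc c01.
have /andP[q0 q1] := q01.
exists (Num.sqrt (K * (1 + D))); first exact: sqrtr_ge0.
move=> n; have [Fn En] := hK' n; split=> //.
apply: enorm_le; first by rewrite mulr_ge0 ?sqrtr_ge0// exprn_ge0// sqrtr_ge0.
rewrite (formZ2 hD _ Fn) [leRHS]exprMn sqr_sqrtr; last by rewrite mulr_ge0// addr_ge0.
rewrite -exprM mulnC exprM sqr_sqrtr ?(ltW q0)//.
have qn := qpos n; have qn1 : q ^+ n <= 1 by apply: exprn_ile1; rewrite ?ltW.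
have c0 := sqr_ge0 ((1 - q) * q ^+ n).
apply: (le_trans (ler_wpM2l c0 En)).
have cq : ((1 - q) * q ^+ n) ^+ 2 <= q ^+ n.
  rewrite expr2; have : (1 - q) * q ^+ n <= 1 by nra.
  have : (1 - q) * q ^+ n <= q ^+ n by nra.
  have : 0 <= (1 - q) * q ^+ n by nra.
  by nra.
have -> : K * (1 + D) * q ^+ n = K * (q ^+ n + D * q ^+ n) by ring.
rewrite mulrCA mulrDr mulr1; exact: (ler_wpM2l K0 (lerD cq (thetaD n))).
Qed.

Lemma Phi_loc : locdom Phi.
Proof.
have /andP[q0 q1] := q01.
move=> G oG; rewrite precompactE => cG.
have [chi [cc c01 c1]] := core_one hD hR hlc cG.
have Fc := core_dom cc; have mc := dom_measurable hD Fc.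
exists (chi \* Phi); last first.
  by apply: aeW => x Gx /=; rewrite c1 ?mul1r//; exact: subset_closure.
have [L L0 termL] := psi_term_bound cc c01.
pose u n := chi \* psum q psi n.
pose v n x := (1 - q) * q ^+ n * (chi \* psi n) x.
have uS n : u n.+1 = u n \+ v n.
  by apply/funext => x; rewrite /u /v /= psumS mulrDr mulrCA.
have Fv n : F (v n) by apply: (domZ hD); have [] := termL n.
have Fu n : F (u n).
  elim: n => [|n IH]; last by rewrite uS; exact: (domD hD).
  rewrite (_ : u 0 = cst 0); first exact: dirichlet0 hD.
  by apply/funext => x; rewrite /u /psum /= big_ord0 mulr0.
pose p := Num.sqrt q; have p0 : 0 < p by rewrite sqrtr_gt0.
have p1 : p < 1 by rewrite -[ltRHS]sqrtr1 ltr_sqrt.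
have p1' : 0 < 1 - p by lra.
have pn n : 0 < p ^+ n by exact: exprn_gt0.
have tail n j : enorm E (u n \- u (n + j)%N) <= L / (1 - p) * (p ^+ n - p ^+ (n + j)).
  elim: j => [|j IH].
    rewrite addn0 subrr mulr0 (_ : u n \- u n = (fun x => 0 * u n x)).
      by rewrite (enormZ hD)// normr0 mul0r.
    by apply/funext => x /=; rewrite subrr mul0r.
  have -> : u n \- u (n + j.+1)%N = (u n \- u (n + j)%N) \- v (n + j)%N.
    by rewrite addnS uS; apply/funext => x /=; ring.
  apply: le_trans (enormB hD (domB hD (Fu _) (Fu _)) (Fv _)) _.
  have [_ vL] := termL (n + j)%N; apply: (le_trans (lerD IH vL)).
  rewrite le_eqVlt; apply/orP; left; apply/eqP.
  by rewrite addnS exprS -/p; field; rewrite gt_eqF.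
have mPhi : measurable_fun setT (chi \* Phi).
  by apply: measurable_funM => //; exact/measurable_continuous/Phi_cont.
have sPhi : sqint m (chi \* Phi).
  apply: sqint_le mPhi _ (dom_sqint hD Fc) => x /=; rewrite normrM ler_piMr//.
  by have /andP[h0 h1] := Phi01 x; rewrite ger0_norm.
suff [] : F (chi \* Phi) /\ enorm E (u n \- (chi \* Phi)) @[n --> \oo] --> 0 by [].
apply: (form_closed_tail hD (b := fun n => L / (1 - p) * p ^+ n) Fu sPhi).
- move=> n k; apply: (le_trans (tail n k)); rewrite ler_wpM2l//.
    by rewrite divr_ge0// ltW.
  by have := pn (n + k)%N; lra.
- by apply: cvg0Z; apply: cvg_geometric_q; rewrite p0.
have small n : `|sqn m (u n \- (chi \* Phi))| <= sqn m chi * q ^+ n.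
  rewrite ger0_norm ?sqn_ge0//.
  apply: (@le_trans _ _ (sqn m (fun x => q ^+ n * chi x))).
    apply: sqn_le.
    - by apply: sqintZ; exact: (dom_sqint hD).
    - by apply: measurable_funB => //; exact: (dom_measurable hD).
    - move=> x; rewrite /u /= -mulrBr normrM [leRHS]normrM mulrC ler_wpM2r//.
      rewrite [leRHS]gtr0_norm//; exact: (pseries_dist q01 psi01).
  rewrite (sqnZ _ (dom_sqint hD Fc)) mulrC ler_wpM2l ?sqn_ge0// expr2 ler_piMl//.
    exact: ltW.
  by apply: exprn_ile1; exact: ltW.
by apply: (cvg0_le small); apply: cvg0Z; exact: cvg_geometric_q q01.
Qed.

Hypothesis rhoS : forall n, rho n <= rho n.+1.

Lemma rho_le k n : (k <= n)%N -> rho k <= rho n.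
Proof.
move=> /subnKC <-; elim: (n - k)%N => [|j IH]; first by rewrite addn0.
by rewrite addnS; exact: le_trans (rhoS _).
Qed.

Lemma rho_ball k n : (k <= n)%N -> ball x0 (rho k) `<=` ball x0 (rho n).
Proof. by move=> kn; exact: le_ball (rho_le kn). Qed.

(* On this open neighbourhood of the n-th shell all the psi k but psi n are
   constant. *)
Definition region n : set X := ball x0 (rho n.+1) `&`
  (if n is k.+1 then [set x | phi k x < 4^-1] else setT).

Lemma region_open n : open (region n).
Proof.
apply: openI; first exact: open_mball.
by case: n => [|k]; [exact: openT|apply: open_lt_cont; exact: phi_cont].
Qed.

Lemma phi_ball n x : ball x0 (rho n) x -> phi n x = 1.
Proof. by move=> bx; apply: phi_in; exact: subset_closure. Qed.

Lemma psi_past n k x : region n x -> (k < n)%N -> psi k x = 0.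
Proof.
case: n => // n [_ /= xn]; rewrite ltnS => kn; apply: psi_low.
move: kn; rewrite leq_eqVlt => /predU1P[->//|kn]; have nb : ~ ball x0 (rho k.+1) x.
  by move=> bx; move: xn; rewrite (phi_ball (rho_ball kn bx)); lra.
by rewrite (phi_out nb); lra.
Qed.

Lemma psi_future n k x : ball x0 (rho n.+1) x -> (n < k)%N -> psi k x = 1.
Proof.
move=> bx nk; have p1 := phi_ball (rho_ball nk bx).
by apply: psi_high; rewrite p1; lra.
Qed.

Lemma Phi_region n x : region n x -> Phi x = (1 - q) * q ^+ n * psi n x + q ^+ n.+1.
Proof.
move=> rx; apply: (pseries_eq q01 psi01) => k; first exact: psi_past.
by apply: psi_future; case: rx.
Qed.

Lemma Phi_inner x : ball x0 (rho 0) x -> Phi x = 1.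
Proof.
move=> bx; rewrite (@Phi_region 0); first last.
  by split=> //; apply: (rho_ball (k := 0)).
rewrite psi_high; last by rewrite phi_ball//; lra.
by rewrite expr0 expr1; lra.
Qed.

Lemma Phi_outer x : (forall n, ~ ball x0 (rho n) x) -> Phi x = 0.
Proof.
move=> nx; apply: (pseries_eq0 q01 psi01) => k; apply: psi_low.
by rewrite phi_out//; lra.
Qed.

Definition shell n := ball x0 (rho n.+1) `\` ball x0 (rho n).

Lemma shell_region n : shell n `<=` region n.
Proof.
move=> x [bx nx]; split=> //; case: n nx bx => // n nx bx /=.
by rewrite phi_out//; lra.
Qed.

Lemma shell_measurable n : measurable (shell n).
Proof. by apply: measurableD; exact/open_borel/open_mball. Qed.

Lemma layer_shell n : layer n `<=` shell n.
Proof. by move=> x [bx nx]; split=> // h; apply: nx; exact: subset_closure. Qed.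

Lemma shell_trivIset : trivIset setT shell.
Proof.
apply: ltn_trivIset => i j ij; apply/seteqP; split=> // x [[bx _] [_ nx]].
by apply: nx; exact: rho_ball bx.
Qed.

Lemma Phi_layer n A : measurable A -> A `<=` layer n ->
  (LM Phi A <= (4 * ((1 - q) * q ^+ n) ^+ 2)%:E * LM (phi n) A)%E.
Proof.
move=> mA AL.
have AO : A `<=` region n by apply: subset_trans AL _ => x /layer_shell/shell_region.
apply: (@le_trans _ _ ((((1 - q) * q ^+ n) ^+ 2)%:E * LM (psi n) A)%E).
  exact: (local_energy_affine_le hlc hrad hsupp hVD hE Phi_loc (@psi_loc n)
    Phi01 (@psi01 n) (@region_open n) (@Phi_region n) mA AO).
set c := ((1 - q) * q ^+ n) ^+ 2.
have -> : (4 * c)%:E = (c%:E * 4%:E)%E by rewrite -EFinM mulrC.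
rewrite -muleA; apply: lee_wpmul2l; first by rewrite lee_fin sqr_ge0.
exact: psi_slope.
Qed.

(** The part of the shell outside the layer lies in the closure of the inner ball, where phi n = 1.
    Hence psi n, and with it Phi, is constant on an open neighbourhood of that part. *)
Lemma Phi_null n A : measurable A -> A `<=` shell n -> (forall x, A x -> ~ layer n x) ->
  LM Phi A = 0%E.
Proof.
move=> mA AS AL.
have oO := openI (@region_open n) (open_gt_cont (3 / 4) (@phi_cont n)).
apply: (local_energy_const Phi_loc Phi01 oO (b := (1 - q) * q ^+ n + q ^+ n.+1)) => //.
  by move=> x [/Phi_region -> /psi_high ->]; rewrite mulr1.
move=> x Ax; split; first exact/shell_region/AS.
have := AL x Ax; have [bx _] := AS x Ax; rewrite /layer /=.
have [/phi_in ->|ncl] := pselect (closure (ball x0 (rho n)) x); first by lra.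
by move=> nl; exfalso; apply: nl.
Qed.

Variables (E' : (X -> R) -> (X -> R) -> R) (C : R).
Hypothesis hE' : strongly_local_form m F E'.
Hypothesis C0 : 0 <= C.
Hypothesis hC : forall u, F u -> E u u <= C * E' u u.
Hypothesis hC' : forall u, F u -> E' u u <= C * E u u.
Hypothesis qC : 4 * C ^+ 2 * (1 - q) ^+ 2 <= q ^+ 2.

Local Notation EM' := (energy_measure m F E').
Local Notation LM' := (local_energy_measure m F E').

Lemma layer_estimate n f : F f -> quasi_continuous m F E f ->
  (\int[LM' Phi]_(x in layer n) (f x ^+ 2)%:E <=
   (8^-1)%:E * \int[EM' f]_(x in layer n) (Phi x ^+ 2)%:E +
   (4 * C * D)%:E * \int[m]_(x in layer n) (f x ^+ 2)%:E)%E.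
Proof.
move=> Ff qf; have mL := layer_measurable n; have qn := qpos n; have qn1 := qpos n.+1.
have /andP[q0 q1] := q01.
have mf := sqr_measurable (dom_measurable hD Ff).
have mphi := sqr_measurable (measurable_continuous (@phi_cont n)).
have mPhi := sqr_measurable (measurable_continuous Phi_cont).
have sq0 (g : X -> R) x : (0 <= (g x ^+ 2)%:E)%E by rewrite lee_fin sqr_ge0.
(* C compares the local energy measures of the two forms, 4 comes from the steepening, and the last
   factor is the squared weight of psi n in Phi. A second C enters below when the energy measure of
   f is compared. *)
pose a := 4 * C * ((1 - q) * q ^+ n) ^+ 2.
have a0 : 0 <= a by apply: mulr_ge0; [apply: mulr_ge0|exact: sqr_ge0].
apply: (@le_trans _ _ (a%:E * \int[LM (phi n)]_(x in layer n) (f x ^+ 2)%:E)%E).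
  apply: (le_measure_integral_on a0 mL) => // A mA AL.
  apply: (le_trans (local_energy_measure_comparison hlc hrad hsupp hVD hE' hE C0 hC' Phi_loc mA)).
  have -> : (a%:E = C%:E * (4 * ((1 - q) * q ^+ n) ^+ 2)%:E)%E.
    by rewrite -EFinM; congr (_%:E); rewrite /a; ring.
  by rewrite -muleA; apply: lee_wpmul2l; [rewrite lee_fin|exact: Phi_layer].
have csda : (a%:E * \int[LM (phi n)]_(x in layer n) (f x ^+ 2)%:E <= a%:E *
    ((8^-1)%:E * \int[EM f]_(x in layer n) (phi n x ^+ 2)%:E +
     (theta n)%:E * \int[m]_(x in layer n) (f x ^+ 2)%:E))%E.
  by apply: lee_wpmul2l; rewrite ?lee_fin//; exact: csd.
apply: (le_trans csda).
have step : (\int[EM f]_(x in layer n) (phi n x ^+ 2)%:E <=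
    (C * (q ^+ n.+1) ^- 2)%:E * \int[EM' f]_(x in layer n) (Phi x ^+ 2)%:E)%E.
  apply: (@le_trans _ _ (C%:E * \int[EM' f]_(x in layer n) (phi n x ^+ 2)%:E)%E).
    apply: (le_measure_integral_on C0 mL) => // A mA _.
    exact: (energy_measure_comparison hlc hrad hsupp hVD hE hE' C0 hC).
  rewrite EFinM -muleA lee_wpmul2l ?lee_fin//.
  rewrite -ge0_integralZl//; last 2 first.
  - exact: measurable_funS mPhi.
  - by rewrite lee_fin invr_ge0 sqr_ge0.
  apply: ge0_le_integral => //.
  - exact: measurable_funS mphi.
  - by apply: measurable_funeM; exact: measurable_funS mPhi.
  move=> x /layer_shell/shell_region/Phi_region PE.
  rewrite -EFinM lee_fin mulrC ler_pdivlMr ?exprn_gt0//.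
  have /andP[h0 h1] := phi01 n x; have /andP[k0 k1] := psi01 n x.
  have Pq : q ^+ n.+1 <= Phi x by rewrite PE lerDr mulr_ge0// mulr_ge0 ?ltW//; lra.
  apply: (@le_trans _ _ ((q ^+ n.+1) ^+ 2)).
    by rewrite ler_piMl ?sqr_ge0// exprn_ile1.
  by rewrite ler_sqr ?nnegrE// ?(ltW qn1)//; apply: le_trans Pq; exact: ltW.
have J0 (mu : {measure set X -> \bar R}) (g : X -> R) :
  (0 <= \int[mu]_(x in layer n) (g x ^+ 2)%:E)%E by apply: integral_ge0.
have i8 : (0 <= (8^-1)%:E :> \bar R)%E by rewrite lee_fin invr_ge0.
have t0 : (0 <= (theta n)%:E)%E by rewrite lee_fin.
rewrite ge0_muleDr; [|by apply: mule_ge0|by apply: mule_ge0].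
apply: leeD.
  rewrite muleCA; apply: lee_wpmul2l => //.
  apply: (@le_trans _ _ (a%:E * ((C * (q ^+ n.+1) ^- 2)%:E *
      \int[EM' f]_(x in layer n) (Phi x ^+ 2)%:E))%E).
    by apply: lee_wpmul2l; rewrite ?lee_fin.
  rewrite muleA -EFinM -[leRHS]mul1e; apply: lee_wpmul2r => //; rewrite lee_fin.
  have -> : a * (C * (q ^+ n.+1) ^- 2) = 4 * C ^+ 2 * (1 - q) ^+ 2 / q ^+ 2.
    by rewrite /a (exprS q n); field; rewrite !gt_eqF.
  by rewrite ler_pdivrMr ?exprn_gt0// mul1r.
rewrite muleA -EFinM; apply: lee_wpmul2r => //; rewrite lee_fin.
rewrite /a -[_ * theta n]mulrA; apply: ler_wpM2l; first by rewrite mulr_ge0.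
apply: (le_trans (thetaD n)); rewrite -[leRHS]mulr1; apply: ler_wpM2l => //.
by apply: exprn_ile1; exact: ltW.
Qed.

(** The closure of the innermost ball is removed so that these sets partition the open set over
    which CSD integrates; only n = 0 loses an inner boundary of its own. *)
Definition annulus n := shell n `\` closure (ball x0 (rho 0)).

Lemma annulus_measurable n : measurable (annulus n).
Proof.
by apply: measurableD; [exact: shell_measurable|exact/closed_borel/closed_closure].
Qed.

Lemma layer_annulus n : layer n `<=` annulus n.
Proof.
move=> x lx; split; first exact: layer_shell.
by case: lx => _ nx h; apply: nx; move: h; apply: closureS; exact: rho_ball.
Qed.

Lemma annulus_estimate n f : F f -> quasi_continuous m F E f ->
  (\int[LM' Phi]_(x in annulus n) (f x ^+ 2)%:E <=
   (8^-1)%:E * \int[EM' f]_(x in annulus n) (Phi x ^+ 2)%:E +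
   (4 * C * D)%:E * \int[m]_(x in annulus n) (f x ^+ 2)%:E)%E.
Proof.
move=> Ff qf; have mL := layer_measurable n; have mW := annulus_measurable n.
have mf := sqr_measurable (dom_measurable hD Ff).
have mPhi := sqr_measurable (measurable_continuous Phi_cont).
have sq0 (g : X -> R) x : (0 <= (g x ^+ 2)%:E)%E by rewrite lee_fin sqr_ge0.
have mR := measurableD mW mL.
have WE : annulus n = layer n `|` (annulus n `\` layer n).
  by rewrite setDE setUIr setUv setIT; apply/esym/setUidr; exact: layer_annulus.
rewrite [in leLHS]WE ge0_integral_setU//; last 2 first.
- exact: measurable_funS mf.
- by apply/disj_set2P; rewrite setDE setICA setICr setI0.
have rest : (\int[LM' Phi]_(x in annulus n `\` layer n) (f x ^+ 2)%:E <= 0)%E.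
  rewrite -[leRHS](mul0e (\int[LM Phi]_(x in annulus n `\` layer n) (f x ^+ 2)%:E)%E).
  apply: le_measure_integral_on => // A mA AR; rewrite mul0e.
  apply: (le_trans (local_energy_measure_comparison hlc hrad hsupp hVD hE' hE C0 hC' Phi_loc mA)).
  rewrite (@Phi_null n)// ?mule0//; first by move=> x /AR[[]].
  by move=> x /AR[].
rewrite -[leRHS]adde0; apply: leeD => //.
apply: (le_trans (layer_estimate n Ff qf)); have lW := @layer_annulus n.
apply: leeD; apply: lee_wpmul2l; rewrite ?lee_fin ?invr_ge0 ?mulr_ge0//.
  by apply: ge0_subset_integral => //; exact: measurable_funS mPhi.
by apply: ge0_subset_integral => //; exact: measurable_funS mf.
Qed.

Lemma annuli_estimate f : F f -> quasi_continuous m F E f ->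
  (\int[LM' Phi]_(x in \bigcup_n annulus n) (f x ^+ 2)%:E <=
   (8^-1)%:E * \int[EM' f]_(x in \bigcup_n annulus n) (Phi x ^+ 2)%:E +
   (4 * C * D)%:E * \int[m]_(x in \bigcup_n annulus n) (f x ^+ 2)%:E)%E.
Proof.
move=> Ff qf; have sq0 (g : X -> R) x : (0 <= (g x ^+ 2)%:E)%E by rewrite lee_fin sqr_ge0.
apply: integral_piecewise_le => //.
- exact: annulus_measurable.
- rewrite /annulus; under eq_fun do rewrite setDE; apply: trivIset_setIr.
  exact: shell_trivIset.
- exact: sqr_measurable (dom_measurable hD Ff).
- exact: sqr_measurable (measurable_continuous Phi_cont).
- by rewrite !mulr_ge0.
- by move=> n; exact: annulus_estimate.
Qed.

End layers.

(** * Transfer of CSA between comparable forms *)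

Section stability.
Context {d : measure_display} {R : realType} {X : borelMetricType d R}.
Variable m : {measure set X -> \bar R}.
Variables (F : set (X -> R)) (E E' : (X -> R) -> (X -> R) -> R) (C betaL beta : R).
Hypothesis hlc : locally_compact [set: X].
Hypothesis hrad : radon_measure m.
Hypothesis hsupp : measure_support m = [set: X].
Hypothesis hVD : volume_doubling m.
Hypothesis hE : strongly_local_form m F E.
Hypothesis hE' : strongly_local_form m F E'.
Hypothesis C1 : 1 <= C.
Hypothesis hC : forall u, F u -> E u u <= C * E' u u.
Hypothesis hC' : forall u, F u -> E' u u <= C * E u u.
Hypothesis bL : 2 <= betaL.
Hypothesis b2 : 2 <= beta.

Lemma CSA_transfer : CSA m F E (Psi betaL beta) -> CSA m F E' (Psi betaL beta).
Proof.
move=> [CS CS0 H]; have C1' := C1; have bL' := bL; have b2' := b2; have C0 : 0 < C := lt_le_trans ltr01 C1.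
have C2 : 0 < 1 + 2 * C by lra.
(* This q solves 2 C (1 - q) = q, so that the new coefficient of the energy term is again exactly
   1/8. *)
pose q := 2 * C / (1 + 2 * C).
have q0 : 0 < q by rewrite divr_gt0// mulr_gt0.
have q1 : q < 1 by rewrite /q ltr_pdivrMr// mul1r ltrDr.
have qC : 4 * C ^+ 2 * (1 - q) ^+ 2 <= q ^+ 2.
  by rewrite le_eqVlt; apply/orP; left; apply/eqP; rewrite /q; field; rewrite gt_eqF.
clearbody q.
have q01 : 0 < q < 1 by rewrite q0.
pose ga := Num.max betaL beta.
have ga0 : 0 < ga by rewrite lt_max; apply/orP; left; lra.
pose t := q `^ ga^-1.
have t0 : 0 < t by exact: powR_gt0.
have tq : t `^ ga = q by rewrite /t -powRrM mulVf ?gt_eqF// powRr1// ltW.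
have t1 : t < 1.
  rewrite ltNge; apply/negP => t1; have : 1 `^ ga <= t `^ ga.
    by apply: ge0_ler_powR; rewrite ?nnegrE// ltW.
  by rewrite tq powR1; lra.
clearbody t; have t01 : 0 < t < 1 by rewrite t0.
have tn n := geometric_gt0 t01 n.
have T0 : 0 < (1 - t) `^ ga by rewrite powR_gt0// subr_gt0.
(* This is 4 C D Psi(r) for the D introduced below, hence independent of r. *)
exists (4 * C * (CS * (1 - q) ^+ 2 / (1 - t) `^ ga)).
  by rewrite !mulr_gt0 ?invr_gt0 ?exprn_gt0 ?subr_gt0.
move=> x rho0 r rho00 r0; have P0 := Psi_gt0 betaL beta r0.
(* The widths s n form a geometric series of sum r, so rho n increases from rho0 towards rho0 +
   r. *)
pose s n := r * ((1 - t) * t ^+ n); pose rho n := rho0 + r * (1 - t ^+ n).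
have lam n : 0 < (1 - t) * t ^+ n <= 1.
  rewrite mulr_gt0 ?subr_gt0//=.
  have tn1 : t ^+ n <= 1 by apply: exprn_ile1; exact: ltW.
  by apply: le_trans tn1; rewrite ler_piMl ?(ltW (tn n))//; lra.
have s0 n : 0 < s n by rewrite mulr_gt0//; case/andP: (lam n).
have rhoE n : rho n.+1 = rho n + s n by rewrite /rho /s exprS; ring.
have rhoS n : rho n <= rho n.+1 by rewrite rhoE lerDl ltW.
have rho_0 : rho 0 = rho0 by rewrite /rho expr0 subrr mulr0 addr0.
have rhop n : 0 < rho n.
  apply: ltr_wpDr => //; apply: mulr_ge0; first exact: ltW.
  by rewrite subr_ge0; apply: exprn_ile1; exact: ltW.
have rhor n : rho n <= rho0 + r.
  by rewrite /rho lerD2l -[leRHS]mulr1 ler_wpM2l ?(ltW r0)//; have := tn n; lra.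
pose theta n := CS * (Psi betaL beta (s n))^-1.
have theta0 n : 0 <= theta n.
  by apply: mulr_ge0; [exact: ltW|rewrite invr_ge0 ltW// Psi_gt0].
have Hn n : exists phi, cutoff m F (ball x (rho n)) (ball x (rho n.+1)) phi /\
    forall f, F f -> quasi_continuous m F E f ->
      (\int[local_energy_measure m F E phi]_(y in layer x rho n) (f y ^+ 2)%:E <=
       (8^-1)%:E * \int[energy_measure m F E f]_(y in layer x rho n) (phi y ^+ 2)%:E +
       (theta n)%:E * \int[m]_(y in layer x rho n) (f y ^+ 2)%:E)%E.
  have [phi cphi csd] := H x (rho n) (s n) (rhop n) (s0 n).
  by exists phi; rewrite /layer rhoE; split.
have [phi /all_and2[cphi csd]] := choice Hn.
(* By [Psi_scale] and (t^n)^ga = q^n, theta n is at most CS / ((1 - t)^ga q^n Psi(r)); the squared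
   weight (1 - q)^2 q^(2n) turns this into D q^n. *)
pose D := CS * (1 - q) ^+ 2 / ((1 - t) `^ ga * Psi betaL beta r).
have thetaD n : ((1 - q) * q ^+ n) ^+ 2 * theta n <= D * q ^+ n.
  have qn := geometric_gt0 q01 n; have b0 : 0 < betaL by lra.
  have b0' : 0 < beta by lra.
  have := Psi_scale b0 b0' (lam n) r0; rewrite -/ga mulrC.
  rewrite powRM; [|by rewrite subr_ge0 ltW|exact: ltW].
  have -> : (t ^+ n) `^ ga = q ^+ n.
    by rewrite -powR_mulrn ?(ltW t0)// powRAC tq powR_mulrn// ltW.
  rewrite [_ * r]mulrC -/(s n) => sP.
  have p0 : 0 < Psi betaL beta r * ((1 - t) `^ ga * q ^+ n) by rewrite !mulr_gt0.
  apply: (@le_trans _ _ (((1 - q) * q ^+ n) ^+ 2 *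
      (CS * (Psi betaL beta r * ((1 - t) `^ ga * q ^+ n))^-1))).
    apply: ler_wpM2l; first exact: sqr_ge0.
    apply: ler_wpM2l; first exact: ltW.
    by rewrite lef_pV2// posrE// Psi_gt0.
  rewrite le_eqVlt; apply/orP; left; apply/eqP.
  by rewrite /D; field; rewrite !gt_eqF.
have locP := Phi_loc hlc hrad hsupp hVD hE theta0 cphi csd q01 thetaD.
exists (pseries q (fun n => slope4 (phi n))).
  split=> //.
  - exact: (Phi_cont cphi q01).
  - exact: (Phi01 _ q01).
  - move=> y; rewrite -rho_0; exact: (Phi_inner cphi q01 rhoS).
  - move=> y ny; apply: (Phi_outer cphi q01) => n by_.
    by apply: ny; apply: le_ball by_; exact: rhor.
move=> U f Ff qf.
(* A point of U lies in the ball of radius rho N for some N since rho n tends to rho0 + r;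
   descending to the first such ball finds its shell. *)
have UE : U = \bigcup_n annulus x rho n.
  apply/seteqP; split=> [y [yb ny]|y [n _ [[yb _] ny]]]; last first.
    split; last by rewrite -rho_0.
    by apply: le_ball yb; exact: rhor.
  have [N yN] : exists N, ball x (rho N) y.
    move/ball_mdist: yb => yb.
    have e0 : 0 < (rho0 + r - mdist x y) / r by rewrite divr_gt0// subr_gt0.
    have : \forall n \near \oo, t ^+ n < (rho0 + r - mdist x y) / r.
      by apply: (cvgr_lt _ (cvg_geometric_q t01)).
    move=> [N _ /(_ N (leqnn N))] /=; rewrite ltr_pdivlMr// => tN.
    by exists N; apply/ball_mdist; rewrite /rho; lra.
  have nb0 : ~ ball x (rho 0) y.
    by rewrite rho_0 => h; apply: ny; exact: subset_closure.
  elim: N yN => [//|N IH yN].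
  have [/IH//|nb] := pselect (ball x (rho N) y).
  by exists N => //; split; [split|rewrite rho_0].
(* The test functions are quasi-continuous for E', whereas the hypothesis concerns those
   quasi-continuous for E. *)
have qfE : quasi_continuous m F E f := quasi_continuous_comparison C1 hC qf.
have -> : 4 * C * (CS * (1 - q) ^+ 2 / (1 - t) `^ ga) * (Psi betaL beta r)^-1 = 4 * C * D.
  by rewrite /D; field; rewrite !gt_eqF.
rewrite UE; exact: (annuli_estimate hlc hrad hsupp hVD hE theta0 cphi csd q01 thetaD
  rhoS hE' (ltW C0) hC hC' qC Ff qfE).
Qed.

End stability.

Theorem corollary5p2 (d : measure_display) (R : realType)
    (X : borelMetricType d R) (m : {measure set X -> \bar R})
    (betaL beta : R)
    (F : set (X -> R)) (E1 E2 : (X -> R) -> (X -> R) -> R) (C : R) :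
  locally_compact [set: X] ->
  radon_measure m ->
  measure_support m = [set: X] ->
  volume_doubling m ->
  2 <= betaL -> 2 <= beta ->
  dirichlet_form m F E1 -> regular_form m F E1 -> strongly_local m F E1 ->
  dirichlet_form m F E2 -> regular_form m F E2 -> strongly_local m F E2 ->
  1 <= C ->
  (forall f, F f -> C^-1 * E1 f f <= E2 f f <= C * E1 f f) ->
  CSA m F E1 (Psi betaL beta) <-> CSA m F E2 (Psi betaL beta).
Proof.
move=> hlc hrad hsupp hVD bL b2 hD1 hR1 hS1 hD2 hR2 hS2 C1 hC.
have C0 : 0 < C := lt_le_trans ltr01 C1.
have hC2 f : F f -> E2 f f <= C * E1 f f by move=> /hC /andP[].
have hC1 f : F f -> E1 f f <= C * E2 f f.
  by move=> /hC /andP[+ _]; rewrite mulrC ler_pdivrMr// mulrC.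
have hE1 : strongly_local_form m F E1 by [].
have hE2 : strongly_local_form m F E2 by [].
by split; apply: (CSA_transfer hlc hrad hsupp hVD) C1 _ _ bL b2.
Qed.
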